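(* Let $K\ge1$, let $n_1,\dots,n_K\ge2$ be integers and $\sigma_1,\dots,\sigma_K>0$. For $k=1,\dots,K$ let $X_{k,1},\dots,X_{k,n_k}$ be i.i.d. $N(0,\sigma_k^2)$, with the samples mutually independent across $k$. Let $$W_n:=\sum_{k=1}^K\frac{S_k^2}{n_k},\qquad S_k^2:=\frac1{n_k-1}\sum_{i=1}^{n_k}\left(X_{k,i}-\overline X_k\right)^2,\qquad \overline X_k:=\frac1{n_k}\sum_{i=1}^{n_k}X_{k,i},$$ $$\mu_n:=\sum_{k=1}^K\frac{\sigma_k^2}{n_k},\qquad \nu_n:=\frac{\left(\sum_{k=1}^K\sigma_k^2/n_k\right)^2}{\sum_{k=1}^K\sigma_k^4/(n_k^2(n_k-1))},\qquad \tau_{k,n}:=\frac{\sigma_k^2}{n_k(n_k-1)},$$ and let $U_n\sim\mathcal G_{\nu_n/2,\,2\mu_n/\nu_n}$. For $r=1,2$, set $$\Delta_n^{(r)}:=\max_{1\le k\le K}\left\{\left|\frac{\tau_{k,n}}{\mu_n/\nu_n}-1\right|\tau_{k,n}^r\right\}.$$ Then $$d_1(W_n,U_n)\le4\Delta_n^{(1)},\qquad d_2(W_n,U_n)\le8\Delta_n^{(2)}+2\mu_n e_{\nu_n/2}\Delta_n^{(1)}.$$ If $\nu_n>2$, then $$d_{\mathrm{Kol}}(W_n,U_n)\le2\left(\frac{\nu_n\Delta_n^{(1)}}{\mu_n\sqrt{2\pi(\nu_n/2-1)}\,r_{\nu_n/2}}\right)^{1/2}.$$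
   Context: For $a,b>0$, $\mathcal G_{a,b}$ denotes the Gamma distribution with shape $a$ and scale $b$, with density $p_{a,b}(x)=\frac{1}{\Gamma(a)b^a}x^{a-1}e^{-x/b}\mathbf 1_{\{x>0\}}$. For $\alpha>1$, $r_\alpha:=\exp\left(\frac1{12\alpha-11}\right)$. Distances. $\mathcal Z_1$ is the class of continuously differentiable $h:(0,\infty)\to\mathbb R$ with $\|h'\|_\infty\le1$; $\mathcal Z_2$ is the class of twice continuously differentiable $h:(0,\infty)\to\mathbb R$ with $\|h''\|_\infty\le1$. For positive random variables $X,Y$ with finite moments of order $j\in\{1,2\}$, $d_j(X,Y):=\sup_{h\in\mathcal Z_j}|\mathbb E[h(X)]-\mathbb E[h(Y)]|$. Also $d_{\mathrm{Kol}}(X,Y):=\sup_{z\in\mathbb R}|\mathbb P[X\le z]-\mathbb P[Y\le z]|$. The constant $e_a$, $a>0$. Write $P_{a,1}(x)=\int_0^xp_{a,1}(u)\,du$, $\overline P_{a,1}(x)=\int_x^\infty p_{a,1}(u)\,du$, $\underline{\mathrm P}^1_{a,1}(x)=\int_0^xP_{a,1}(u)\,du$, $\overline{\mathrm P}^1_{a,1}(x)=\int_x^\infty\overline P_{a,1}(u)\,du$, $\underline M_{a,1}(y)=\frac{P_{a,1}(y)}{y\,p_{a,1}(y)}$, $\overline M_{a,1}(y)=\frac{\overline P_{a,1}(y)}{y\,p_{a,1}(y)}$ for $x,y>0$, and $$C_{a,1}^2(z)=\overline M_{a,1}''(z)\int_0^z\underline{\mathrm P}^1_{a,1}(x)\,dx+\underline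 M_{a,1}''(z)\int_z^\infty\overline{\mathrm P}^1_{a,1}(x)\,dx,\qquad z>0.$$ Then $e_a:=\sup_{z>0}C_{a,1}^2(z)$, which is finite. *)

(* Defs.v *)
From HB Require Import structures.
From mathcomp Require Import all_boot all_order all_algebra.
From mathcomp Require Import all_classical all_reals all_analysis.
Set Implicit Arguments.
Unset Strict Implicit.
Unset Printing Implicit Defensive.
Import Order.TTheory GRing.Theory Num.Theory.
Import numFieldNormedType.Exports.
Local Open Scope classical_set_scope.
Local Open Scope ring_scope.

Section gamma_distribution.
Context {R : realType}.
Implicit Types a b x : R.

Definition gamma_function a : R :=
  \int[lebesgue_measure]_(t in `]0, +oo[) (t `^ (a - 1) * expR (- t)).

Definition gamma_pdf a b x : R :=
  if 0 < x then
    (gamma_function a * b `^ a)^-1 * x `^ (a - 1) * expR (- x / b)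
  else 0.

Definition gamma_prob a b (A : set R) : \bar R :=
  (\int[lebesgue_measure]_(x in A) (gamma_pdf a b x)%:E)%E.

Definition r_ (alpha : R) : R := expR (1 / (12 * alpha - 11)).

End gamma_distribution.

Section stein_constant.
Context {R : realType}.
Implicit Types a x y z : R.

Definition lowerP a x : R :=
  \int[lebesgue_measure]_(u in `]0, x[) gamma_pdf a 1 u.

Definition upperP a x : R :=
  \int[lebesgue_measure]_(u in `]x, +oo[) gamma_pdf a 1 u.

Definition lowerP1 a x : R :=
  \int[lebesgue_measure]_(u in `]0, x[) lowerP a u.

Definition upperP1 a x : R :=
  \int[lebesgue_measure]_(u in `]x, +oo[) upperP a u.

Definition lowerM a y : R := lowerP a y / (y * gamma_pdf a 1 y).

Definition upperM a y : R := upperP a y / (y * gamma_pdf a 1 y).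

Definition C2 a z : R :=
  derive1n 2 (upperM a) z *
    (\int[lebesgue_measure]_(x in `]0, z[) lowerP1 a x) +
  derive1n 2 (lowerM a) z *
    (\int[lebesgue_measure]_(x in `]z, +oo[) upperP1 a x).

Definition e_ a : \bar R := ereal_sup [set (C2 a z)%:E | z in `]0, +oo[].

End stein_constant.

Section distances.
Context {R : realType}.

(* A function on (0, +oo) is represented by a total function, whose values
   outside (0, +oo) are never used. *)
Definition Z_ (j : nat) : set (R -> R) :=
  [set h | forall x, 0 < x ->
    [/\ forall i, (i < j)%N -> derivable (derive1n i h) x 1,
        {for x, continuous (derive1n j h)} &
        `|derive1n j h x| <= 1]].

Context {d d' : measure_display} {T : measurableType d}
  {T' : measurableType d'}.

(* The restriction to (0, +oo) costs nothing for X that is positive almost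
   surely. *)
Definition expect_pos (d0 : measure_display) (T0 : measurableType d0) (P : probability T0 R)
    (X : T0 -> R) (h : R -> R) : \bar R :=
  'E_P[((h \_ `]0, +oo[) \o X)%R]%E.

Definition dist_Z (j : nat) (P : probability T R) (X : T -> R)
    (Q : probability T' R) (Y : T' -> R) : \bar R :=
  ereal_sup [set `|expect_pos P X h - expect_pos Q Y h|%E | h in Z_ j].

Definition dist_Kol (P : probability T R) (X : T -> R)
    (Q : probability T' R) (Y : T' -> R) : \bar R :=
  ereal_sup [set `|P [set w | (X w <= z)%R] - Q [set w | (Y w <= z)%R]|%E
            | z in [set: R]].

End distances.

Section random_variables.
Context {R : realType} {d : measure_display} {T : measurableType d}.
Variable P : probability T R.

Definition has_law (X : {RV P >-> R}) (mu : set R -> \bar R) : Prop :=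
  forall A : set R, measurable A -> distribution P X A = mu A.

Definition mutually_independent (I : finType) (X : I -> {RV P >-> R}) : Prop :=
  forall (J : {set I}) (A : I -> set R), (forall i, measurable (A i)) ->
    P (\bigcap_(i in [set` J]) X i @^-1` A i) =
    (\prod_(i in J) P (X i @^-1` A i))%E.

End random_variables.

Section statistics.
Context {R : realType} (K : nat) (n : 'I_K -> nat).

Section sample.
Context {T : Type} (X : forall k, 'I_(n k) -> T -> R).

Definition sample_mean k (w : T) : R :=
  (n k)%:R^-1 * \sum_(i < n k) X i w.

Definition sample_variance k (w : T) : R :=
  ((n k)%:R - 1)^-1 * \sum_(i < n k) (X i w - sample_mean k w) ^+ 2.

Definition W_stat (w : T) : R := \sum_(k < K) sample_variance k w / (n k)%:R.

End sample.

Variable sigma : 'I_K -> R.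

Definition mu_ : R := \sum_(k < K) sigma k ^+ 2 / (n k)%:R.

Definition nu_ : R :=
  (\sum_(k < K) sigma k ^+ 2 / (n k)%:R) ^+ 2 /
  \sum_(k < K) sigma k ^+ 4 / ((n k)%:R ^+ 2 * ((n k)%:R - 1)).

Definition tau_ (k : 'I_K) : R := sigma k ^+ 2 / ((n k)%:R * ((n k)%:R - 1)).

(* The terms are nonnegative, so starting from 0 does not change the maximum. *)
Definition Delta_ (r : nat) : R :=
  \big[Num.max/0]_(k < K) (`|tau_ k / (mu_ / nu_) - 1| * tau_ k ^+ r).

End statistics.

(* Main.v *)
(* Stein's method for the gamma law. Write [a := nu / 2], [b := 2 mu / nu], so that
   [a b = mu], and [V_k := S_k^2 / n_k], so that [W] is the sum of the [V_k]. For a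
   test function [h], let [f] solve [b x f'(x) + (a b - x) f(x) = h(x) - E h(U)].
   Gaussian integration by parts in each coordinate gives, for [e > 0],
     [E V_k g(W + e) = (sigma_k^2 / n_k) E g(W + e) + 2 tau_k E V_k g'(W + e)].
   Using it for [g = f] and then for [g = f'], the terms in [E f'(W + e)] cancel
   because the gamma law has the mean and the variance of [W], and
     [E h(W + e) - E h(U) = sum_k (b - 2 tau_k) 2 tau_k E V_k f''(W + e) + O(e)].
   Let [e] tend to [0]. As [|x f''(x)| <= 2 / b] for [h] in Z_1 and
   [|f''(x)| <= e_a / b] for [h] in Z_2, both smooth bounds follow. The first one
   yields the Kolmogorov bound by smoothing the indicator of a half-line, where the
   density of [U] is bounded by Robbins' form of Stirling's formula at [a - 1];
   that form holds since the ratio of the two sides decreases along [y, y + 1, ...]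
   and is asymptotically at least [1], by Laplace's method. *)
Require Import Defs.
From HB Require Import structures.
From mathcomp Require Import all_boot all_order all_algebra.
From mathcomp Require Import all_classical all_reals all_analysis.
From mathcomp Require Import measurable_realfun real_interval ring lra.
Set Implicit Arguments.
Unset Strict Implicit.
Unset Printing Implicit Defensive.
Import Order.TTheory GRing.Theory Num.Theory.
Import numFieldNormedType.Exports.
Local Open Scope classical_set_scope.
Local Open Scope ring_scope.

(** * Calculus on the half-line *)

Section real_calculus.
Context {R : realType}.
Implicit Types (F G f g : R -> R) (a b l x y : R).

(** The law of [W] is never computed: [V_k] is a multiple of the sum over [i] of [X_{k,i}] times its
    deviation from the sample mean, so integration by parts in each coordinate is enough. It
    requires functions that are differentiable along a whole line and of polynomial growth. Hence
    the shift [W + e], as [h] and [f] are known on []0, +oo[] only and [W] may vanish, and hence the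
    growth estimates on [f], [f'] and [x f''] next to the sharp bounds. The sharp bounds come from
    an exact formula for [f''], in which the integrals of [h' P] over []0, x[] and of [h' Q] over
    []x, +oo[] are weighted by second iterated tails of the gamma law. For [|h'| <= 1] a Wronskian
    identity evaluates the total weight. For [|h''| <= 1] one more integration by parts produces
    [4 cdf2 ccdf2 / (x^3 p)], the function of which [e_a] is the supremum. Inequalities between such
    integrals are proved without integrating: two functions with limit [0] at the same end of the
    half-line are compared through their derivatives. *)

Lemma deriveD_fun F G x (f g : R) : is_derive x 1 F f -> is_derive x 1 G g ->
  is_derive x 1 (fun t => F t + G t) (f + g).
Proof. by move=> ? ?; exact: is_deriveD. Qed.

Lemma deriveN_fun F x (f : R) : is_derive x 1 F f -> is_derive x 1 (fun t => - F t) (- f).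
Proof. by move=> ?; exact: is_deriveN. Qed.

Lemma deriveB_fun F G x (f g : R) : is_derive x 1 F f -> is_derive x 1 G g ->
  is_derive x 1 (fun t => F t - G t) (f - g).
Proof. by move=> ? ?; exact: is_deriveB. Qed.

Lemma deriveM_fun F G x (f g : R) : is_derive x 1 F f -> is_derive x 1 G g ->
  is_derive x 1 (fun t => F t * G t) (f * G x + F x * g).
Proof.
move=> dF dG; have H := is_deriveM dF dG; apply: is_derive_eq H _.
by rewrite /GRing.scale/= addrC mulrC.
Qed.

Lemma deriveV_fun F x (f : R) : F x != 0 -> is_derive x 1 F f ->
  is_derive x 1 (fun t => (F t)^-1) (- f / (F x) ^+ 2).
Proof.
move=> F0 dF; have H := is_deriveV F0 dF; apply: is_derive_eq H _.
by rewrite /GRing.scale/= mulrC mulNr mulrN.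
Qed.

Lemma deriveC_fun (c : R) x : is_derive x 1 (fun=> c) (0 : R).
Proof. exact: is_derive_cst. Qed.

Lemma deriveI_fun x : is_derive x 1 (fun t : R => t) 1.
Proof. exact: is_derive_id. Qed.

Lemma derive_comp F G x (f g : R) : is_derive (G x) 1 F f -> is_derive x 1 G g ->
  is_derive x 1 (fun t => F (G t)) (f * g).
Proof. by move=> dF dG; exact: is_derive1_comp. Qed.

Lemma is_derive_continuous F x (f : R) : is_derive x 1 F f -> {for x, continuous F}.
Proof. by move=> [dF _]; apply/differentiable_continuous/derivable1_diffP. Qed.

(* As [is_derive] is a class, a hypothesis of that form left to be proved would
   be submitted to instance resolution. *)
Definition has_derive F x (f : R) := is_derive x 1 F f.

Lemma is_derive_MVT F f a b : a <= b ->
  (forall x, a <= x <= b -> has_derive F x (f x)) ->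
  exists2 c, a <= c <= b & F b - F a = f c * (b - a).
Proof.
rewrite le_eqVlt => /predU1P[->|ab] dF.
  by exists b; [rewrite lexx|rewrite !subrr mulr0].
have [||c cab H] := @MVT R F f a b ab.
- by move=> x; rewrite in_itv/= => /andP[ax xb]; apply: dF; rewrite !ltW.
- apply: continuous_in_subspaceT => x; rewrite inE/= in_itv/= => xab.
  exact: is_derive_continuous (dF _ xab).
by exists c => //; move: cab; rewrite in_itv/= => /andP[? ?]; rewrite !ltW.
Qed.

Lemma is_derive_le F f a b : a <= b ->
  (forall x, a <= x <= b -> has_derive F x (f x)) ->
  (forall x, a <= x <= b -> 0 <= f x) -> F a <= F b.
Proof.
move=> ab dF f0; have [c cab H] := is_derive_MVT ab dF.
by rewrite -subr_ge0 H mulr_ge0 ?subr_ge0// f0.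
Qed.

Lemma is_derive_increment_le F f a b M : a <= b ->
  (forall x, a <= x <= b -> has_derive F x (f x)) ->
  (forall x, a <= x <= b -> `|f x| <= M) -> `|F b - F a| <= M * (b - a).
Proof.
move=> ab dF fM; have [c cab ->] := is_derive_MVT ab dF.
by rewrite normrM [X in _ * X]ger0_norm ?subr_ge0// ler_wpM2r ?subr_ge0// fM.
Qed.

Lemma is_derive_ge F f a b : a <= b ->
  (forall x, a <= x <= b -> has_derive F x (f x)) ->
  (forall x, a <= x <= b -> f x <= 0) -> F b <= F a.
Proof.
move=> ab dF f0; rewrite -lerN2.
apply: (@is_derive_le (fun x => - F x) (fun x => - f x)) => //.
- by move=> x xab; apply: deriveN_fun; exact: dF.
- by move=> x xab; rewrite oppr_ge0 f0.
Qed.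

(** [F] is nondecreasing on []0, b]]. With [l = 0] this yields the sign of a function known by its
    derivative and its limit at the open end. *)
Lemma ge_lim_right0 F f l b : 0 < b ->
  (forall x, 0 < x <= b -> has_derive F x (f x)) ->
  (forall x, 0 < x <= b -> 0 <= f x) ->
  F x @[x --> 0^'+] --> l -> l <= F b.
Proof.
move=> b0 dF f0 Fl; apply: (cvgr_to_le Fl); near=> x.
have x0 : 0 < x by near: x; exact: nbhs_right_gt.
have xb : x <= b by near: x; exact: nbhs_right_le.
apply: (@is_derive_le F f) => // t /andP[xt tb]; [apply: dF|apply: f0];
by rewrite tb (lt_le_trans x0).
Unshelve. all: by end_near. Qed.

Lemma ge_lim_pinfty F f l b :
  (forall x, b <= x -> has_derive F x (f x)) ->
  (forall x, b <= x -> f x <= 0) ->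
  F x @[x --> +oo] --> l -> l <= F b.
Proof.
move=> dF f0 Fl; apply: (cvgr_to_le Fl); near=> x.
have xb : b <= x by near: x; apply: nbhs_pinfty_ge; exact: num_real.
by apply: (@is_derive_ge F f) => // t /andP[xt tb]; [apply: dF|apply: f0].
Unshelve. all: by end_near. Qed.

Lemma le_lim_pinfty F f l b :
  (forall x, b <= x -> has_derive F x (f x)) ->
  (forall x, b <= x -> 0 <= f x) ->
  F x @[x --> +oo] --> l -> F b <= l.
Proof.
move=> dF f0 Fl; apply: (cvgr_to_ge Fl); near=> x.
have xb : b <= x by near: x; apply: nbhs_pinfty_ge; exact: num_real.
by apply: (@is_derive_le F f) => // t /andP[xt tb]; [apply: dF|apply: f0].
Unshelve. all: by end_near. Qed.

(** [G + F] and [G - F] are nondecreasing with limit [0] at [0]. It replaces the triangle inequality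
    for integrals from [0]; the version at infinity, where [G] decreases, does the same for
    tails. *)
Lemma norm_le_lim_right0 F G f g b : 0 < b ->
  (forall x, 0 < x <= b -> has_derive F x (f x)) ->
  (forall x, 0 < x <= b -> has_derive G x (g x)) ->
  (forall x, 0 < x <= b -> `|f x| <= g x) ->
  F x @[x --> 0^'+] --> 0 -> G x @[x --> 0^'+] --> 0 -> `|F b| <= G b.
Proof.
move=> b0 dF dG fg F0 G0; rewrite ler_norml -subr_ge0 opprK addrC -[X in _ && X]subr_ge0.
apply/andP; split.
  apply: (@ge_lim_right0 (fun x => G x + F x) (fun x => g x + f x)) => //.
  - by move=> x xb; exact: (deriveD_fun (dG _ xb) (dF _ xb)).
  - by move=> x xb; have := fg _ xb; rewrite ler_norml; lra.
  - by rewrite -[X in _ --> X](addr0 0); exact: cvgD.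
apply: (@ge_lim_right0 (fun x => G x - F x) (fun x => g x - f x)) => //.
- by move=> x xb; exact: (deriveB_fun (dG _ xb) (dF _ xb)).
- by move=> x xb; have := fg _ xb; rewrite ler_norml; lra.
- by rewrite -[X in _ --> X](subrr 0); exact: cvgB.
Qed.

Lemma norm_le_lim_pinfty F G f g b :
  (forall x, b <= x -> has_derive F x (f x)) ->
  (forall x, b <= x -> has_derive G x (g x)) ->
  (forall x, b <= x -> `|f x| <= - g x) ->
  F x @[x --> +oo] --> 0 -> G x @[x --> +oo] --> 0 -> `|F b| <= G b.
Proof.
move=> dF dG fg F0 G0; rewrite ler_norml -subr_ge0 opprK addrC -[X in _ && X]subr_ge0.
apply/andP; split.
  apply: (@ge_lim_pinfty (fun x => G x + F x) (fun x => g x + f x)) => //.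
  - by move=> x xb; exact: (deriveD_fun (dG _ xb) (dF _ xb)).
  - by move=> x xb; have := fg _ xb; rewrite ler_norml; lra.
  - by rewrite -[X in _ --> X](addr0 0); exact: cvgD.
apply: (@ge_lim_pinfty (fun x => G x - F x) (fun x => g x - f x)) => //.
- by move=> x xb; exact: (deriveB_fun (dG _ xb) (dF _ xb)).
- by move=> x xb; have := fg _ xb; rewrite ler_norml; lra.
- by rewrite -[X in _ --> X](subrr 0); exact: cvgB.
Qed.

Lemma cvg_norm_le0 {T : Type} {a : set_system T} {Fa : Filter a} (F G : T -> R) :
  (\near a, `|F a| <= G a) -> G x @[x --> a] --> 0 -> F x @[x --> a] --> 0.
Proof.
move=> FG G0.
have NG0 : - G x @[x --> a] --> 0.
  by rewrite -[X in _ --> X]oppr0; exact: cvgN.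
apply: squeeze_cvgr NG0 G0.
by apply: filterS FG => x; rewrite ler_norml.
Qed.

Lemma bounded_cvg0 (g G : R -> R) C :
  (\forall t \near 0^'+, `|g t| <= C) -> G t @[t --> 0^'+] --> 0 ->
  g t * G t @[t --> 0^'+] --> 0.
Proof.
move=> gC G0.
have H : C * `|G t| @[t --> 0^'+] --> 0.
  rewrite -[X in _ --> X](mulr0 C); apply: cvgM; first exact: cvg_cst.
  by rewrite -[X in _ --> X](normr0 R); exact: cvg_norm.
by apply: (cvg_norm_le0 _ H); apply: filterS gC => t gt; rewrite normrM ler_wpM2r.
Qed.

End real_calculus.

(** * Integrals over the half-line from primitives *)

Section half_line_integrals.
Context {R : realType}.
Local Notation mu := (@lebesgue_measure R).
Implicit Types (F f g : R -> R) (l x : R).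

Lemma derivable_segment_LRcontinuous F f a b :
  (forall x, a <= x <= b -> has_derive F x (f x)) -> a <= b ->
  derivable_oo_LRcontinuous F a b.
Proof.
move=> dF ab; split.
- move=> x; rewrite in_itv/= => /andP[/ltW ax /ltW xb].
  by have [] : is_derive x 1 F (f x) by apply: dF; rewrite ax.
- apply/cvg_at_right_filter/(@is_derive_continuous _ _ _ (f a)).
  by apply: dF; rewrite lexx.
- apply/cvg_at_left_filter/(@is_derive_continuous _ _ _ (f b)).
  by apply: dF; rewrite lexx andbT.
Qed.

Lemma integral_segment_is_derive F f a b : a < b ->
  (forall x, a <= x <= b -> {for x, continuous f}) ->
  (forall x, a <= x <= b -> has_derive F x (f x)) ->
  (\int[mu]_(x in `[a, b]) (f x)%:E = (F b - F a)%:E)%E.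
Proof.
move=> ab cf dF; rewrite (@continuous_FTC2 _ f F)//.
- by apply: continuous_in_subspaceT => x; rewrite inE/= in_itv/=; exact: cf.
- by apply: derivable_segment_LRcontinuous dF _; exact: ltW.
- move=> x; rewrite in_itv/= => /andP[/ltW ax /ltW xb].
  by rewrite derive1E; have [|_ ->//] := dF x; rewrite ax.
Qed.

Lemma itv_measurable f (i : interval R) :
  [set` i] `<=` `](0:R), +oo[ ->
  (forall x, 0 < x -> {for x, continuous f}) ->
  measurable_fun [set` i] f.
Proof.
move=> i0 cf; apply: (@measurable_funS _ _ _ _ (`](0:R), +oo[)) => //.
apply: open_continuous_measurable_fun; first exact: interval_open.
by move=> x; rewrite inE/= in_itv/= andbT; exact: cf.
Qed.

Lemma itv0_measurable f (i : itv_bound R) :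
  (forall x, 0 < x -> {for x, continuous f}) ->
  measurable_fun [set` Interval (BRight 0) i] f.
Proof.
move=> cf; apply: itv_measurable => //.
by apply: subset_itvl; case: i => // -[].
Qed.

Lemma itvy_measurable f (x : R) (b : bool) : 0 < x ->
  (forall x, 0 < x -> {for x, continuous f}) ->
  measurable_fun [set` Interval (BSide b x) +oo%O] f.
Proof.
move=> x0 cf; apply: itv_measurable => //; apply: subset_itvr.
by case: b; rewrite bnd_simp// ltW.
Qed.

(** The integrand may be unbounded at [0], so the fundamental theorem is applied on segments that
    increase to []0, x]], and monotone convergence concludes. *)
Lemma ge0_integral_0x F f l x : 0 < x ->
  (forall x, 0 < x -> {for x, continuous f}) ->
  (forall x, 0 < x -> 0 <= f x) ->
  (forall x, 0 < x -> has_derive F x (f x)) ->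
  F x @[x --> 0^'+] --> l ->
  (\int[mu]_(t in `]0%R, x[) (f t)%:E = (F x - l)%:E)%E.
Proof.
move=> x0 cf f0 dF Fl.
rewrite integral_itv_bndo_bndc; last first.
  apply/measurable_EFinP; exact: itv0_measurable.
(* [n.+2], and not [n.+1], so that every segment is nondegenerate. *)
pose S n := `[x / n.+2%:R, x]%classic.
have xn0 n : 0 < x / n.+2%:R by rewrite divr_gt0.
have SU : \bigcup_n S n = `]0, x]%classic.
  rewrite eqEsubset; split => [t [n _]|t] /=; rewrite /S /= !in_itv/=.
    by move=> /andP[xt ->]; rewrite andbT (lt_le_trans _ xt).
  move=> /andP[t0 tx].
  have [n xtn] : exists n : nat, x / t <= n%:R.
    by exists (Num.bound (x / t)); rewrite ltW// archi_boundP// divr_ge0// ltW.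
  exists n => //=; rewrite in_itv/= tx andbT.
  rewrite ler_pdivrMr// mulrC -ler_pdivrMr// (le_trans xtn)// ler_nat.
  by rewrite -addn2 leq_addr.
have SFn n : (\int[mu]_(t in S n) (f t)%:E = (F x - F (x / n.+2%:R))%:E)%E.
  apply: integral_segment_is_derive.
  - by rewrite ltr_pdivrMr// ltr_pMr// ltr1n.
  - by move=> t /andP[xt _]; apply: cf; rewrite (lt_le_trans _ xt).
  - by move=> t /andP[xt _]; apply: dF; rewrite (lt_le_trans _ xt).
rewrite -SU.
have : (\int[mu]_(t in S i) (f t)%:E)%E @[i --> \oo] -->
       (\int[mu]_(t in \bigcup_n S n) (f t)%:E)%E.
  apply: ge0_nondecreasing_set_cvg_integral => //.
  - apply/nondecreasing_seqP => n; rewrite subsetEset; apply: subset_itvr.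
    by rewrite bnd_simp ler_pM2l// lef_pV2 ?posrE// ler_nat.
  - move=> n; exact: measurable_itv.
  - by move=> n; apply/measurable_EFinP; apply: itv_measurable => // t;
      rewrite /= !in_itv/= andbT => /andP[/(lt_le_trans (xn0 n))].
  - move=> n t; rewrite /S/= in_itv/= => /andP[/(lt_le_trans (xn0 n)) t0 _].
    by rewrite lee_fin f0.
move=> /cvg_lim <- //; apply: cvg_lim => //.
under eq_cvg do rewrite SFn.
apply: cvg_EFin; first exact: nearW.
rewrite (_ : _ \o _ = fun n => F x - F (x / n.+2%:R))//.
apply: cvgB; first exact: cvg_cst.
move/cvg_at_rightP : Fl; apply; split => //.
rewrite -[0](mulr0 x); apply: cvgMr.
apply/gtr0_cvgV0; first exact: nearW.
have /(cvg_comp _ _ (cvg_addnl 2)) := @cvgr_idn R.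
exact.
Qed.

Lemma ge0_integral_xy F f l x : 0 < x ->
  (forall x, 0 < x -> {for x, continuous f}) ->
  (forall x, 0 < x -> 0 <= f x) ->
  (forall x, 0 < x -> has_derive F x (f x)) ->
  F x @[x --> +oo] --> l ->
  (\int[mu]_(t in `]x, +oo[) (f t)%:E = (l - F x)%:E)%E.
Proof.
move=> x0 cf f0 dF Fl.
rewrite integral_itv_obnd_cbnd; last first.
  apply/measurable_EFinP; exact: itvy_measurable.
rewrite (@ge0_continuous_FTC2y _ f F x l)//.
- by move=> t xt; apply/f0/(lt_le_trans x0).
- apply: continuous_in_subspaceT => t; rewrite inE/= in_itv/= andbT => xt.
  by apply/cf/(lt_le_trans x0).
- by move=> t xt; have [] := dF t (lt_trans x0 xt).
- exact/cvg_at_right_filter/(is_derive_continuous (dF _ x0)).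
- move=> t; rewrite in_itv/= andbT => xt.
  by rewrite derive1E; have [_ ->] := dF t (lt_trans x0 xt).
Qed.

Lemma integral0y_split f x : 0 < x -> measurable_fun `](0:R), +oo[ f ->
  (forall x, 0 < x -> 0 <= f x) ->
  (\int[mu]_(t in `]0%R, +oo[) (f t)%:E =
   \int[mu]_(t in `]0%R, x[) (f t)%:E + \int[mu]_(t in `]x, +oo[) (f t)%:E)%E.
Proof.
move=> x0 mf f0.
rewrite [X in (_ = _ + X)%E]integral_itv_obnd_cbnd; last first.
  apply/measurable_EFinP; apply: measurable_funS mf => //.
  by apply: subset_itvr; rewrite bnd_simp ltW.
rewrite -ge0_integral_setU//=.
- congr (\int[mu]_(t in _) _)%E.
  by rewrite -itv_bndbnd_setU// ?bnd_simp// ltW.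
- rewrite -itv_bndbnd_setU ?bnd_simp//; first exact/measurable_EFinP.
- move=> t; rewrite lee_fin => -[] /=; rewrite !in_itv/=.
  + by move=> /andP[/f0].
  + by rewrite andbT => xt; apply/f0/(lt_le_trans x0).
- apply/disj_setPS => t [/=]; rewrite !in_itv/= andbT => /andP[_ tx].
  by rewrite leNgt tx.
Qed.

Lemma ge0_integral_0y F f l l' :
  (forall x, 0 < x -> {for x, continuous f}) ->
  (forall x, 0 < x -> 0 <= f x) ->
  (forall x, 0 < x -> has_derive F x (f x)) ->
  F x @[x --> 0^'+] --> l -> F x @[x --> +oo] --> l' ->
  (\int[mu]_(t in `]0%R, +oo[) (f t)%:E = (l' - l)%:E)%E.
Proof.
move=> cf f0 dF Fl Fl'.
rewrite (@integral0y_split _ 1)//; last exact: itv0_measurable.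
rewrite (ge0_integral_0x _ _ _ _ Fl)// (ge0_integral_xy _ _ _ _ Fl')//.
by rewrite -EFinD; congr EFin; ring.
Qed.

Lemma Rintegral_tail g x : 0 < x -> mu.-integrable `]0%R, +oo[ (EFin \o g) ->
  \int[mu]_(t in `]x, +oo[) g t =
  \int[mu]_(t in `]0, +oo[) g t - \int[mu]_(t in `]0, x[) g t.
Proof.
move=> x0 ig; rewrite (@Rintegral_itv_bndo_bndc _ (BRight 0) x); last first.
  by apply: integrableS ig => //; exact: subset_itvl.
by rewrite Rintegral_itvB//; rewrite bnd_simp ltW.
Qed.

Section dominated_primitive.
Variables (g G phi Phi : R -> R) (l : R).
Hypothesis cg : forall x, 0 < x -> {for x, continuous g}.
Hypothesis cphi : forall x, 0 < x -> {for x, continuous phi}.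
Hypothesis gphi : forall x, 0 < x -> `|g x| <= phi x.
Hypothesis dPhi : forall x, 0 < x -> has_derive Phi x (phi x).
Hypothesis Phi0 : Phi x @[x --> 0^'+] --> 0.
Hypothesis Phiy : Phi x @[x --> +oo] --> l.

Let phi0 x : 0 < x -> 0 <= phi x.
Proof. by move=> /gphi; exact: le_trans. Qed.

(** Signed integrands are treated by domination: [phi] has a known primitive with limits [0] and
    [l]. This gives integrability here, and below it bounds the primitive of [g] near both ends. *)
Lemma dominated_integrable0y : mu.-integrable `]0%R, +oo[ (EFin \o g).
Proof.
have iphi : mu.-integrable `]0%R, +oo[ (EFin \o phi).
  apply/integrableP; split.
    apply/measurable_EFinP; exact: itv0_measurable.
  have -> : (\int[mu]_(x in `]0%R, +oo[) `|(EFin \o phi) x| =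
             \int[mu]_(x in `]0%R, +oo[) (phi x)%:E)%E.
    apply: eq_integral => x; rewrite inE/= in_itv/= andbT => x0.
    by rewrite ger0_norm// phi0.
  by rewrite (@ge0_integral_0y Phi phi _ _ _ _ _ Phi0 Phiy)// ltry.
apply: (le_integrable _ _ _ iphi) => //.
- apply/measurable_EFinP; exact: itv0_measurable.
- move=> x /=; rewrite in_itv/= andbT => x0.
  by rewrite lee_fin (le_trans (gphi x0))// ler_norm.
Qed.

Let H x := \int[mu]_(t in `]0, x[) g t.

Let igS (i : interval R) : [set` i] `<=` `]0, +oo[%classic ->
  mu.-integrable [set` i] (EFin \o g).
Proof. by move=> iS; apply: integrableS dominated_integrable0y. Qed.

Lemma dominated_primitive_derive x : 0 < x -> is_derive x 1 H (g x).
Proof.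
move=> x0.
have x1 : x < x + 1 by rewrite ltrDl.
have i1 : mu.-integrable [set` Interval (BRight 0) (BRight (x + 1))] (EFin \o g).
  by apply: igS; exact: subset_itvl.
have [dH Hg] := continuous_FTC1 x1 i1 (x0 : (BRight 0 < BRight x)%O) (cg x0).
rewrite (_ : H = fun y => \int[mu]_(t in [set` Interval (BRight 0) (BRight y)]) g t).
  by rewrite -Hg derive1E; exact: derivableP.
apply/funext => y; rewrite /H Rintegral_itv_bndo_bndc//.
by apply: igS; apply: subset_itvl.
Qed.

Lemma dominated_primitive_norm x : 0 < x -> `|H x| <= Phi x.
Proof.
move=> x0; apply: (le_trans (le_normr_Rintegral _ _)) => //.
  by apply: igS; exact: subset_itvl.
rewrite -lee_fin; have -> : Phi x = Phi x - 0 by rewrite subr0.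
rewrite -(ge0_integral_0x x0 cphi phi0 dPhi Phi0) /Rintegral fineK; last first.
  apply: integrable_fin_num => //; apply: integrable_norm.
  by apply: igS; exact: subset_itvl.
apply: ge0_le_integral => //.
- apply/measurable_EFinP/measurableT_comp => //; exact: itv0_measurable.
- apply/measurable_EFinP; exact: itv0_measurable.
- by move=> t /=; rewrite in_itv/= => /andP[t0 _]; rewrite lee_fin gphi.
Qed.

Lemma dominated_primitive_tail x : 0 < x ->
  `|\int[mu]_(t in `]0, +oo[) g t - H x| <= l - Phi x.
Proof.
move=> x0.
have -> : \int[mu]_(t in `]0, +oo[) g t - H x = \int[mu]_(t in `]x, +oo[) g t.
  by rewrite Rintegral_tail//; exact: dominated_integrable0y.
have ix : mu.-integrable `]x, +oo[ (EFin \o g).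
  by apply: igS; apply: subset_itvr; rewrite bnd_simp ltW.
have xy0 t : `]x, +oo[%classic t -> 0 < t.
  by rewrite /= in_itv/= andbT; exact: lt_trans.
apply: (le_trans (le_normr_Rintegral _ _)) => //.
rewrite -lee_fin -(ge0_integral_xy x0 cphi phi0 dPhi Phiy) /Rintegral fineK; last first.
  by apply: integrable_fin_num => //; exact: integrable_norm.
apply: ge0_le_integral => //.
- by apply/measurable_EFinP/measurableT_comp => //; apply/measurable_EFinP; case/integrableP: ix.
- apply/measurable_EFinP; exact: itvy_measurable.
- by move=> t /xy0 t0; rewrite lee_fin gphi.
Qed.

Lemma dominated_primitive_cvg0 : H x @[x --> 0^'+] --> 0.
Proof.
apply: (cvg_norm_le0 _ Phi0); near=> x; rewrite dominated_primitive_norm//.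
Unshelve. all: by end_near. Qed.

Lemma dominated_primitive_cvgy :
  H x @[x --> +oo] --> \int[mu]_(t in `]0, +oo[) g t.
Proof.
apply/subr_cvg0.
have lPhi : l - Phi x @[x --> +oo] --> 0.
  by rewrite -[X in _ --> X](subrr l); apply: cvgB => //; exact: cvg_cst.
apply: (cvg_norm_le0 _ lPhi); near=> x; rewrite distrC dominated_primitive_tail//.
Unshelve. all: by end_near. Qed.

End dominated_primitive.

End half_line_integrals.

(** * The gamma density and its tails *)

Section gamma_density.
Context {R : realType}.
Local Notation mu := (@lebesgue_measure R).
Implicit Types (a b t x : R) (m : nat).

Lemma powR_expR t x : 0 < t -> t `^ x = expR (x * ln t).
Proof. by move=> t0; rewrite /powR gt_eqF. Qed.

(** A comparison function: its derivative [phi] behaves like [t^(a - 1)] at [0] and like [t^(-2)] at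
    infinity, so a multiple of it dominates any polynomial times the gamma weight, and it is
    integrated in closed form. *)
Let Phi a t := (t / (1 + t)) `^ a.
Let phi a t := a * (t / (1 + t)) `^ (a - 1) * (1 + t) ^- 2.

Lemma Phi_derive a t : 0 < t -> is_derive t 1 (Phi a) (phi a t).
Proof.
move=> t0; have t1 : 1 + t != 0 by rewrite gt_eqF// addr_gt0.
have dq : is_derive t 1 (fun t => t / (1 + t)) ((1 + t) ^- 2).
  apply: is_derive_eq (deriveM_fun (deriveI_fun t) (deriveV_fun t1
    (deriveD_fun (deriveC_fun 1 t) (deriveI_fun t)))) _.
  by field.
have q0 : 0 < t / (1 + t) by rewrite divr_gt0// addr_gt0.
rewrite /Phi /phi.
exact: (@derive_comp _ (fun u => u `^ a) (fun t => t / (1 + t)) t _ _ (is_derive1_powR _ q0) dq).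
Qed.

Lemma phi_continuous a t : 0 < t -> {for t, continuous (phi a)}.
Proof.
move=> t0; have t1 : 1 + t != 0 by rewrite gt_eqF// addr_gt0.
apply: cvgM.
  apply: cvgM; first exact: cvg_cst.
  have -> : (fun x => (x / (1 + x)) `^ (a - 1)) = Phi (a - 1) by [].
  exact: (is_derive_continuous (Phi_derive _ t0)).
apply: cvgV; first by rewrite expf_neq0.
apply: (@continuous_comp _ _ _ (fun t => 1 + t) (fun t => t ^+ 2)).
  by apply: cvgD; [exact: cvg_cst|exact: cvg_id].
exact: exprn_continuous.
Qed.

Lemma Phi_cvg0 a : 0 < a -> Phi a x @[x --> 0^'+] --> 0.
Proof.
move=> a0; apply: (cvg_norm_le0 _ (powR_cvg0 a0)); near=> t.
have t0 : 0 < t by near: t; exact: nbhs_right_gt.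
rewrite ger0_norm ?powR_ge0// ge0_ler_powR ?nnegrE ?ltW// ?divr_gt0 ?addr_gt0//.
by rewrite ltr_pdivrMr ?addr_gt0// ltr_pMr// ltrDl.
Unshelve. all: by end_near. Qed.

Lemma ratio1D_cvgy : t / (1 + t) @[t --> +oo] --> (1 : R).
Proof.
have H : 1 - (1 + t)^-1 @[t --> +oo] --> (1 : R).
  rewrite -[X in _ --> X]subr0; apply: cvgB; first exact: cvg_cst.
  apply/gtr0_cvgV0; last exact: cvg_addrl.
  by near=> t; rewrite addr_gt0//; near: t; apply: nbhs_pinfty_gt; exact: num_real.
apply: cvg_trans H; apply: near_eq_cvg; near=> t.
have t1 : 1 + t != 0.
  by rewrite gt_eqF// addr_gt0//; near: t; apply: nbhs_pinfty_gt; exact: num_real.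
by field.
Unshelve. all: by end_near. Qed.

Lemma Phi_cvgy a : Phi a x @[x --> +oo] --> (1 : R).
Proof.
have {1}-> : (1 : R) = 1 `^ a by rewrite powR1.
have C1 : {for (1 : R), continuous (fun u : R => u `^ a)}.
  exact: is_derive_continuous (is_derive1_powR a ltr01).
exact: continuous_cvg C1 ratio1D_cvgy.
Qed.

Lemma phi_cvgy a : phi a x @[x --> +oo] --> 0.
Proof.
rewrite -[X in _ --> X](mulr0 (a * 1)); apply: cvgM.
  by apply: cvgM; [exact: cvg_cst|exact: (Phi_cvgy (a - 1))].
have V0 : (1 + t)^-1 @[t --> +oo] --> (0 : R).
  apply/gtr0_cvgV0; last exact: cvg_addrl.
  by near=> t; rewrite addr_gt0//; near: t; apply: nbhs_pinfty_gt; exact: num_real.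
have -> : (fun t : R => (1 + t) ^- 2) = (fun t => (1 + t)^-1 * (1 + t)^-1).
  by apply/funext => t; rewrite -exprVn expr2.
by rewrite -[X in _ --> X](mulr0 0); exact: cvgM.
Unshelve. all: by end_near. Qed.

(* [N ln (1 + t) <= N ln L + (1 + t) / b - N] for [L := N b], by concavity of [ln] *)
Lemma gamma_weight_le a b m : 0 < a -> 0 < b -> exists2 C, 0 <= C &
  forall t, 0 < t -> (1 + t) ^+ m * (t `^ (a - 1) * expR (- t / b)) <= C * phi a t.
Proof.
(* [N] collects [m] and the [a + 1] of [phi a t = a t^(a - 1) (1 + t)^(- (a + 1))]. *)
move=> a0 b0; pose N := m%:R + 1 + a; pose L := N * b.
have N0 : 0 < N by rewrite /N addr_gt0// ltr_wpDl.
have L0 : 0 < L by rewrite mulr_gt0.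
exists (expR (N * ln L + b^-1 - N) / a); first by rewrite divr_ge0 ?expR_ge0// ltW.
move=> t t0; have t1 : 0 < 1 + t by rewrite addr_gt0.
have lnt : ln (1 + t) <= ln L + (1 + t) / L - 1.
  have -> : ln (1 + t) = ln L + ln ((1 + t) / L).
    by rewrite -lnM ?posrE ?divr_gt0//; congr ln; field; rewrite gt_eqF.
  rewrite -addrA lerD2l.
  have := @le_ln1Dx R ((1 + t) / L - 1); rewrite (_ : 1 + ((1 + t) / L - 1) = (1 + t) / L); last by ring.
  apply.
  by rewrite ltrBrDl subrr divr_gt0.
have key : N * ln (1 + t) - t / b <= N * ln L + b^-1 - N.
  have : N * ln (1 + t) <= N * (ln L + (1 + t) / L - 1) by rewrite ler_pM2l.
  have -> : N * (ln L + (1 + t) / L - 1) = N * ln L + b^-1 - N + t / b.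
    by rewrite /L; field; rewrite !gt_eqF.
  by lra.
rewrite /phi !powR_expR ?divr_gt0// lnM ?posrE ?invr_gt0// lnV ?posrE//.
have -> : (1 + t) ^- 2 = expR (- 2 * ln (1 + t)).
  by rewrite mulNr expRN (expRM_natl 2) lnK.
have -> : (1 + t) ^+ m = expR (m%:R * ln (1 + t)) by rewrite expRM_natl lnK.
rewrite [leRHS](_ : _ = expR (N * ln L + b^-1 - N) *
    (expR ((a - 1) * (ln t - ln (1 + t))) * expR (- 2 * ln (1 + t)))); last first.
  by field; rewrite gt_eqF.
rewrite -!expRD ler_expR.
have : m%:R * ln (1 + t) = N * ln (1 + t) - (1 + a) * ln (1 + t).
  by rewrite /N; ring.
have := key.
rewrite mulNr mulrBr; set u := ln (1 + t); set v := ln t; set w := ln L.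
move=> k1 ->; have -> : (1 + a) * u = (a - 1) * u + 2 * u by ring.
by lra.
Qed.

Lemma derive_expR_lin (c t : R) :
  is_derive t 1 (fun t => expR (- t / c)) (- c^-1 * expR (- t / c)).
Proof.
have dl : is_derive t 1 (fun t => - t / c) (- c^-1).
  apply: is_derive_eq (deriveM_fun (deriveN_fun (deriveI_fun t)) (deriveC_fun c^-1 t)) _.
  by ring.
rewrite mulrC.
exact: (@derive_comp _ expR (fun t => - t / c) t _ _ (is_derive_expR _) dl).
Qed.

Lemma gamma_weight_derive a b t : 0 < t ->
  b != 0 -> is_derive t 1 (fun t => t `^ (a - 1) * expR (- t / b))
    (((a - 1) / t - b^-1) * (t `^ (a - 1) * expR (- t / b))).
Proof.
move=> t0 b0.
apply: is_derive_eq (deriveM_fun (is_derive1_powR (a - 1) t0) (derive_expR_lin b t)) _.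
have -> : t `^ (a - 1 - 1) = t `^ (a - 1) / t.
  by rewrite powRB ?(gt_eqF t0) ?implybT// powRr1// ltW.
field.
by rewrite b0 gt_eqF.
Qed.

Lemma gamma_pdf_pos a b t : 0 < t -> gamma_pdf a b t =
  (gamma_function a * b `^ a)^-1 * (t `^ (a - 1) * expR (- t / b)).
Proof. by move=> t0; rewrite /gamma_pdf t0 mulrA. Qed.

Lemma gamma_pdf_derive a b t : 0 < t -> b != 0 ->
  is_derive t 1 (gamma_pdf a b) (((a - 1) / t - b^-1) * gamma_pdf a b t).
Proof.
move=> t0 b0; pose k := (gamma_function a * b `^ a)^-1.
apply: (@near_eq_is_derive _ _ _ (fun t => k * (t `^ (a - 1) * expR (- t / b)))).
  near=> s; rewrite gamma_pdf_pos//; near: s; exact: lt_nbhsr.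
apply: is_derive_eq (deriveM_fun (deriveC_fun k t) (gamma_weight_derive a t0 b0)) _.
by rewrite gamma_pdf_pos// -/k mul0r add0r mulrCA.
Unshelve. all: by end_near. Qed.

Lemma gamma_pdf_continuous a b t : 0 < t -> b != 0 -> {for t, continuous (gamma_pdf a b)}.
Proof. by move=> t0 b0; exact: is_derive_continuous (gamma_pdf_derive a t0 b0). Qed.

Section gamma_moments.
Variables (a b : R).
Hypothesis a0 : 0 < a.
Hypothesis b0 : 0 < b.

Let dPhiC C t : 0 < t -> is_derive t 1 (fun t => C * Phi a t) (C * phi a t).
Proof.
move=> t0; apply: is_derive_eq (deriveM_fun (deriveC_fun C t) (Phi_derive a t0)) _.
by rewrite mul0r add0r.
Qed.

Let cphiC C t : 0 < t -> {for t, continuous (fun t => C * phi a t)}.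
Proof. by move=> t0; apply: cvgM; [exact: cvg_cst|exact: phi_continuous]. Qed.

Let PhiC0 C : C * Phi a t @[t --> 0^'+] --> 0.
Proof.
by rewrite -[X in _ --> X](mulr0 C); apply: cvgM; [exact: cvg_cst|exact: Phi_cvg0].
Qed.

Let PhiCy C : C * Phi a t @[t --> +oo] --> C.
Proof.
rewrite -[X in _ --> X](mulr1 C).
by apply: cvgM; [exact: cvg_cst|exact: Phi_cvgy].
Qed.

Section weighted_primitive.
Variables (g : R -> R) (K : R) (m : nat).
Hypothesis cg : forall t, 0 < t -> {for t, continuous g}.
Hypothesis gK : forall t, 0 < t ->
  `|g t| <= K * ((1 + t) ^+ m * (t `^ (a - 1) * expR (- t / b))).

Let dom : exists C, forall t, 0 < t -> `|g t| <= C * phi a t.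
Proof.
have [C C0 HC] := gamma_weight_le m a0 b0.
exists (`|K| * C) => t t0; apply: (le_trans (gK t0)).
rewrite -mulrA; apply: (@le_trans _ _ (`|K| * ((1 + t) ^+ m * (t `^ (a - 1) * expR (- t / b))))).
  rewrite ler_wpM2r ?ler_norm// !mulr_ge0 ?exprn_ge0 ?powR_ge0 ?expR_ge0//.
  by rewrite addr_ge0 ?ltW.
by rewrite ler_wpM2l// HC.
Qed.

(** This lemma and the next three serve the density, its product with a test function and the
    integrand of the gamma function alike: only continuity and a polynomial multiple of the gamma
    weight have to be supplied. *)
Lemma weighted_integrable : mu.-integrable `]0%R, +oo[ (EFin \o g).
Proof.
have [C HC] := dom.
exact: (@dominated_integrable0y R g (fun t => C * phi a t)
  (fun t => C * Phi a t) C cg (@cphiC C) HC (@dPhiC C) (@PhiC0 C) (@PhiCy C)).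
Qed.

Let H x := \int[mu]_(t in `]0, x[) g t.

Lemma weighted_primitive_derive x : 0 < x -> is_derive x 1 H (g x).
Proof.
have [C HC] := dom.
exact: (@dominated_primitive_derive R g (fun t => C * phi a t)
  (fun t => C * Phi a t) C cg (@cphiC C) HC (@dPhiC C) (@PhiC0 C) (@PhiCy C) x).
Qed.

Lemma weighted_primitive_cvg0 : H x @[x --> 0^'+] --> 0.
Proof.
have [C HC] := dom.
exact: (@dominated_primitive_cvg0 R g (fun t => C * phi a t)
  (fun t => C * Phi a t) C cg (@cphiC C) HC (@dPhiC C) (@PhiC0 C) (@PhiCy C)).
Qed.

Lemma weighted_primitive_cvgy : H x @[x --> +oo] --> \int[mu]_(t in `]0, +oo[) g t.
Proof.
have [C HC] := dom.
exact: (@dominated_primitive_cvgy R g (fun t => C * phi a t)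
  (fun t => C * Phi a t) C cg (@cphiC C) HC (@dPhiC C) (@PhiC0 C) (@PhiCy C)).
Qed.

End weighted_primitive.

Lemma gamma_weight_cvgy m :
  (1 + t) ^+ m * (t `^ (a - 1) * expR (- t / b)) @[t --> +oo] --> 0.
Proof.
have [C C0 HC] := gamma_weight_le m a0 b0.
have phiC : C * phi a t @[t --> +oo] --> 0.
  rewrite -[X in _ --> X](mulr0 C).
  by apply: cvgM; [exact: cvg_cst|exact: phi_cvgy].
apply: (cvg_norm_le0 _ phiC); near=> t.
have t0 : 0 < t by near: t; apply: nbhs_pinfty_gt; exact: num_real.
rewrite ger0_norm ?HC// !mulr_ge0 ?exprn_ge0 ?powR_ge0 ?expR_ge0//.
by rewrite addr_ge0 ?ltW.
Unshelve. all: by end_near. Qed.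

End gamma_moments.

(** The primitive [H] of the integrand is nondecreasing, and the mean value theorem makes it
    increase strictly from [1] to [2], which keeps its limit at infinity away from [0]. *)
Lemma gamma_function_gt0 a : 0 < a -> 0 < gamma_function a.
Proof.
move=> a0; pose g (t : R) := t `^ (a - 1) * expR (- t / 1).
have cg t : 0 < t -> {for t, continuous g}.
  by move=> t0; exact: is_derive_continuous (gamma_weight_derive a t0 (oner_neq0 R)).
have g0 t : 0 < t -> 0 < g t by move=> t0; rewrite mulr_gt0 ?expR_gt0 ?powR_gt0.
have gK t : 0 < t -> `|g t| <= 1 * ((1 + t) ^+ 0 * g t).
  by move=> t0; rewrite expr0 !mul1r ger0_norm// ltW// g0.
have dH := weighted_primitive_derive a0 ltr01 cg gK.
have H0 := weighted_primitive_cvg0 a0 ltr01 cg gK.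
have Hy := weighted_primitive_cvgy a0 ltr01 cg gK.
set H := (fun x : R => \int[mu]_(t in `]0, x[) g t) in dH H0 Hy.
have -> : gamma_function a = \int[mu]_(t in `]0, +oo[) g t.
  by apply: eq_Rintegral => t _; rewrite /g divr1.
have H1 : 0 <= H 1.
  apply: (ge_lim_right0 ltr01 _ _ H0) => x /andP[x0 _]; first exact: dH.
  exact/ltW/g0.
have H2 : H 2 <= \int[mu]_(t in `]0, +oo[) g t.
  apply: (le_lim_pinfty _ _ Hy) => x x2; first by apply: dH; lra.
  by apply/ltW/g0; lra.
apply: lt_le_trans H2; apply: le_lt_trans H1 _.
have [|||c] := @MVT R H g 1 2.
- by lra.
- by move=> x; rewrite in_itv/= => /andP[x1 _]; apply: dH; lra.
- apply: continuous_in_subspaceT => x; rewrite inE/= in_itv/= => /andP[x1 _].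
  by apply: (is_derive_continuous (dH x _)); lra.
rewrite in_itv/= => /andP[c1 _] H12; rewrite -subr_gt0 H12 mulr_gt0 ?g0//; lra.
Qed.

End gamma_density.

Section gamma_tails.
Context {R : realType}.
Local Notation mu := (@lebesgue_measure R).
Variable a : R.
Hypothesis a0 : 0 < a.
Implicit Types x t : R.

Let p := gamma_pdf a 1.
Let P := lowerP a.
Let Q := upperP a.

Let k := (gamma_function a * 1 `^ a)^-1.

Let k_gt0 : 0 < k.
Proof. by rewrite /k powR1 mulr1 invr_gt0 gamma_function_gt0. Qed.

Lemma gamma_pdf1_gt0 x : 0 < x -> 0 < p x.
Proof.
move=> x0; rewrite /p gamma_pdf_pos// -/k mulr_gt0// mulr_gt0 ?expR_gt0//.
by rewrite powR_gt0.
Qed.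
Let p_gt0 := gamma_pdf1_gt0.

Lemma gamma_pdf1_derive x : 0 < x -> is_derive x 1 p (((a - 1) / x - 1) * p x).
Proof.
by move=> x0; have := gamma_pdf_derive a x0 (oner_neq0 R); rewrite invr1.
Qed.
Let dp := gamma_pdf1_derive.

Lemma gamma_pdf1_mulx_derive x : 0 < x ->
  is_derive x 1 (fun t => t * p t) ((a - x) * p x).
Proof.
move=> x0; apply: is_derive_eq (deriveM_fun (deriveI_fun x) (dp x0)) _.
by field; rewrite gt_eqF.
Qed.
Let dxp := gamma_pdf1_mulx_derive.

Let cp x : 0 < x -> {for x, continuous p}.
Proof. by move=> x0; exact: is_derive_continuous (dp x0). Qed.

Let pK x : 0 < x -> `|p x| <= k * ((1 + x) ^+ 0 * (x `^ (a - 1) * expR (- x / 1))).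
Proof.
move=> x0; rewrite ger0_norm ?(ltW (p_gt0 x0))//.
by rewrite expr0 mul1r /p gamma_pdf_pos.
Qed.

Lemma gamma_pdf1_integrable : mu.-integrable `]0%R, +oo[ (EFin \o p).
Proof. exact: (weighted_integrable a0 ltr01 cp pK). Qed.

Lemma gamma_pdf1_integral : \int[mu]_(t in `]0, +oo[) p t = 1.
Proof.
pose w t := t `^ (a - 1) * expR (- t / 1).
have iw : mu.-integrable `]0%R, +oo[ (EFin \o w).
  apply: (@weighted_integrable _ a 1 a0 ltr01 w 1 0) => t t0.
    exact: is_derive_continuous (gamma_weight_derive a t0 (oner_neq0 R)).
  by rewrite expr0 !mul1r ger0_norm// mulr_ge0 ?expR_ge0 ?powR_ge0.
transitivity (\int[mu]_(t in `]0, +oo[) (k * w t)).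
  apply: eq_Rintegral => t; rewrite inE/= in_itv/= andbT => t0.
  by rewrite /p gamma_pdf_pos.
rewrite RintegralZl//.
have -> : \int[mu]_(t in `]0, +oo[) w t = gamma_function a.
  by apply: eq_Rintegral => t _; rewrite /w divr1.
by rewrite /k powR1 mulr1 mulVf// gt_eqF// gamma_function_gt0.
Qed.

Lemma lowerP_derive x : 0 < x -> is_derive x 1 P (p x).
Proof. exact: (weighted_primitive_derive a0 ltr01 cp pK). Qed.
Let dP := lowerP_derive.

Lemma lowerP_cvg0 : P x @[x --> 0^'+] --> 0.
Proof. exact: (weighted_primitive_cvg0 a0 ltr01 cp pK). Qed.

Lemma lowerP_cvgy : P x @[x --> +oo] --> (1 : R).
Proof.
rewrite -gamma_pdf1_integral.
exact: (weighted_primitive_cvgy a0 ltr01 cp pK).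
Qed.

Lemma upperPE x : 0 < x -> Q x = 1 - P x.
Proof.
move=> x0; rewrite /Q /upperP Rintegral_tail//; last exact: gamma_pdf1_integrable.
by rewrite gamma_pdf1_integral.
Qed.

Lemma upperP_derive x : 0 < x -> is_derive x 1 Q (- p x).
Proof.
move=> x0; apply: (@near_eq_is_derive _ _ _ (fun t => 1 - P t)).
  near=> t; rewrite upperPE//; near: t; exact: lt_nbhsr.
by apply: is_derive_eq (deriveB_fun (deriveC_fun 1 x) (dP x0)) _; rewrite sub0r.
Unshelve. all: by end_near. Qed.
Let dQ := upperP_derive.

Lemma upperP_cvgy : Q x @[x --> +oo] --> 0.
Proof.
have H : 1 - P x @[x --> +oo] --> 0.
  rewrite -[X in _ --> X](subrr 1); apply: cvgB; first exact: cvg_cst.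
  exact: lowerP_cvgy.
apply: cvg_trans H; apply: near_eq_cvg; near=> x.
by rewrite upperPE//; near: x; apply: nbhs_pinfty_gt; exact: num_real.
Unshelve. all: by end_near. Qed.

Lemma lowerP_ge0 x : 0 < x -> 0 <= P x.
Proof.
move=> x0; apply: (ge_lim_right0 x0 _ _ lowerP_cvg0) => t /andP[t0 _].
  exact: dP.
exact/ltW/p_gt0.
Qed.

Lemma upperP_ge0 x : 0 < x -> 0 <= Q x.
Proof.
move=> x0; apply: (ge_lim_pinfty _ _ upperP_cvgy) => t xt.
  by apply: dQ; exact: lt_le_trans xt.
by rewrite oppr_le0 ltW// p_gt0// (lt_le_trans x0).
Qed.

Lemma gamma_pdf1_mulx_cvg0 : t * p t @[t --> 0^'+] --> 0.
Proof.
have H : k * t `^ a @[t --> 0^'+] --> 0.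
  by rewrite -[X in _ --> X](mulr0 k); apply: cvgM; [exact: cvg_cst|exact: powR_cvg0].
apply: (cvg_norm_le0 _ H); near=> t.
have t0 : 0 < t by near: t; exact: nbhs_right_gt.
have tp0 : 0 <= t * p t by rewrite mulr_ge0// ltW// p_gt0.
rewrite ger0_norm// /p gamma_pdf_pos// -/k mulrCA ler_pM2l// mulrA mulr_powRB1 ?(ltW t0)//.
by rewrite ler_piMr ?powR_ge0// expR_le1 divr1 oppr_le0 ltW.
Unshelve. all: by end_near. Qed.

Lemma gamma_pdf1_poly_cvgy m : (1 + t) ^+ m * p t @[t --> +oo] --> 0.
Proof.
have H : k * ((1 + t) ^+ m * (t `^ (a - 1) * expR (- t / 1))) @[t --> +oo] --> 0.
  rewrite -[X in _ --> X](mulr0 k); apply: cvgM; first exact: cvg_cst.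
  exact: gamma_weight_cvgy.
apply: cvg_trans H; apply: near_eq_cvg; near=> t.
have t0 : 0 < t by near: t; apply: nbhs_pinfty_gt; exact: num_real.
by rewrite /p gamma_pdf_pos// -/k mulrCA.
Unshelve. all: by end_near. Qed.

(** From [2 (a - 1)] on, [2 p - Q] is nonincreasing, and it tends to [0]. The tail thus inherits the
    decay of the density against polynomials. *)
Lemma upperP_le_pdf x : 0 < x -> 2 * (a - 1) <= x -> Q x <= 2 * p x.
Proof.
move=> x0 xa; rewrite -subr_ge0.
have H : 2 * p t - Q t @[t --> +oo] --> 0.
  rewrite -[X in _ --> X](subrr 0); apply: cvgB; last exact: upperP_cvgy.
  rewrite -[X in _ --> X](mulr0 2); apply: cvgM; first exact: cvg_cst.
  have := @gamma_pdf1_poly_cvgy 0.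
  rewrite (_ : (fun t => (1 + t) ^+ 0 * p t) = p)//.
  by apply/funext => t; rewrite expr0 mul1r.
apply: (ge_lim_pinfty _ _ H) => t xt.
  have t0 := lt_le_trans x0 xt.
  exact: deriveB_fun (deriveM_fun (deriveC_fun 2 t) (dp t0)) (dQ t0).
have t0 := lt_le_trans x0 xt.
rewrite mul0r add0r opprK.
have -> : 2 * (((a - 1) / t - 1) * p t) + p t = (2 * (a - 1) - t) / t * p t.
  by field; rewrite gt_eqF.
apply: mulr_le0_ge0; last exact/ltW/p_gt0.
by rewrite pmulr_lle0 ?invr_gt0// subr_le0 (le_trans xa).
Qed.

Lemma upperP_poly_cvgy m : (1 + t) ^+ m * Q t @[t --> +oo] --> 0.
Proof.
have H : 2 * ((1 + t) ^+ m * p t) @[t --> +oo] --> 0.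
  rewrite -[X in _ --> X](mulr0 2); apply: cvgM; first exact: cvg_cst.
  exact: gamma_pdf1_poly_cvgy.
apply: (cvg_norm_le0 _ H); near=> t.
have t0 : 0 < t by near: t; apply: nbhs_pinfty_gt; exact: num_real.
have ta : 2 * (a - 1) <= t by near: t; apply: nbhs_pinfty_ge; exact: num_real.
have t1 : 0 <= (1 + t) ^+ m by rewrite exprn_ge0// addr_ge0// ltW.
rewrite ger0_norm ?mulr_ge0 ?upperP_ge0// mulrCA ler_wpM2l//.
exact: upperP_le_pdf.
Unshelve. all: by end_near. Qed.

(** This disposes of the boundary terms at infinity in all later integrations by parts. *)
Lemma poly_growth_pdf_cvgy (g : R -> R) C m :
  (forall t, 0 < t -> `|g t| <= C * (1 + t) ^+ m) ->
  g t * p t @[t --> +oo] --> 0 /\ g t * Q t @[t --> +oo] --> 0.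
Proof.
move=> gC; split.
- have H : C * ((1 + t) ^+ m * p t) @[t --> +oo] --> 0.
    rewrite -[X in _ --> X](mulr0 C); apply: cvgM; first exact: cvg_cst.
    exact: gamma_pdf1_poly_cvgy.
  apply: (cvg_norm_le0 _ H); near=> t.
  have t0 : 0 < t by near: t; apply: nbhs_pinfty_gt; exact: num_real.
  by rewrite normrM mulrA (ger0_norm (ltW (p_gt0 t0))) ler_pM2r ?p_gt0// gC.
- have H : C * ((1 + t) ^+ m * Q t) @[t --> +oo] --> 0.
    rewrite -[X in _ --> X](mulr0 C); apply: cvgM; first exact: cvg_cst.
    exact: upperP_poly_cvgy.
  apply: (cvg_norm_le0 _ H); near=> t.
  have t0 : 0 < t by near: t; apply: nbhs_pinfty_gt; exact: num_real.
  by rewrite normrM mulrA (ger0_norm (upperP_ge0 t0)) ler_wpM2r ?upperP_ge0// gC.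
Unshelve. all: by end_near. Qed.

End gamma_tails.

(** * Iterated tails of the gamma law and a closed form of [C2] *)

Section gamma_iterated_tails.
Context {R : realType}.
Local Notation mu := (@lebesgue_measure R).
Variable a : R.
Hypothesis a0 : 0 < a.
Implicit Types x t : R.

Let p := gamma_pdf a 1.
Let P := lowerP a.
Let Q := upperP a.
Let dp := @gamma_pdf1_derive R a.
Let dxp := @gamma_pdf1_mulx_derive R a.
Let dP := lowerP_derive a0.
Let dQ := upperP_derive a0.
Let p_gt0 := gamma_pdf1_gt0 a0.

(* Closed forms, from [x p' = (a - 1 - x) p], of the first and second iterated
   primitives of [P] vanishing at [0] and of [Q] vanishing at infinity. *)
Definition cdf1 x := (x - a) * P x + x * p x.
Definition ccdf1 x := (a - x) * Q x + x * p x.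
Definition cdf2 x :=
  ((x ^+ 2 - 2 * a * x + a * (a + 1)) * P x + (x - (a + 1)) * (x * p x)) / 2.
Definition ccdf2 x :=
  ((x ^+ 2 - 2 * a * x + a * (a + 1)) * Q x - (x - (a + 1)) * (x * p x)) / 2.

Let dxa x : is_derive x 1 (fun t => t - a) 1.
Proof. by apply: is_derive_eq (deriveB_fun (deriveI_fun x) (deriveC_fun a x)) _; rewrite subr0. Qed.

Lemma cdf1_derive x : 0 < x -> is_derive x 1 cdf1 (P x).
Proof.
move=> x0; apply: is_derive_eq (deriveD_fun (deriveM_fun (dxa x) (dP x0)) (dxp x0)) _.
by rewrite -/p -/P; ring.
Qed.

Lemma ccdf1_derive x : 0 < x -> is_derive x 1 ccdf1 (- Q x).
Proof.
move=> x0.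
have dax : is_derive x 1 (fun t => a - t) (-1).
  by apply: is_derive_eq (deriveB_fun (deriveC_fun a x) (deriveI_fun x)) _; rewrite sub0r.
apply: is_derive_eq (deriveD_fun (deriveM_fun dax (dQ x0)) (dxp x0)) _.
by rewrite -/p -/Q; ring.
Qed.

Let dquad x : is_derive x 1 (fun t => t ^+ 2 - 2 * a * t + a * (a + 1)) (2 * x - 2 * a).
Proof.
have d2 : is_derive x 1 (fun t => t ^+ 2) (x + x).
  have := deriveM_fun (deriveI_fun x) (deriveI_fun x).
  by rewrite mul1r mulr1; under eq_fun do rewrite -expr2.
apply: is_derive_eq (deriveD_fun (deriveB_fun d2 (deriveM_fun (deriveC_fun (2 * a) x)
  (deriveI_fun x))) (deriveC_fun (a * (a + 1)) x)) _.
by ring.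
Qed.

Let dxa1 x : is_derive x 1 (fun t => t - (a + 1)) 1.
Proof.
by apply: is_derive_eq (deriveB_fun (deriveI_fun x) (deriveC_fun (a + 1) x)) _; rewrite subr0.
Qed.

Lemma cdf2_derive x : 0 < x -> is_derive x 1 cdf2 (cdf1 x).
Proof.
move=> x0; apply: is_derive_eq (deriveM_fun (deriveD_fun (deriveM_fun (dquad x) (dP x0))
  (deriveM_fun (dxa1 x) (dxp x0))) (deriveC_fun 2^-1 x)) _.
by rewrite -/p -/P /cdf1; field.
Qed.

Lemma ccdf2_derive x : 0 < x -> is_derive x 1 ccdf2 (- ccdf1 x).
Proof.
move=> x0; apply: is_derive_eq (deriveM_fun (deriveB_fun (deriveM_fun (dquad x) (dQ x0))
  (deriveM_fun (dxa1 x) (dxp x0))) (deriveC_fun 2^-1 x)) _.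
by rewrite -/p -/Q /ccdf1; field.
Qed.

Let near01 : \forall t \near (0:R)^'+, 0 < t <= 1.
Proof.
near=> t; apply/andP; split; first by near: t; exact: nbhs_right_gt.
by near: t; exact: nbhs_right_le.
Unshelve. all: by end_near. Qed.

Lemma cdf1_cvg0 : cdf1 x @[x --> 0^'+] --> 0.
Proof.
rewrite -[X in _ --> X](addr0 0); apply: cvgD; last exact: gamma_pdf1_mulx_cvg0.
apply: (@bounded_cvg0 _ _ _ (1 + a)); last exact: lowerP_cvg0.
apply: filterS near01 => t /andP[t0 t1]; rewrite (le_trans (ler_normB _ _))//.
by rewrite !gtr0_norm// lerD2r.
Qed.

Lemma cdf2_cvg0 : cdf2 x @[x --> 0^'+] --> 0.
Proof.
rewrite -[X in _ --> X](mul0r 2^-1); apply: cvgM; last exact: cvg_cst.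
rewrite -[X in _ --> X](addr0 0); apply: cvgD.
- apply: (@bounded_cvg0 _ _ _ (1 + 2 * a + a * (a + 1))); last exact: lowerP_cvg0.
  apply: filterS near01 => t /andP[t0 t1].
  have a2 : 0 < a * (a + 1) by rewrite mulr_gt0 ?addr_gt0.
  have at1 : 0 <= a * t <= a.
    by apply/andP; split; [rewrite mulr_ge0// ltW|rewrite ler_piMr// ltW].
  have tt1 : 0 <= t ^+ 2 <= 1.
    by apply/andP; split; [rewrite exprn_ge0// ltW|rewrite exprn_ile1// ltW].
  by have a0' := a0; rewrite ler_norml; apply/andP; split; lra.
- apply: (@bounded_cvg0 _ _ _ (1 + a + 1)); last exact: gamma_pdf1_mulx_cvg0.
  apply: filterS near01 => t /andP[t0 t1].
  by have a0' := a0; rewrite ler_norml; apply/andP; split; lra.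
Qed.

Let poly_growth_pdf g C m := @poly_growth_pdf_cvgy R a a0 g C m.

Lemma ccdf1_cvgy : ccdf1 x @[x --> +oo] --> 0.
Proof.
rewrite -[X in _ --> X](addr0 0); apply: cvgD.
  have [|//] := @poly_growth_pdf (fun x => a - x) (1 + a) 1.
  move=> t t0; rewrite (le_trans (ler_normB _ _))// !gtr0_norm//.
  have at0 : 0 < a * t by rewrite mulr_gt0.
  by rewrite expr1 mulrDr mulr1 mulrDl mul1r; lra.
have [|//] := @poly_growth_pdf (fun x => x) 1 1.
by move=> t t0; rewrite gtr0_norm// expr1 mul1r lerDr.
Qed.

Lemma ccdf2_cvgy : ccdf2 x @[x --> +oo] --> 0.
Proof.
rewrite -[X in _ --> X](mul0r 2^-1); apply: cvgM; last exact: cvg_cst.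
rewrite -[X in _ --> X](subr0 0); apply: cvgB.
  have [|//] := @poly_growth_pdf (fun x => x ^+ 2 - 2 * a * x + a * (a + 1))
     (1 + a + a * (a + 1)) 2.
  move=> t t0.
  have a2 : 0 < a * (a + 1) by rewrite mulr_gt0 ?addr_gt0.
  have at0 : 0 < a * t by rewrite mulr_gt0.
  have att0 : 0 < a * t ^+ 2 by rewrite mulr_gt0 ?exprn_gt0.
  have aat0 : 0 < a * (a + 1) * t by rewrite mulr_gt0.
  have aatt0 : 0 < a * (a + 1) * t ^+ 2 by rewrite mulr_gt0 ?exprn_gt0.
  have t20 : 0 < t ^+ 2 by rewrite exprn_gt0.
  have -> : (1 + a + a * (a + 1)) * (1 + t) ^+ 2 = 1 + 2 * t + t ^+ 2 + a + 2 * (a * t) +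
     a * t ^+ 2 + a * (a + 1) + 2 * (a * (a + 1) * t) + a * (a + 1) * t ^+ 2 by ring.
  rewrite -mulrA; move: (a * (a + 1)) a2 aat0 aatt0 => A a2 aat0 aatt0.
  by have a0' := a0; rewrite ler_norml; apply/andP; split; lra.
have -> : (fun x => (x - (a + 1)) * (x * p x)) = (fun x => ((x - (a + 1)) * x) * p x).
  by apply/funext => x; rewrite mulrA.
have [|//] := @poly_growth_pdf (fun x => (x - (a + 1)) * x) (1 + a) 2.
move=> t t0; have at0 : 0 < a * t by rewrite mulr_gt0.
have att0 : 0 < a * t ^+ 2 by rewrite mulr_gt0 ?exprn_gt0.
have t20 : 0 < t ^+ 2 by rewrite exprn_gt0.
have -> : (t - (a + 1)) * t = t ^+ 2 - a * t - t by ring.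
have -> : (1 + a) * (1 + t) ^+ 2 = 1 + 2 * t + t ^+ 2 + a + 2 * (a * t) + a * t ^+ 2 by ring.
by have a0' := a0; rewrite ler_norml; apply/andP; split; lra.
Qed.

Lemma cdf1_ge0 x : 0 < x -> 0 <= cdf1 x.
Proof.
move=> x0; apply: (ge_lim_right0 x0 _ _ cdf1_cvg0) => t /andP[t0 _].
  exact: cdf1_derive.
exact: lowerP_ge0.
Qed.

Lemma cdf2_ge0 x : 0 < x -> 0 <= cdf2 x.
Proof.
move=> x0; apply: (ge_lim_right0 x0 _ _ cdf2_cvg0) => t /andP[t0 _].
  exact: cdf2_derive.
exact: cdf1_ge0.
Qed.

Lemma ccdf1_ge0 x : 0 < x -> 0 <= ccdf1 x.
Proof.
move=> x0; apply: (ge_lim_pinfty _ _ ccdf1_cvgy) => t xt.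
  by apply: ccdf1_derive; exact: lt_le_trans xt.
by rewrite oppr_le0 upperP_ge0// (lt_le_trans x0).
Qed.

Lemma ccdf2_ge0 x : 0 < x -> 0 <= ccdf2 x.
Proof.
move=> x0; apply: (ge_lim_pinfty _ _ ccdf2_cvgy) => t xt.
  by apply: ccdf2_derive; exact: lt_le_trans xt.
by rewrite oppr_le0 ccdf1_ge0// (lt_le_trans x0).
Qed.

Let cP x : 0 < x -> {for x, continuous P}.
Proof. by move=> x0; exact: is_derive_continuous (dP x0). Qed.

Let cQ x : 0 < x -> {for x, continuous Q}.
Proof. by move=> x0; exact: is_derive_continuous (dQ x0). Qed.

Let ccdf1' x : 0 < x -> {for x, continuous cdf1}.
Proof. by move=> x0; exact: is_derive_continuous (cdf1_derive x0). Qed.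

Let cccdf1 x : 0 < x -> {for x, continuous ccdf1}.
Proof. by move=> x0; exact: is_derive_continuous (ccdf1_derive x0). Qed.

Let dNccdf1 x : 0 < x -> is_derive x 1 (fun t => - ccdf1 t) (Q x).
Proof. by move=> x0; apply: is_derive_eq (deriveN_fun (ccdf1_derive x0)) _; rewrite opprK. Qed.

Let dNccdf2 x : 0 < x -> is_derive x 1 (fun t => - ccdf2 t) (ccdf1 x).
Proof. by move=> x0; apply: is_derive_eq (deriveN_fun (ccdf2_derive x0)) _; rewrite opprK. Qed.

Let Nccdf1_cvgy : - ccdf1 t @[t --> +oo] --> 0.
Proof. by rewrite -[X in _ --> X]oppr0; apply: cvgN; exact: ccdf1_cvgy. Qed.

Let Nccdf2_cvgy : - ccdf2 t @[t --> +oo] --> 0.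
Proof. by rewrite -[X in _ --> X]oppr0; apply: cvgN; exact: ccdf2_cvgy. Qed.

Lemma lowerP1E x : 0 < x -> lowerP1 a x = cdf1 x.
Proof.
move=> x0; rewrite /lowerP1 /Rintegral.
have -> := ge0_integral_0x x0 cP (lowerP_ge0 a0) cdf1_derive (@cdf1_cvg0).
by rewrite subr0.
Qed.

Lemma upperP1E x : 0 < x -> upperP1 a x = ccdf1 x.
Proof.
move=> x0; rewrite /upperP1 /Rintegral.
have -> := ge0_integral_xy x0 cQ (upperP_ge0 a0) dNccdf1 (@Nccdf1_cvgy).
by rewrite sub0r opprK.
Qed.

Lemma integral_lowerP1 z : 0 < z -> \int[mu]_(x in `]0, z[) lowerP1 a x = cdf2 z.
Proof.
move=> z0; transitivity (\int[mu]_(x in `]0, z[) cdf1 x).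
  by apply: eq_Rintegral => t; rewrite inE/= in_itv/= => /andP[t0 _]; rewrite lowerP1E.
rewrite /Rintegral.
have -> := ge0_integral_0x z0 ccdf1' cdf1_ge0 cdf2_derive (@cdf2_cvg0).
by rewrite subr0.
Qed.

Lemma integral_upperP1 z : 0 < z -> \int[mu]_(x in `]z, +oo[) upperP1 a x = ccdf2 z.
Proof.
move=> z0; transitivity (\int[mu]_(x in `]z, +oo[) ccdf1 x).
  apply: eq_Rintegral => t; rewrite inE/= in_itv/= andbT => zt.
  by rewrite upperP1E// (lt_trans z0).
rewrite /Rintegral.
have -> := ge0_integral_xy z0 cccdf1 ccdf1_ge0 dNccdf2 (@Nccdf2_cvgy).
by rewrite sub0r opprK.
Qed.

(** [derive1n] differentiates total functions, whereas [f1] is the derivative on the half-line only;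
    the half-line being open, agreement near [x] is enough. *)
Lemma derive1n2E (f f1 f2 : R -> R) :
  (forall x, 0 < x -> has_derive f x (f1 x)) ->
  (forall x, 0 < x -> has_derive f1 x (f2 x)) ->
  forall x, 0 < x -> derive1n 2 f x = f2 x.
Proof.
move=> df df1 x x0; rewrite /derive1n/= derive1E.
have : is_derive x 1 f^`()%classic (f2 x).
  apply: (@near_eq_is_derive _ _ _ f1); last exact: df1.
  near=> t; have t0 : 0 < t by near: t; exact: lt_nbhsr.
  by rewrite derive1E; have [_ ->] := df t t0.
by case.
Unshelve. all: by end_near. Qed.

Let dxnp n x : 0 < x ->
  is_derive x 1 (fun t => t ^+ n.+1 * p t) ((a + n%:R - x) * (x ^+ n * p x)).
Proof.
move=> x0; elim: n => [|n IHn].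
  under eq_fun do rewrite expr1.
  by apply: is_derive_eq (dxp x0) _; rewrite addr0 expr0 mul1r.
have -> : (fun t => t ^+ n.+2 * p t) = (fun t => t * (t ^+ n.+1 * p t)).
  by apply/funext => t; rewrite exprS mulrA.
apply: is_derive_eq (deriveM_fun (deriveI_fun x) IHn) _.
by rewrite -natr1 exprS; ring.
Qed.

(** The quotient rule, where [x^(n + 1) p] has logarithmic derivative [(a + n - x) / x]. The new
    numerator is [cdf1] when [N = P] and [2 cdf2] when [N = cdf1], so the derivatives of [lowerM]
    stay explicit. *)
Let ratio_derive (N : R -> R) (N1 : R) n x : 0 < x -> is_derive x 1 N N1 ->
  is_derive x 1 (fun t => N t / (t ^+ n.+1 * p t))
    ((x * N1 - (a + n%:R - x) * N x) / (x ^+ n.+2 * p x)).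
Proof.
move=> x0 dN.
have xp0 : x ^+ n.+1 * p x != 0 by rewrite mulf_neq0 ?gt_eqF ?exprn_gt0// p_gt0.
apply: is_derive_eq (deriveM_fun dN (@deriveV_fun _ (fun t => t ^+ n.+1 * p t) x _ xp0 (dxnp n x0))) _.
have px : p x != 0 by rewrite gt_eqF// p_gt0.
have xn0 : x ^+ n != 0 by rewrite gt_eqF ?exprn_gt0.
rewrite !exprS; field.
by rewrite xn0 px gt_eqF.
Qed.

Lemma lowerM_derive x : 0 < x -> is_derive x 1 (lowerM a) (cdf1 x / (x ^+ 2 * p x)).
Proof.
move=> x0; apply: is_derive_eq (ratio_derive 0 x0 (dP x0)) _.
by rewrite addr0 /cdf1 -/p -/P; congr (_ / _); ring.
Qed.

Lemma lowerM_derive2 x : 0 < x -> derive1n 2 (lowerM a) x = 2 * cdf2 x / (x ^+ 3 * p x).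
Proof.
apply: (@derive1n2E _ (fun x => cdf1 x / (x ^+ 2 * p x))
  (fun x => 2 * cdf2 x / (x ^+ 3 * p x))) => {}x x0; first exact: lowerM_derive.
apply: is_derive_eq (ratio_derive 1 x0 (cdf1_derive x0)) _.
by congr (_ / _); rewrite /cdf2 /cdf1; field.
Qed.

Lemma upperM_derive2 x : 0 < x -> derive1n 2 (upperM a) x = 2 * ccdf2 x / (x ^+ 3 * p x).
Proof.
apply: (@derive1n2E _ (fun x => - ccdf1 x / (x ^+ 2 * p x))
  (fun x => 2 * ccdf2 x / (x ^+ 3 * p x))) => {}x x0.
  apply: is_derive_eq (ratio_derive 0 x0 (dQ x0)) _.
  by rewrite addr0 /ccdf1 -/p -/Q; congr (_ / _); ring.
have dN := deriveN_fun (ccdf1_derive x0).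
apply: is_derive_eq (ratio_derive 1 x0 dN) _.
by congr (_ / _); rewrite /ccdf2 /ccdf1; field.
Qed.

(** The two summands of [C2] coincide: each is [2 cdf2 ccdf2 / (z^3 p)]. *)
Lemma C2E z : 0 < z -> C2 a z = 4 * cdf2 z * ccdf2 z / (z ^+ 3 * p z).
Proof.
move=> z0; rewrite /C2 lowerM_derive2// upperM_derive2//.
by rewrite integral_lowerP1// integral_upperP1//; ring.
Qed.

End gamma_iterated_tails.

(** * The Stein equation of the gamma law *)

Section gamma_stein_solution.
Context {R : realType}.
Variable a : R.
Hypothesis a0 : 0 < a.
Implicit Types x t : R.

Let p := gamma_pdf a 1.
Let P := lowerP a.
Let Q := upperP a.
Let dp := @gamma_pdf1_derive R a.
Let dxp := @gamma_pdf1_mulx_derive R a.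
Let dP := lowerP_derive a0.
Let dQ := upperP_derive a0.
Let p_gt0 := gamma_pdf1_gt0 a0.

Variables (h h1 H : R -> R) (c C : R).
Hypothesis dh : forall x, 0 < x -> is_derive x 1 h (h1 x).
Hypothesis hC : forall x, 0 < x -> `|h x| <= C * (1 + x) ^+ 2.
Hypothesis h1C : forall x, 0 < x -> `|h1 x| <= C * (1 + x).
Hypothesis dH : forall x, 0 < x -> is_derive x 1 H (h x * p x).
Hypothesis H0 : H x @[x --> 0^'+] --> 0.
Hypothesis Hy : H x @[x --> +oo] --> c.

(** [x p] is an integrating factor of the Stein equation, [(x p F)' = (h - c) p]. As [c] is the
    limit of [H], the numerator vanishes at both ends. *)
Definition stein_sol x := (H x - c * P x) / (x * p x).
(** The first derivative as the Stein equation gives it; [stein_sol2] solves in the same way the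
    differentiated equation [x F'' + (a + 1 - x) F' - F = h']. *)
Definition stein_sol1 x := (h x - c - (a - x) * stein_sol x) / x.
Definition stein_sol2 x :=
  (h1 x + stein_sol x - (a + 1 - x) * stein_sol1 x) / x.

Local Notation F := stein_sol.
Local Notation F1 := stein_sol1.
Local Notation F2 := stein_sol2.

Let xp_neq0 x : 0 < x -> x * p x != 0.
Proof. by move=> x0; rewrite gt_eqF// mulr_gt0// p_gt0. Qed.

Let dN x : 0 < x -> is_derive x 1 (fun t => H t - c * P t) ((h x - c) * p x).
Proof.
move=> x0; apply: is_derive_eq (deriveB_fun (dH x0) (deriveM_fun (deriveC_fun c x) (dP x0))) _.
by rewrite -/p; ring.
Qed.

Lemma stein_sol_derive x : 0 < x -> is_derive x 1 F (F1 x).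
Proof.
move=> x0; apply: is_derive_eq (deriveM_fun (dN x0)
  (@deriveV_fun _ (fun t => t * p t) x _ (xp_neq0 x0) (dxp x0))) _.
rewrite /F1 /F -/p -/P; field.
by rewrite !gt_eqF// p_gt0.
Qed.

Let dax x : is_derive x 1 (fun t => a - t) (-1).
Proof.
by apply: is_derive_eq (deriveB_fun (deriveC_fun a x) (deriveI_fun x)) _; rewrite sub0r.
Qed.

Lemma stein_sol1_derive x : 0 < x -> is_derive x 1 F1 (F2 x).
Proof.
move=> x0; apply: is_derive_eq (deriveM_fun
  (deriveB_fun (deriveB_fun (dh x0) (deriveC_fun c x))
               (deriveM_fun (dax x) (stein_sol_derive x0)))
  (@deriveV_fun _ (fun t => t) x _ (lt0r_neq0 x0) (deriveI_fun x))) _.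
by rewrite /F2 /F1; field; rewrite gt_eqF.
Qed.

Lemma stein_sol2_continuous x : 0 < x -> {for x, continuous h1} ->
  {for x, continuous F2}.
Proof.
move=> x0 ch1; apply: cvgM.
  apply: cvgB; first apply: cvgD => //.
    exact: is_derive_continuous (stein_sol_derive x0).
  apply: cvgM; last exact: is_derive_continuous (stein_sol1_derive x0).
  by apply: cvgB; [exact: cvg_cst|exact: cvg_id].
by apply: cvgV; [rewrite gt_eqF|exact: cvg_id].
Qed.

Lemma stein_equation x : 0 < x -> x * F1 x + (a - x) * F x = h x - c.
Proof. by move=> x0; rewrite /F1; field; rewrite gt_eqF. Qed.

(** [A] is the integral of [h' P] over []0, x[] and [B] that of [h' Q] over []x, +oo[], written so
    that derivative and limit are at hand. *)
Let A x := h x * P x - H x.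
Let B x := (c - H x) - h x * Q x.

Let C0 : 0 <= C.
Proof.
have := le_trans (normr_ge0 _) (hC ltr01).
by rewrite pmulr_lge0// exprn_gt0// addr_gt0.
Qed.

Let hC0 : \forall t \near (0:R)^'+, `|h t| <= C * 4.
Proof.
near=> t; have t0 : 0 < t by near: t; exact: nbhs_right_gt.
have t1 : t <= 1 by near: t; exact: nbhs_right_le.
rewrite (le_trans (hC t0))// ler_wpM2l//.
have -> : (4 : R) = 2 ^+ 2 by ring.
by rewrite lerXn2r ?nnegrE//; lra.
Unshelve. all: by end_near. Qed.

Let h1C0 : \forall t \near (0:R)^'+, `|h1 t| <= C * 2.
Proof.
near=> t; have t0 : 0 < t by near: t; exact: nbhs_right_gt.
have t1 : t <= 1 by near: t; exact: nbhs_right_le.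
by rewrite (le_trans (h1C t0))// ler_wpM2l//; lra.
Unshelve. all: by end_near. Qed.

Let A_cvg0 : A x @[x --> 0^'+] --> 0.
Proof.
rewrite -[X in _ --> X](subrr 0); apply: cvgB; last exact: H0.
by apply: bounded_cvg0 hC0 _; exact: lowerP_cvg0.
Qed.

Let B_cvgy : B x @[x --> +oo] --> 0.
Proof.
rewrite -[X in _ --> X](subrr 0); apply: cvgB.
  by rewrite -[X in _ --> X](subrr c); apply: cvgB; [exact: cvg_cst|exact: Hy].
by have [] := poly_growth_pdf_cvgy a0 hC.
Qed.

Let dA x : 0 < x -> is_derive x 1 A (h1 x * P x).
Proof.
move=> x0; apply: is_derive_eq (deriveB_fun (deriveM_fun (dh x0) (dP x0)) (dH x0)) _.
by rewrite -/p -/P; ring.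
Qed.

Let dB x : 0 < x -> is_derive x 1 B (- (h1 x * Q x)).
Proof.
move=> x0; apply: is_derive_eq (deriveB_fun (deriveB_fun (deriveC_fun c x) (dH x0))
   (deriveM_fun (dh x0) (dQ x0))) _.
by rewrite -/p -/Q; ring.
Qed.

(** Once [Q = 1 - P] is substituted, everything cancels but [x^2 p]. Through [F2E] it expresses that
    [F''] is [0] for [h x = x], whose solution is the constant [-1]. *)
Let cdf_wronskian x : 0 < x ->
  2 * (ccdf2 a x * cdf1 a x + cdf2 a x * ccdf1 a x) = x ^+ 2 * p x.
Proof.
move=> x0; rewrite /ccdf2 /cdf2 /ccdf1 /cdf1 -/p -/P upperPE// -/P.
by field.
Qed.

(** In this form [F''] depends on [h'] alone, through [A] and [B]; the bounds on [h'] and [h''] are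
    applied to it. *)
Let F2E x : 0 < x -> F2 x = h1 x / x -
  2 * (ccdf2 a x * A x + cdf2 a x * B x) / (x ^+ 3 * p x).
Proof.
move=> x0; rewrite /F2 /F1 /F /ccdf2 /cdf2 /A /B -/p -/P /Q upperPE// -/P.
by field; rewrite !gt_eqF// p_gt0.
Qed.

Let norm_lincomb (u v y z : R) : 0 <= u -> 0 <= v ->
  `|u * y + v * z| <= u * `|y| + v * `|z|.
Proof.
move=> u0 v0; rewrite (le_trans (ler_normD _ _))// !normrM.
by rewrite (ger0_norm u0) (ger0_norm v0).
Qed.

(** In [x F''] the first term is [h']. Comparison of derivatives gives [|A| <= cdf1] and
    [|B| <= ccdf1], and [cdf_wronskian] then bounds the second term by [1] as well. *)
Lemma stein_sol2_le1 : (forall x, 0 < x -> `|h1 x| <= 1) ->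
  forall x, 0 < x -> x * `|F2 x| <= 2.
Proof.
move=> h11 x x0.
have h1P t : 0 < t -> `|h1 t * P t| <= P t.
  by move=> t0; rewrite normrM (ger0_norm (lowerP_ge0 a0 t0)) ler_piMl ?h11// lowerP_ge0.
have h1Q t : 0 < t -> `|h1 t * Q t| <= Q t.
  by move=> t0; rewrite normrM (ger0_norm (upperP_ge0 a0 t0)) ler_piMl ?h11// upperP_ge0.
have HA : `|A x| <= cdf1 a x.
  apply: (norm_le_lim_right0 x0 _ _ _ A_cvg0 (cdf1_cvg0 a0)) => t /andP[t0 _].
  - exact: dA.
  - exact: cdf1_derive.
  - exact: h1P.
have HB : `|B x| <= ccdf1 a x.
  apply: (norm_le_lim_pinfty _ _ _ B_cvgy (ccdf1_cvgy a0)) => t xt;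
    have t0 := lt_le_trans x0 xt.
  - exact: dB.
  - exact: ccdf1_derive.
  - by rewrite normrN opprK; exact: h1Q.
have xp0 : 0 < x ^+ 2 * p x by rewrite mulr_gt0 ?exprn_gt0 ?p_gt0.
have -> : x * `|F2 x| =
    `|h1 x - 2 * (ccdf2 a x * A x + cdf2 a x * B x) / (x ^+ 2 * p x)|.
  rewrite F2E// -{1}(gtr0_norm x0) -normrM; congr `| _ |; field.
  by rewrite !gt_eqF// p_gt0.
apply: (le_trans (ler_normB _ _)); rewrite -[leRHS]/(1 + 1 : R); apply: lerD; first exact: h11.
rewrite normrM normfV (gtr0_norm xp0) ler_pdivrMr// mul1r -cdf_wronskian//.
rewrite normrM gtr0_norm// ler_pM2l//.
apply: (le_trans (norm_lincomb _ _ (ccdf2_ge0 a0 x0) (cdf2_ge0 a0 x0))).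
by apply: lerD; apply: ler_wpM2l => //; [exact: ccdf2_ge0|exact: cdf2_ge0].
Qed.

(** A further integration by parts: up to sign, [A1] and [B1] are the integrals of [h'' cdf1] below
    [x] and of [h'' ccdf1] above it. By [cdf_wronskian] the terms in [h'] cancel, and
    [|A1| <= cdf2], [|B1| <= ccdf2] leave the closed form of [C2]. *)
Lemma stein_sol2_le_C2 (h2 : R -> R) :
  (forall x, 0 < x -> is_derive x 1 h1 (h2 x)) ->
  (forall x, 0 < x -> `|h2 x| <= 1) ->
  forall x, 0 < x -> `|F2 x| <= C2 a x.
Proof.
move=> dh1 h21 x x0.
pose A1 t := h1 t * cdf1 a t - A t.
pose B1 t := h1 t * ccdf1 a t - B t.
have dA1 t : 0 < t -> is_derive t 1 A1 (h2 t * cdf1 a t).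
  move=> t0; apply: is_derive_eq (deriveB_fun (deriveM_fun (dh1 _ t0) (cdf1_derive a0 t0)) (dA t0)) _.
  by rewrite -/P; ring.
have dB1 t : 0 < t -> is_derive t 1 B1 (h2 t * ccdf1 a t).
  move=> t0; apply: is_derive_eq (deriveB_fun (deriveM_fun (dh1 _ t0) (ccdf1_derive a0 t0)) (dB t0)) _.
  by rewrite -/Q; ring.
have A10 : A1 t @[t --> 0^'+] --> 0.
  rewrite -[X in _ --> X](subrr 0); apply: cvgB; last exact: A_cvg0.
  by apply: bounded_cvg0 h1C0 _; exact: cdf1_cvg0.
have B1y : B1 t @[t --> +oo] --> 0.
  rewrite -[X in _ --> X](subrr 0); apply: cvgB; last exact: B_cvgy.
  have -> : (fun t => h1 t * ccdf1 a t) =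
      (fun t => h1 t * (a - t) * Q t + h1 t * t * p t).
    by apply/funext => t; rewrite /ccdf1 -/p -/Q; ring.
  rewrite -[X in _ --> X](addr0 0); apply: cvgD.
    have [|_ //] := @poly_growth_pdf_cvgy R a a0 (fun t => h1 t * (a - t)) (C * (1 + a)) 2.
    move=> t t0; rewrite normrM expr2 mulrACA; apply: ler_pM => //; first exact: h1C.
    have at0 : 0 < a * t by rewrite mulr_gt0.
    have a0' := a0; rewrite ler_norml; apply/andP; split; lra.
  have [|//] := @poly_growth_pdf_cvgy R a a0 (fun t => h1 t * t) C 2.
  move=> t t0; rewrite normrM expr2 mulrA; apply: ler_pM => //; first exact: h1C.
  by rewrite gtr0_norm// lerDr.
have HA : `|A1 x| <= cdf2 a x.
  apply: (norm_le_lim_right0 x0 _ _ _ A10 (cdf2_cvg0 a0)) => t /andP[t0 _].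
  - exact: dA1.
  - exact: cdf2_derive.
  - by rewrite normrM (ger0_norm (cdf1_ge0 a0 t0)) ler_piMl ?h21// cdf1_ge0.
have HB : `|B1 x| <= ccdf2 a x.
  apply: (norm_le_lim_pinfty _ _ _ B1y (ccdf2_cvgy a0)) => t xt;
    have t0 := lt_le_trans x0 xt.
  - exact: dB1.
  - exact: ccdf2_derive.
  - by rewrite opprK normrM (ger0_norm (ccdf1_ge0 a0 t0)) ler_piMl ?h21// ccdf1_ge0.
have xp0 : 0 < x ^+ 3 * p x by rewrite mulr_gt0 ?exprn_gt0 ?p_gt0.
have px0 := p_gt0 x0.
have -> : F2 x = 2 * (ccdf2 a x * A1 x + cdf2 a x * B1 x) / (x ^+ 3 * p x).
  have -> : 2 * (ccdf2 a x * A1 x + cdf2 a x * B1 x) =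
     h1 x * (2 * (ccdf2 a x * cdf1 a x + cdf2 a x * ccdf1 a x)) -
     2 * (ccdf2 a x * A x + cdf2 a x * B x) by rewrite /A1 /B1; ring.
  by rewrite cdf_wronskian// F2E//; field; rewrite !gt_eqF.
rewrite C2E// -/p normrM normfV (gtr0_norm xp0) ler_pM2r ?invr_gt0//.
rewrite normrM gtr0_norm//.
have -> : 4 * cdf2 a x * ccdf2 a x = 2 * (ccdf2 a x * cdf2 a x + cdf2 a x * ccdf2 a x) by ring.
rewrite ler_pM2l//.
apply: (le_trans (norm_lincomb _ _ (ccdf2_ge0 a0 x0) (cdf2_ge0 a0 x0))).
by apply: lerD; apply: ler_wpM2l => //; [exact: ccdf2_ge0|exact: cdf2_ge0].
Qed.

(** Beyond [2 (a + 1)] the factor [a + 1 - t] in the derivative of [t^2 p] is at most [- t / 2], so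
    [t^2 p] decreases fast enough to serve as a majorant. *)
Let x1 := 2 * (a + 1) + 1.

Let x1_gt1 : 1 < x1.
Proof. by rewrite /x1; have a0' := a0; lra. Qed.

Let x1_gt0 : 0 < x1 := lt_trans ltr01 x1_gt1.

(** [h - c] is bounded on []0, x1]], whence [|F| <= D0 lowerM]; and [lowerM] is nondecreasing
    because its derivative is [cdf1 / (x^2 p)]. *)
Let stein_sol_bounded : exists D, forall x, 0 < x <= x1 -> `|F x| <= D.
Proof.
pose D0 := C * (1 + x1) ^+ 2 + `|c|.
have hD t : 0 < t <= x1 -> `|h t - c| <= D0.
  move=> /andP[t0 tx]; apply: (le_trans (ler_normB _ _)); rewrite lerD2r.
  apply: (le_trans (hC t0)); rewrite ler_wpM2l// lerXn2r ?nnegrE ?lerD2l//;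
    by rewrite addr_ge0 ?ltW.
have D00 : 0 <= D0 by rewrite addr_ge0// mulr_ge0// sqr_ge0.
have HN x : 0 < x <= x1 -> `|H x - c * P x| <= D0 * P x.
  move=> /andP[x0 xx1].
  have DP0 : D0 * P t @[t --> 0^'+] --> 0.
    rewrite -[X in _ --> X](mulr0 D0); apply: cvgM; first exact: cvg_cst.
    exact: lowerP_cvg0.
  have N0 : H t - c * P t @[t --> 0^'+] --> 0.
    rewrite -[X in _ --> X](_ : 0 - c * 0 = 0); last by ring.
    apply: cvgB; first exact: H0.
    by apply: cvgM; [exact: cvg_cst|exact: lowerP_cvg0].
  have dDP t : 0 < t -> is_derive t 1 (fun t => D0 * P t) (D0 * p t).
    move=> t0; apply: is_derive_eq (deriveM_fun (deriveC_fun D0 t) (dP t0)) _.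
    by rewrite mul0r add0r.
  apply: (norm_le_lim_right0 x0 _ _ _ N0 DP0) => t /andP[t0 tx].
  - exact: dN.
  - exact: dDP.
  - by rewrite normrM (gtr0_norm (p_gt0 t0)) ler_pM2r ?p_gt0// hD// t0 (le_trans tx xx1).
exists (D0 * lowerM a x1) => x /[dup] xx /andP[x0 xx1].
have xp0 : 0 < x * p x by rewrite mulr_gt0// p_gt0.
rewrite /F normrM normfV (gtr0_norm xp0).
apply: (@le_trans _ _ (D0 * P x / (x * p x))).
  by rewrite ler_pM2r ?invr_gt0// HN.
rewrite -mulrA ler_wpM2l//.
apply: (@is_derive_le _ (lowerM a) (fun x => cdf1 a x / (x ^+ 2 * p x)) x x1) => //.
  by move=> t /andP[xt _]; apply: (lowerM_derive a0); exact: lt_le_trans xt.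
move=> t /andP[xt _]; have t0 := lt_le_trans x0 xt.
by rewrite divr_ge0 ?cdf1_ge0// mulr_ge0 ?exprn_ge0// ltW// p_gt0.
Qed.

Let dx2p x : 0 < x ->
  is_derive x 1 (fun t => t ^+ 2 * p t) (x * (a + 1 - x) * p x).
Proof.
move=> x0; have -> : (fun t => t ^+ 2 * p t) = (fun t => t * (t * p t)).
  by apply/funext => t; rewrite expr2 mulrA.
by apply: is_derive_eq (deriveM_fun (deriveI_fun x) (dxp x0)) _; rewrite -/p; ring.
Qed.

(** Near infinity the numerator of [F] is compared with [K x^2 p]: its derivative is at most
    [K / 2 x^2 p] in absolute value, while that of the majorant lies below [- K / 2 x^2 p]. *)
Let stein_sol_linear : exists D, forall x, x1 <= x -> `|F x| <= D * x.
Proof.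
pose K := 2 * (4 * C + `|c|).
have K0 : 0 <= K by rewrite /K mulr_ge0// addr_ge0// mulr_ge0.
exists K => x xx1; have x0 := lt_le_trans x1_gt0 xx1.
have hK t : x <= t -> `|h t - c| <= K / 2 * t ^+ 2.
  move=> xt; have t0 := lt_le_trans x0 xt.
  have t1 : 1 <= t := ltW (lt_le_trans x1_gt1 (le_trans xx1 xt)).
  have t21 : 1 <= t ^+ 2 by rewrite exprn_ege1.
  have c0 := normr_ge0 c.
  have -> : K / 2 = 4 * C + `|c| by rewrite /K; field.
  rewrite (le_trans (ler_normB _ _))// [leRHS]mulrDl.
  apply: lerD; last by rewrite ler_peMr.
  rewrite (le_trans (hC t0))// (mulrC 4) -mulrA ler_wpM2l//.
  have -> : 4 * t ^+ 2 = (2 * t) ^+ 2 by ring.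
  by rewrite lerXn2r ?nnegrE//; lra.
have Kx2y : K * (t ^+ 2 * p t) @[t --> +oo] --> 0.
  rewrite -[X in _ --> X](mulr0 K); apply: cvgM; first exact: cvg_cst.
  have [|//] := @poly_growth_pdf_cvgy R a a0 (fun t => t ^+ 2) 1 2.
  move=> t t0; rewrite mul1r ger0_norm ?exprn_ge0// ?(ltW t0)//.
  by rewrite lerXn2r ?nnegrE//; lra.
have Ny : H t - c * P t @[t --> +oo] --> 0.
  rewrite -[X in _ --> X](_ : c - c * 1 = 0); last by ring.
  apply: cvgB; first exact: Hy.
  by apply: cvgM; [exact: cvg_cst|exact: lowerP_cvgy].
have dK t : 0 < t -> is_derive t 1 (fun t => K * (t ^+ 2 * p t)) (K * (t * (a + 1 - t) * p t)).
  move=> t0; apply: is_derive_eq (deriveM_fun (deriveC_fun K t) (dx2p t0)) _.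
  by rewrite mul0r add0r.
have key t : x <= t -> K * (t * (a + 1 - t)) <= - (K / 2 * t ^+ 2).
  move=> xt; have t0 := lt_le_trans x0 xt.
  have : 0 <= K * t * (t / 2 - (a + 1)).
    apply: mulr_ge0; first by rewrite mulr_ge0// ltW.
    by have := le_trans xx1 xt; rewrite /x1; lra.
  have -> : K * (t * (a + 1 - t)) = - (K * t * (t / 2 - (a + 1))) - K / 2 * t ^+ 2 by field.
  by lra.
have HN : `|H x - c * P x| <= K * (x ^+ 2 * p x).
  apply: (norm_le_lim_pinfty _ _ _ Ny Kx2y) => t xt; have t0 := lt_le_trans x0 xt.
  - exact: dN.
  - exact: dK.
  - rewrite /= mulrA -mulNr normrM (gtr0_norm (p_gt0 t0)) ler_pM2r ?p_gt0//.
    by have := hK _ xt; have := key _ xt; lra.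
have xp0 : 0 < x * p x by rewrite mulr_gt0// p_gt0.
rewrite /F normrM normfV (gtr0_norm xp0) ler_pdivrMr//.
by have -> : K * x * (x * p x) = K * (x ^+ 2 * p x) by ring.
Qed.

Let stein_sol_growth : exists2 D, 0 <= D & forall x, 0 < x -> `|F x| <= D * (1 + x).
Proof.
have [D1 HD1] := stein_sol_bounded; have [D2 HD2] := stein_sol_linear.
exists (`|D1| + `|D2|) => [|x x0]; first by rewrite addr_ge0.
have D1x : 0 <= `|D1| * x by rewrite mulr_ge0// ltW.
have D2x : 0 <= `|D2| * x by rewrite mulr_ge0// ltW.
have n1 := normr_ge0 D1; have n2 := normr_ge0 D2.
rewrite mulrDr mulr1 mulrDl.
have [xx1|/ltW xx1] := leP x x1.
  have : `|F x| <= `|D1| by rewrite (le_trans (HD1 x _)) ?x0// ler_norm.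
  by lra.
have : `|F x| <= `|D2| * x by rewrite (le_trans (HD2 x _))// ler_pM2r// ler_norm.
by lra.
Qed.

(** The formula of [F1] divides by [x]. Boundedness near [0] comes instead from
    [(x^2 p F')' = x p (h' + F)], compared with [(x^2 p)' = x (a + 1 - x) p], which is at least
    [a x p] on []0, 1]]. *)
Let stein_sol1_bounded : exists D, forall x, 0 < x <= 1 -> `|F1 x| <= D.
Proof.
have [D1 D10 HD1] := stein_sol_growth.
pose E := 2 * C + 2 * D1.
have E0 : 0 <= E by rewrite /E addr_ge0// mulr_ge0.
exists (E / a) => x /andP[x0 xle1].
have dG t : 0 < t -> is_derive t 1 (fun t => t ^+ 2 * p t * F1 t) (t * p t * (h1 t + F t)).
  move=> t0; apply: is_derive_eq (deriveM_fun (dx2p t0) (stein_sol1_derive t0)) _.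
  by rewrite /F2; field; rewrite gt_eqF.
have dE t : 0 < t -> is_derive t 1 (fun t => E / a * (t ^+ 2 * p t)) (E / a * (t * (a + 1 - t) * p t)).
  move=> t0; apply: is_derive_eq (deriveM_fun (deriveC_fun (E / a) t) (dx2p t0)) _.
  by rewrite mul0r add0r.
have G0 : t ^+ 2 * p t * F1 t @[t --> 0^'+] --> 0.
  have H' : (h t - c - (a - t) * F t) * (t * p t) @[t --> 0^'+] --> 0.
    apply: (@bounded_cvg0 _ _ _ (C * 4 + `|c| + (a + 1) * (D1 * 2))); last exact: gamma_pdf1_mulx_cvg0.
    near=> t; have t0 : 0 < t by near: t; exact: nbhs_right_gt.
    have t1 : t <= 1 by near: t; exact: nbhs_right_le.
    apply: (le_trans (ler_normB _ _)); apply: lerD.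
      apply: (le_trans (ler_normB _ _)); rewrite lerD2r.
      by near: t.
    rewrite normrM; apply: ler_pM => //.
      by have a0' := a0; rewrite ler_norml; apply/andP; split; lra.
    by apply: (le_trans (HD1 t t0)); rewrite ler_wpM2l//; lra.
  apply: cvg_trans H'; apply: near_eq_cvg; near=> t.
  have t0 : 0 < t by near: t; exact: nbhs_right_gt.
  by rewrite /F1; field; rewrite gt_eqF.
have E00 : E / a * (t ^+ 2 * p t) @[t --> 0^'+] --> 0.
  rewrite -[X in _ --> X](mulr0 (E / a)); apply: cvgM; first exact: cvg_cst.
  have -> : (fun t => t ^+ 2 * p t) = (fun t => t * (t * p t)).
    by apply/funext => t; rewrite expr2 mulrA.
  apply: (@bounded_cvg0 _ _ _ 1); last exact: gamma_pdf1_mulx_cvg0.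
  near=> t; have t0 : 0 < t by near: t; exact: nbhs_right_gt.
  by rewrite gtr0_norm//; near: t; exact: nbhs_right_le.
have key t : 0 < t -> t <= 1 -> E <= E / a * (a + 1 - t).
  move=> t0 t1; rewrite -[leLHS](@divfK _ a) ?gt_eqF//.
  by rewrite ler_wpM2l ?divr_ge0 ?(ltW a0)//; lra.
have hF t : 0 < t -> t <= 1 -> `|h1 t + F t| <= E.
  move=> t0 t1; rewrite (le_trans (ler_normD _ _))// /E.
  apply: lerD; [rewrite (le_trans (h1C t0))// mulrC|rewrite (le_trans (HD1 t t0))// mulrC];
  by rewrite ler_wpM2r//; lra.
have xp0 : 0 < x ^+ 2 * p x by rewrite mulr_gt0 ?exprn_gt0 ?p_gt0.
rewrite -(ler_pM2l xp0) -{1}(gtr0_norm xp0) -normrM (mulrC _ (E / a)).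
apply: (norm_le_lim_right0 x0 _ _ _ G0 E00) => t /andP[t0 tx].
- exact: dG.
- exact: dE.
have t1 := le_trans tx xle1.
have tp0 : 0 < t * p t by rewrite mulr_gt0 ?p_gt0.
have -> : E / a * (t * (a + 1 - t) * p t) = t * p t * (E / a * (a + 1 - t)) by ring.
by rewrite normrM (gtr0_norm tp0) ler_pM2l// (le_trans (hF _ t0 t1))// key.
Unshelve. all: by end_near. Qed.

(** Only the existence of [D] matters: it makes the Gaussian means of the shifted solution finite.
    The exponent is [3] because [F'] is estimated by [(1 + x)^2] and [x F''] contains
    [(a + 1 - x) F']. *)
Lemma stein_sol_poly_growth : exists2 D, 0 <= D & forall x, 0 < x ->
  [/\ `|F x| <= D * (1 + x) ^+ 3, `|F1 x| <= D * (1 + x) ^+ 3 &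
      x * `|F2 x| <= D * (1 + x) ^+ 3].
Proof.
have [D1 D10 HD1] := stein_sol_growth; have [D2 HD2] := stein_sol1_bounded.
pose D3 := `|D2| + C + `|c| + (a + 1) * D1.
have a1 : 0 <= a + 1 by have a0' := a0; lra.
have D30 : 0 <= D3 by rewrite /D3 !addr_ge0// mulr_ge0.
have HF1 x : 0 < x -> `|F1 x| <= D3 * (1 + x) ^+ 2.
  move=> x0; have x21 : 1 <= (1 + x) ^+ 2 by rewrite exprn_ege1//; lra.
  have [xx1|/ltW xx1] := leP x 1.
    apply: (@le_trans _ _ D3); last by rewrite ler_peMr.
    apply: (@le_trans _ _ `|D2|); first by rewrite (le_trans (HD2 x _)) ?x0// ler_norm.
    by rewrite /D3 -!addrA lerDl !addr_ge0// mulr_ge0.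
  rewrite /F1 normrM normfV (gtr0_norm x0) ler_pdivrMr//.
  apply: (@le_trans _ _ (D3 * (1 + x) ^+ 2)); last first.
    by rewrite ler_peMr// mulr_ge0// sqr_ge0.
  apply: (le_trans (ler_normB _ _)); rewrite /D3 [leRHS]mulrDl; apply: lerD; last first.
    rewrite normrM expr2 mulrACA; apply: ler_pM => //; last exact: HD1.
    have ax0 : 0 < a * x by rewrite mulr_gt0.
    by have a0' := a0; rewrite ler_norml; apply/andP; split; lra.
  apply: (le_trans (ler_normB _ _)); rewrite [leRHS]mulrDl; apply: lerD.
    by rewrite [leRHS]mulrDl (le_trans (hC x0))// lerDr mulr_ge0// sqr_ge0.
  by rewrite ler_peMr.
exists (D1 + D3 + (C + D1 + (a + 1) * D3)); first by rewrite !addr_ge0// mulr_ge0.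
move=> x x0; have x11 : 1 <= 1 + x by lra.
have x13 : 1 + x <= (1 + x) ^+ 3 by rewrite -[leLHS]expr1 ler_weXn2l.
have x23 : (1 + x) ^+ 2 <= (1 + x) ^+ 3 by rewrite ler_weXn2l.
have p3 : 0 <= (1 + x) ^+ 3 by rewrite exprn_ge0//; lra.
have aD3 : 0 <= (a + 1) * D3 by rewrite mulr_ge0.
split.
- apply: (le_trans (HD1 x x0)); apply: ler_pM => //; first by lra.
  by have C0' := C0; lra.
- apply: (le_trans (HF1 x x0)); apply: ler_pM => //; first by rewrite sqr_ge0.
  by have C0' := C0; lra.
- have -> : x * `|F2 x| = `|h1 x + F x - (a + 1 - x) * F1 x|.
    rewrite -{1}(gtr0_norm x0) -normrM /F2; congr `| _ |; field.
    by rewrite gt_eqF.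
  apply: (@le_trans _ _ ((C + D1 + (a + 1) * D3) * (1 + x) ^+ 3)); last first.
    by rewrite ler_wpM2r// lerDr addr_ge0.
  apply: (le_trans (ler_normB _ _)); rewrite [leRHS]mulrDl; apply: lerD.
    apply: (le_trans (ler_normD _ _)); rewrite [leRHS]mulrDl; apply: lerD.
      by apply: (le_trans (h1C x0)); rewrite ler_wpM2l.
    by apply: (le_trans (HD1 x x0)); rewrite ler_wpM2l.
  rewrite normrM exprS mulrACA; apply: ler_pM => //; last exact: HF1.
  have ax0 : 0 < a * x by rewrite mulr_gt0.
  by have a0' := a0; rewrite ler_norml; apply/andP; split; lra.
Qed.

End gamma_stein_solution.

(** * The Stein equation for an arbitrary scale *)

Section gamma_stein_scaled.
Context {R : realType}.
Local Notation mu := (@lebesgue_measure R).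
Implicit Types a b x y : R.

Definition gamma_mean a b (h : R -> R) : R :=
  \int[mu]_(x in `]0, +oo[) (h x * gamma_pdf a b x).

(** All that the probabilistic part uses of a solution, apart from the sharp bound on [f2]. Near [0]
    only [x f2] is controlled, not [f2]. *)
Definition gamma_stein_sol a b (h f f1 f2 : R -> R) :=
  [/\ forall x, 0 < x -> is_derive x 1 f (f1 x),
      forall x, 0 < x -> is_derive x 1 f1 (f2 x),
      forall x, 0 < x -> {for x, continuous f2},
      forall x, 0 < x ->
        b * x * f1 x + (a * b - x) * f x = h x - gamma_mean a b h &
      exists2 D, 0 <= D & forall x, 0 < x ->
        [/\ `|f x| <= D * (1 + x) ^+ 3, `|f1 x| <= D * (1 + x) ^+ 3 &
            x * `|f2 x| <= D * (1 + x) ^+ 3] ].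

Variables (a b : R).
Hypotheses (a0 : 0 < a) (b0 : 0 < b).

Lemma gamma_pdf_scale y : 0 < y -> b * gamma_pdf a b (b * y) = gamma_pdf a 1 y.
Proof.
move=> y0; have by0 : 0 < b * y by rewrite mulr_gt0.
have ba : b `^ a = b * b `^ (a - 1) by rewrite mulr_powRB1// ltW.
rewrite !gamma_pdf_pos// powR1 ba powRM ?ltW//.
have -> : - (b * y) / b = - y / 1 by field; rewrite gt_eqF.
have bp : b `^ (a - 1) != 0 by rewrite gt_eqF// powR_gt0.
by field; rewrite bp !gt_eqF// gamma_function_gt0.
Qed.

Variables (h h1 : R -> R) (C : R).
Hypothesis dh : forall x, 0 < x -> is_derive x 1 h (h1 x).
Hypothesis ch1 : forall x, 0 < x -> {for x, continuous h1}.
Hypothesis hC : forall x, 0 < x -> `|h x| <= C * (1 + x) ^+ 2.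
Hypothesis h1C : forall x, 0 < x -> `|h1 x| <= C * (1 + x).

Let chp x : 0 < x -> {for x, continuous (fun x => h x * gamma_pdf a b x)}.
Proof.
move=> x0; apply: cvgM; first exact: is_derive_continuous (dh x0).
by apply: gamma_pdf_continuous => //; rewrite gt_eqF.
Qed.

Let k := (gamma_function a * b `^ a)^-1.

Let hpC x : 0 < x -> `|h x * gamma_pdf a b x| <=
  C * k * ((1 + x) ^+ 2 * (x `^ (a - 1) * expR (- x / b))).
Proof.
move=> x0; have k0 : 0 <= k.
  by rewrite invr_ge0 mulr_ge0 ?powR_ge0 ?ltW ?gamma_function_gt0.
have w0 : 0 <= x `^ (a - 1) * expR (- x / b) by rewrite mulr_ge0 ?powR_ge0 ?expR_ge0.
rewrite gamma_pdf_pos// -/k normrM (ger0_norm (mulr_ge0 k0 w0)).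
have -> : C * k * ((1 + x) ^+ 2 * (x `^ (a - 1) * expR (- x / b))) =
  C * (1 + x) ^+ 2 * (k * (x `^ (a - 1) * expR (- x / b))) by ring.
by rewrite ler_wpM2r ?hC// mulr_ge0.
Qed.

Lemma gamma_mean_integrable :
  mu.-integrable `]0%R, +oo[ (EFin \o (fun x => h x * gamma_pdf a b x)).
Proof. exact: (@weighted_integrable _ a b a0 b0 _ _ _ chp hpC). Qed.

Let dscale (f : R -> R) (df : R) y : is_derive (b * y) 1 f df ->
  is_derive y 1 (fun y => f (b * y)) (df * b).
Proof.
move=> dfy; have dl : is_derive y 1 (fun y => b * y) b.
  apply: is_derive_eq (deriveM_fun (deriveC_fun b y) (deriveI_fun y)) _.
  by rewrite mul0r add0r mulr1.
exact: (@derive_comp _ f (fun y => b * y) y _ _ dfy dl).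
Qed.

Section scaled_solution.
Variable s : R.
Hypothesis s0 : 0 < s.

Let Hb x := \int[mu]_(t in `]0, x[) (h t * gamma_pdf a b t).
Let dHb x := @weighted_primitive_derive _ a b a0 b0 _ _ _ chp hpC x.
Let Hb0 := @weighted_primitive_cvg0 _ a b a0 b0 _ _ _ chp hpC.
Let Hby := @weighted_primitive_cvgy _ a b a0 b0 _ _ _ chp hpC.

(** The substitution [x = b y] leads back to scale [1]. The factor [s] normalises the test function:
    [s = b] gives [|g'| <= 1] when [|h'| <= 1], and [s = b^2] gives [|g''| <= 1] when
    [|h''| <= 1]. *)
Let g y := h (b * y) / s.
Let g1 y := h1 (b * y) * b / s.
Let Hg y := Hb (b * y) / s.
Let c := gamma_mean a b h / s.
Let D := C / s * (1 + b) ^+ 3.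

Let dg y : 0 < y -> is_derive y 1 g (g1 y).
Proof.
move=> y0; have by0 : 0 < b * y by rewrite mulr_gt0.
apply: is_derive_eq (deriveM_fun (dscale (dh by0)) (deriveC_fun s^-1 y)) _.
by rewrite mulr0 addr0.
Qed.

Let dHg y : 0 < y -> is_derive y 1 Hg (g y * gamma_pdf a 1 y).
Proof.
move=> y0; have by0 : 0 < b * y by rewrite mulr_gt0.
apply: is_derive_eq (deriveM_fun (dscale (dHb by0)) (deriveC_fun s^-1 y)) _.
by rewrite -gamma_pdf_scale// /g; ring.
Qed.

Let Hg0 : Hg y @[y --> 0^'+] --> 0.
Proof.
rewrite -[X in _ --> X](mul0r s^-1); apply: cvgM; last exact: cvg_cst.
apply: (cvg_comp (fun y => b * y) Hb _ Hb0).
have bl : b * y @[y --> 0^'+] --> (0 : R).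
  apply: cvg_at_right_filter; rewrite -[X in _ --> X](mulr0 b).
  by apply: cvgM; [exact: cvg_cst|exact: cvg_id].
move=> S /= [e e0 HS].
near=> y; apply: HS => /=.
  rewrite sub0r normrN; near: y.
  have /cvgrPdist_lt/(_ _ e0) := bl; apply: filterS => y.
  by rewrite sub0r normrN.
by rewrite mulr_gt0//; near: y; exact: nbhs_right_gt.
Unshelve. all: by end_near. Qed.

Let Hgy : Hg y @[y --> +oo] --> c.
Proof.
apply: cvgM; last exact: cvg_cst.
apply: (cvg_comp (fun y => b * y) Hb _ Hby).
by apply: gt0_cvgMry => //; exact: cvg_id.
Qed.

Let C0 : 0 <= C.
Proof.
have := le_trans (normr_ge0 _) (hC ltr01).
by rewrite pmulr_lge0// exprn_gt0// addr_gt0.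
Qed.

Let gC y : 0 < y -> `|g y| <= D * (1 + y) ^+ 2.
Proof.
move=> y0; have by0 : 0 < b * y by rewrite mulr_gt0.
rewrite /g normrM normfV (gtr0_norm s0) ler_pdivrMr//.
apply: (le_trans (hC by0)).
have -> : D * (1 + y) ^+ 2 * s = C * ((1 + b) * ((1 + b) * (1 + y)) ^+ 2).
  by rewrite /D; field; rewrite gt_eqF.
rewrite ler_wpM2l//; apply: (@le_trans _ _ (((1 + b) * (1 + y)) ^+ 2)); last first.
  by rewrite ler_peMl ?sqr_ge0// lerDl ltW.
rewrite lerXn2r ?nnegrE ?mulr_ge0 ?addr_ge0 ?ltW//.
by rewrite mulrDl mul1r mulrDr mulr1; have := b0; lra.
Qed.

Let g1C y : 0 < y -> `|g1 y| <= D * (1 + y).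
Proof.
move=> y0; have by0 : 0 < b * y by rewrite mulr_gt0.
rewrite /g1 normrM normfV (gtr0_norm s0) ler_pdivrMr//.
rewrite normrM (gtr0_norm b0).
have -> : D * (1 + y) * s = C * ((1 + b) * (1 + y)) * (1 + b) ^+ 2.
  by rewrite /D; field; rewrite gt_eqF.
apply: ler_pM => //; first exact: ltW.
  apply: (le_trans (h1C by0)); rewrite ler_wpM2l//.
  by rewrite mulrDl mul1r mulrDr mulr1; have := b0; lra.
have b20 : 0 < b ^+ 2 by rewrite exprn_gt0.
have -> : (1 + b) ^+ 2 = 1 + 2 * b + b ^+ 2 by ring.
by have := b0; lra.
Qed.

Let F := stein_sol a Hg c.
Let F1 := stein_sol1 a g Hg c.
Let F2 := stein_sol2 a g g1 Hg c.

Definition scaled_sol x := s / b * F (x / b).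
Definition scaled_sol1 x := s / b ^+ 2 * F1 (x / b).
Definition scaled_sol2 x := s / b ^+ 3 * F2 (x / b).

Let dunscale (f : R -> R) (df : R) x : is_derive (x / b) 1 f df ->
  is_derive x 1 (fun x => f (x / b)) (df / b).
Proof.
move=> dfx; have dl : is_derive x 1 (fun x => x / b) b^-1.
  apply: is_derive_eq (deriveM_fun (deriveI_fun x) (deriveC_fun b^-1 x)) _.
  by rewrite mul1r mulr0 addr0.
exact: (@derive_comp _ f (fun x => x / b) x _ _ dfx dl).
Qed.

Lemma scaled_solP : gamma_stein_sol a b h scaled_sol scaled_sol1 scaled_sol2.
Proof.
have xb0 x : 0 < x -> 0 < x / b by move=> x0; rewrite divr_gt0.
split.
- move=> x x0; have H := stein_sol_derive a0 c dHg (xb0 x x0).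
  apply: is_derive_eq (deriveM_fun (deriveC_fun (s / b) x) (dunscale H)) _.
  by rewrite /scaled_sol1 /F1; field; rewrite gt_eqF.
- move=> x x0; have H := stein_sol1_derive a0 c dg dHg (xb0 x x0).
  apply: is_derive_eq (deriveM_fun (deriveC_fun (s / b ^+ 2) x) (dunscale H)) _.
  by rewrite /scaled_sol2 /F2; field; rewrite gt_eqF.
- move=> x x0; apply: cvgM; first exact: cvg_cst.
  have cl : {for x, continuous (fun x => x / b)}.
    by apply: cvgM; [exact: cvg_id|exact: cvg_cst].
  have cl2 : {for x / b, continuous (fun x => b * x)}.
    by apply: cvgM; [exact: cvg_cst|exact: cvg_id].
  have ch1b : {for b * (x / b), continuous h1}.
    by rewrite mulrCA mulfV ?mulr1 ?gt_eqF//; exact: ch1.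
  have cg1 : {for x / b, continuous g1}.
    apply: cvgM; last exact: cvg_cst.
    apply: cvgM; last exact: cvg_cst.
    exact: (continuous_comp cl2 ch1b).
  have cF2 : {for x / b, continuous F2}.
    exact: (@stein_sol2_continuous _ a a0 g g1 Hg c dg dHg (x / b) (xb0 x x0) cg1).
  exact: (@continuous_comp _ _ _ (fun x => x / b) F2 x cl cF2).
- move=> x x0; have := stein_equation a g Hg c (xb0 x x0).
  have -> : g (x / b) = h x / s.
    by rewrite /g; congr (h _ / _); field; rewrite gt_eqF.
  rewrite -/F -/F1 /c => E.
  have -> : h x - gamma_mean a b h = s * (h x / s - gamma_mean a b h / s).
    by field; rewrite gt_eqF.
  by rewrite -E /scaled_sol /scaled_sol1; field; rewrite gt_eqF.
- have [E E0 HE] := stein_sol_poly_growth a0 dg gC g1C dHg Hg0 Hgy.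
  pose r := 1 + b^-1; have bi : 0 < b^-1 by rewrite invr_gt0.
  have r1 : 1 <= r by rewrite lerDl ltW.
  have r0 : 0 <= r by rewrite (le_trans ler01).
  have sb1 : 0 <= s / b by rewrite divr_ge0 ?ltW.
  have sb2 : 0 <= s / b ^+ 2 by rewrite divr_ge0 ?exprn_ge0 ?ltW.
  have Er0 : 0 <= E * r ^+ 3 by rewrite mulr_ge0// exprn_ge0.
  exists ((s / b + s / b ^+ 2) * (E * r ^+ 3)) => [|x x0].
    by rewrite mulr_ge0// addr_ge0.
  have xE : E * (1 + x / b) ^+ 3 <= E * r ^+ 3 * (1 + x) ^+ 3.
    rewrite -mulrA ler_wpM2l// -exprMn lerXn2r ?nnegrE//.
    - by rewrite addr_ge0// ltW// divr_gt0.
    - by rewrite mulr_ge0// addr_ge0// ltW.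
    - have -> : r * (1 + x) = 1 + x / b + (x + b^-1) by rewrite /r; field; rewrite gt_eqF.
      by rewrite lerDl addr_ge0// ltW.
  have x3 : 0 <= (1 + x) ^+ 3 by rewrite exprn_ge0// addr_ge0// ltW.
  have Er3 : 0 <= E * r ^+ 3 * (1 + x) ^+ 3 by rewrite mulr_ge0.
  have [H1 H2 H3] := HE _ (xb0 _ x0).
  split; rewrite -mulrA.
  + rewrite /scaled_sol normrM ger0_norm//; apply: ler_pM => //.
      by rewrite lerDl.
    exact: le_trans xE.
  + rewrite /scaled_sol1 normrM ger0_norm//; apply: ler_pM => //.
      by rewrite lerDr.
    exact: le_trans xE.
  + rewrite /scaled_sol2 normrM ger0_norm; last first.
      by rewrite divr_ge0 ?exprn_ge0 ?ltW.
    have -> : x * (s / b ^+ 3 * `|F2 (x / b)|) = s / b ^+ 2 * (x / b * `|F2 (x / b)|).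
      by field; rewrite gt_eqF.
    apply: ler_pM => //; last exact: le_trans xE.
      by rewrite mulr_ge0// ltW// divr_gt0.
    by rewrite lerDr.
Qed.

Lemma scaled_sol2_le1 : (forall y, 0 < y -> `|g1 y| <= 1) ->
  forall x, 0 < x -> x * `|scaled_sol2 x| <= s / b ^+ 2 * 2.
Proof.
move=> g11 x x0; have xb0 : 0 < x / b by rewrite divr_gt0.
have F22 := stein_sol2_le1 a0 dg gC dHg Hg0 Hgy g11 xb0.
rewrite /scaled_sol2 normrM ger0_norm; last by rewrite divr_ge0 ?exprn_ge0 ?ltW.
have -> : x * (s / b ^+ 3 * `|F2 (x / b)|) = s / b ^+ 2 * (x / b * `|F2 (x / b)|).
  by field; rewrite gt_eqF.
by rewrite ler_wpM2l// divr_ge0 ?exprn_ge0 ?ltW.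
Qed.

Lemma scaled_sol2_le_C2 (g2 : R -> R) :
  (forall y, 0 < y -> is_derive y 1 g1 (g2 y)) ->
  (forall y, 0 < y -> `|g2 y| <= 1) ->
  forall x, 0 < x -> `|scaled_sol2 x| <= s / b ^+ 3 * C2 a (x / b).
Proof.
move=> dg1 g21 x x0; have xb0 : 0 < x / b by rewrite divr_gt0.
have F22 := stein_sol2_le_C2 a0 dg gC g1C dHg Hg0 Hgy dg1 g21 xb0.
have sb0 : 0 <= s / b ^+ 3 by rewrite divr_ge0 ?exprn_ge0 ?ltW.
by rewrite /scaled_sol2 normrM (ger0_norm sb0) ler_wpM2l.
Qed.

End scaled_solution.

Lemma gamma_stein1 : (forall x, 0 < x -> `|h1 x| <= 1) ->
  exists f f1 f2, gamma_stein_sol a b h f f1 f2 /\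
    forall x, 0 < x -> x * `|f2 x| <= 2 / b.
Proof.
move=> h11; do 3 eexists; split; first exact: (scaled_solP b0).
move=> x x0; have -> : 2 / b = b / b ^+ 2 * 2 by field; rewrite gt_eqF.
apply: scaled_sol2_le1 => // y y0.
by rewrite mulfK ?gt_eqF// h11// mulr_gt0.
Qed.

Lemma gamma_stein2 (h2 : R -> R) :
  (forall x, 0 < x -> is_derive x 1 h1 (h2 x)) ->
  (forall x, 0 < x -> `|h2 x| <= 1) ->
  exists f f1 f2, gamma_stein_sol a b h f f1 f2 /\
    forall x, 0 < x -> `|f2 x| <= C2 a (x / b) / b.
Proof.
move=> dh1 h21; have b20 : 0 < b ^+ 2 by rewrite exprn_gt0.
do 3 eexists; split; first exact: (scaled_solP b20).
move=> x x0.
have -> : C2 a (x / b) / b = b ^+ 2 / b ^+ 3 * C2 a (x / b) by field; rewrite gt_eqF.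
apply: (scaled_sol2_le_C2 b20 (g2 := fun y => h2 (b * y))) => // y y0.
  have by0 : 0 < b * y by rewrite mulr_gt0.
  apply: is_derive_eq (deriveM_fun (deriveM_fun (dscale (dh1 _ by0)) (deriveC_fun b y))
    (deriveC_fun (b ^+ 2)^-1 y)) _.
  by field; rewrite gt_eqF.
by rewrite h21// mulr_gt0.
Qed.

End gamma_stein_scaled.

(** * Gaussian integration by parts *)

Section density.
Context {R : realType}.
Local Notation mu := (@lebesgue_measure R).
Variables (nu : probability (measurableTypeR R) R) (f : R -> R).
Hypothesis mf : measurable_fun setT f.
Hypothesis f0 : forall x, 0 <= f x.
Hypothesis nuf : forall A : set R, measurable A -> nu A = (\int[mu]_(x in A) (f x)%:E)%E.
Implicit Types g : R -> \bar R.

Let nu_dom : nu `<< mu.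
Proof.
apply/null_content_dominatesP => A mA muA0; rewrite nuf//.
apply: null_set_integral => //; apply/measurable_EFinP.
exact: measurable_funTS.
Qed.

(** [f] and the Radon-Nikodym derivative have the same integral over every measurable set, hence
    agree almost everywhere; the change of variables stated for the latter then holds for [f]. *)
Let ae_f : ae_eq mu setT (Radon_Nikodym_SigmaFinite.f nu mu) (EFin \o f).
Proof.
apply: integral_ae_eq => //.
- exact: Radon_Nikodym_SigmaFinite.f_integrable.
- by apply/measurable_EFinP.
- move=> E _ mE; transitivity (nu E); last exact: nuf.
  exact/esym/(Radon_Nikodym_SigmaFinite.f_integral nu_dom mE).
Qed.

Lemma ge0_integral_density g : measurable_fun setT g -> (forall x, 0 <= g x)%E ->
  (\int[nu]_x g x = \int[mu]_x (g x * (f x)%:E))%E.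
Proof.
move=> mg g0.
rewrite -(Radon_Nikodym_SigmaFinite.change_of_variables nu_dom)//.
apply: ae_eq_integral => //.
- apply: emeasurable_funM => //.
  exact: measurable_int (Radon_Nikodym_SigmaFinite.f_integrable nu_dom).
- by apply: emeasurable_funM => //; apply/measurable_EFinP.
- exact: (@ae_eqe_mul2l _ (measurableTypeR R) R mu setT _ _ g ae_f).
Qed.

Lemma integrable_density g : measurable_fun setT g ->
  mu.-integrable setT (fun x => g x * (f x)%:E)%E -> nu.-integrable setT g.
Proof.
move=> mg /integrableP[_ ig]; apply/integrableP; split => //.
rewrite ge0_integral_density//; last exact: measurableT_comp.
by under eq_integral => x _ do rewrite -[(f x)%:E]gee0_abs ?lee_fin// -abseM.
Qed.

Lemma integral_density g : nu.-integrable setT g ->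
  (\int[nu]_x g x = \int[mu]_x (g x * (f x)%:E))%E.
Proof.
move=> ig; have mg := measurable_int _ ig.
have igf (h : R -> \bar R) : (forall x, 0 <= h x)%E -> nu.-integrable setT h ->
    mu.-integrable setT (fun x => h x * (f x)%:E)%E.
  move=> h0 ih; have mh := measurable_int _ ih.
  apply/integrableP; split.
    by apply: emeasurable_funM => //; apply/measurable_EFinP.
  have -> : (\int[mu]_x `|h x * (f x)%:E| = \int[mu]_x (h x * (f x)%:E))%E.
    by apply: eq_integral => x _; rewrite gee0_abs// mule_ge0// lee_fin.
  rewrite -ge0_integral_density//.
  have /integrableP[_] := ih; apply: le_lt_trans.
  by apply: ge0_le_integral => //; [exact: measurableT_comp|move=> x _; exact: lee_abs].
have ip := integrable_funepos measurableT ig.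
have im := integrable_funeneg measurableT ig.
rewrite integralE !ge0_integral_density//; last 2 first.
- exact: measurable_int im.
- exact: measurable_int ip.
rewrite -integralB//; [|exact: igf|exact: igf].
apply: eq_integral => x _ /=; rewrite -muleBl//; last exact: add_def_funeposneg.
by rewrite [in RHS](funeposneg g).
Qed.

End density.

Section rv_density.
Context {R : realType} d (T : measurableType d) (P : probability T R).
Local Notation mu := (@lebesgue_measure R).

Let mfun_measurableTypeR (X : {RV P >-> R}) :
  @measurable_fun _ _ T (measurableTypeR R) setT X.
Proof. exact: (measurable_funPT X). Qed.

(* The measurable structures of [R] and of [measurableTypeR R], on which the
   Lebesgue measure lives, are not definitionally the same. *)
Definition rv_measurableTypeR (X : {RV P >-> R}) : {RV P >-> measurableTypeR R} :=
  HB.pack_for {RV P >-> measurableTypeR R} (X : T -> measurableTypeR R)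
    (@isMeasurableFun.Build _ _ T (measurableTypeR R) X (@mfun_measurableTypeR X)).

Variables (X : {RV P >-> R}) (f : R -> R).
Hypothesis mf : measurable_fun setT f.
Hypothesis f0 : forall x, 0 <= f x.
Hypothesis Xf : has_law X (fun A => \int[mu]_(x in A) (f x)%:E)%E.
Implicit Types g : R -> \bar R.

Let nu : probability (measurableTypeR R) R := distribution P (rv_measurableTypeR X).

Let nuf (A : set R) : measurable A -> nu A = (\int[mu]_(x in A) (f x)%:E)%E.
Proof. exact: Xf. Qed.

Lemma ge0_expectation_density g : measurable_fun setT g -> (forall x, 0 <= g x)%E ->
  (\int[P]_w g (X w) = \int[mu]_x (g x * (f x)%:E))%E.
Proof.
move=> mg g0; rewrite -(ge0_integral_density mf nuf)//.
by rewrite ge0_integral_distribution.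
Qed.

Lemma integrable_expectation_density g : measurable_fun setT g ->
  mu.-integrable setT (fun x => g x * (f x)%:E)%E ->
  P.-integrable setT (fun w => g (X w)).
Proof.
move=> mg /integrableP[_ ig]; apply/integrableP; split.
  by apply: measurableT_comp.
rewrite (ge0_expectation_density (g := fun x => `|g x|%E))//; last exact: measurableT_comp.
by under eq_integral => x _ do rewrite -[(f x)%:E]gee0_abs ?lee_fin// -abseM.
Qed.

Lemma expectation_density g : measurable_fun setT g ->
  P.-integrable setT (fun w => g (X w)) ->
  (\int[P]_w g (X w) = \int[mu]_x (g x * (f x)%:E))%E.
Proof.
move=> mg ig; rewrite -(integral_density mf f0 nuf); last first.
  apply/integrableP; split => //.
  rewrite ge0_integral_distribution//; last exact: measurableT_comp.
  by have /integrableP[] := ig.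
by rewrite (integral_distribution (X := rv_measurableTypeR X)).
Qed.

End rv_density.

(** * Polynomials against a Gaussian weight *)

Section gaussian_weight.
Context {R : realType}.
Local Notation mu := (@lebesgue_measure R).
Variable s : R.
Hypothesis s0 : 0 < s.
Implicit Types (x : R) (m : nat).

Let s_neq0 : s != 0.
Proof. by rewrite gt_eqF. Qed.

Let phi := normal_pdf 0 s.

Let phiE x : phi x = normal_peak s * expR (- x ^+ 2 / (s ^+ 2 *+ 2)).
Proof. by rewrite /phi /normal_pdf (negbTE s_neq0) /normal_fun subr0. Qed.

Let phi_ge0 x : 0 <= phi x.
Proof. exact: normal_pdf_ge0. Qed.

(** [1 + y <= L exp ((1 + y) / L)] is raised to the power [m]; with [L = (m + 1) c] the exponent
    [m (1 + y) / L] is at most [(1 + y) / c]. *)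
Lemma poly_le_expR (c : R) m : 0 < c ->
  exists2 K, 0 <= K & forall y, 0 <= y -> (1 + y) ^+ m <= K * expR (y / c).
Proof.
move=> c0; pose L := m.+1%:R * c; have L0 : 0 < L by rewrite mulr_gt0// ltr0n.
exists (L ^+ m * expR c^-1); first by rewrite mulr_ge0 ?expR_ge0// exprn_ge0// ltW.
move=> y y0; have y1 : 0 <= 1 + y by rewrite addr_ge0.
have H : 1 + y <= L * expR ((1 + y) / L).
  rewrite -ler_pdivrMl// mulrC.
  by apply: le_trans (expR_ge1Dx _); rewrite lerDr.
have : (1 + y) ^+ m <= (L * expR ((1 + y) / L)) ^+ m.
  by rewrite lerXn2r ?nnegrE// (le_trans y1).
move=> /le_trans; apply; rewrite exprMn -mulrA -expRD.
rewrite ler_wpM2l ?exprn_ge0 ?(ltW L0)// -expRM_natl ler_expR.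
have -> : c^-1 + y / c = (1 + y) / c by field; rewrite gt_eqF.
have -> : m%:R * ((1 + y) / L) = m%:R / m.+1%:R * ((1 + y) / c).
  by rewrite /L; field; rewrite gt_eqF//= pnatr_eq0.
rewrite ler_piMl//.
  by rewrite divr_ge0// ltW.
by rewrite ler_pdivrMr ?ltr0n// mul1r ler_nat.
Qed.

(** Half of the Gaussian exponent absorbs the polynomial. The other half is the exponent of the
    normal density of deviation [Num.sqrt 2 * s], which is integrable. *)
Lemma gaussian_poly_le m : exists2 K, 0 <= K &
  forall x, (1 + x ^+ 2) ^+ m * phi x <= K * normal_pdf 0 (Num.sqrt 2 * s) x.
Proof.
have c0 : 0 < s ^+ 2 *+ 2 *+ 2 by rewrite !mulrn_wgt0// exprn_gt0.
have [K K0 HK] := @poly_le_expR (s ^+ 2 *+ 2 *+ 2) m c0.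
have r0 : Num.sqrt 2 * s != 0 by rewrite mulf_neq0// gt_eqF// sqrtr_gt0.
have p0 := normal_peak_gt0 r0; have q0 := normal_peak_gt0 s_neq0.
exists (K * normal_peak s / normal_peak (Num.sqrt 2 * s)).
  by rewrite divr_ge0 ?mulr_ge0// ltW.
move=> x; rewrite phiE /normal_pdf (negbTE r0) /normal_fun subr0.
rewrite exprMn sqr_sqrtr// (mulrCA _ (normal_peak s)).
rewrite [leRHS](_ : _ = normal_peak s * (K * expR (- x ^+ 2 / (2 * s ^+ 2 *+ 2)))); last first.
  by field; rewrite gt_eqF// gt_eqF.
rewrite ler_pM2l//.
have -> : expR (- x ^+ 2 / (2 * s ^+ 2 *+ 2)) =
    expR (x ^+ 2 / (s ^+ 2 *+ 2 *+ 2)) * expR (- x ^+ 2 / (s ^+ 2 *+ 2)).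
  by rewrite -expRD; congr expR; field.
by rewrite mulrA ler_wpM2r ?expR_ge0// HK// sqr_ge0.
Qed.

Variables (g : R -> R) (D : R) (m : nat).
Hypothesis mg : measurable_fun setT g.
Hypothesis gD : forall x, `|g x| <= D * (1 + x ^+ 2) ^+ m.

Lemma gaussian_poly_integrable : mu.-integrable setT (fun x => (g x * phi x)%:E).
Proof.
have [K K0 HK] := gaussian_poly_le m.
have r0 : Num.sqrt 2 * s != 0 by rewrite mulf_neq0// gt_eqF// sqrtr_gt0.
have ik : mu.-integrable setT (fun x => (`|D| * K)%:E * (normal_pdf 0 (Num.sqrt 2 * s) x)%:E)%E.
  by apply: integrableZl => //; exact: integrable_normal_pdf.
apply: (le_integrable _ _ _ ik) => //.
  apply/measurable_EFinP; apply: measurable_funM => //; exact: measurable_normal_pdf.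
move=> x _ /=; rewrite lee_fin [leRHS]ger0_norm; last first.
  by rewrite !mulr_ge0// normal_pdf_ge0.
rewrite normrM (ger0_norm (phi_ge0 x)) -mulrA.
apply: (@le_trans _ _ (`|D| * ((1 + x ^+ 2) ^+ m * phi x))); last by rewrite ler_wpM2l.
rewrite mulrA ler_wpM2r//; apply: (le_trans (gD x)).
by rewrite ler_wpM2r ?ler_norm// exprn_ge0// addr_ge0// sqr_ge0.
Qed.

End gaussian_weight.

Section gaussian_ibp.
Context {R : realType}.
Local Notation mu := (@lebesgue_measure R).
Variable s : R.
Hypothesis s0 : 0 < s.
Let phi := normal_pdf 0 s.
Variables (G g : R -> R) (D : R) (m : nat).
Hypothesis dG : forall x : R, is_derive x 1 G (g x).
Hypothesis cg : forall x, {for x, continuous g}.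
Hypothesis GD : forall x, `|G x| <= D * (1 + x ^+ 2) ^+ m.
Hypothesis gD : forall x, `|g x| <= D * (1 + x ^+ 2) ^+ m.

Implicit Types x : R.

Let s_neq0 : s != 0.
Proof. by rewrite gt_eqF. Qed.

Let dphi x : is_derive x 1 phi (- (x / s ^+ 2) * phi x).
Proof.
pose q (x : R) := - x ^+ 2 / (s ^+ 2 *+ 2).
have dq : is_derive x 1 q (- (x / s ^+ 2)).
  have -> : q = fun x => - (x * x) * (s ^+ 2 *+ 2)^-1.
    by apply/funext => y; rewrite /q expr2.
  apply: is_derive_eq (deriveM_fun (deriveN_fun (deriveM_fun (deriveI_fun x)
    (deriveI_fun x))) (deriveC_fun (s ^+ 2 *+ 2)^-1 x)) _.
  by field.
have E : phi = (fun x => normal_peak s * expR (q x)).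
  by apply/funext => y; rewrite /phi /normal_pdf (negbTE s_neq0) /normal_fun subr0.
rewrite E.
apply: is_derive_eq (deriveM_fun (deriveC_fun (normal_peak s) x)
  (@derive_comp _ expR q x _ _ (is_derive_expR _) dq)) _.
by rewrite mul0r add0r; ring.
Qed.

(** Since [phi' = - (x / s^2) phi], the derivative of [Psi] is the difference of the two integrands
    to be compared, and it remains to see that this difference has integral [0]. *)
Let Psi x := - (s ^+ 2 * (G x * phi x)).
Let psi x := x * G x * phi x - s ^+ 2 * (g x * phi x).

Let dPsi x : is_derive x 1 Psi (psi x).
Proof.
apply: is_derive_eq (deriveN_fun (deriveM_fun (deriveC_fun (s ^+ 2) x)
  (deriveM_fun (dG x) (dphi x)))) _.
by rewrite /psi; field.
Qed.

Let cphi x : {for x, continuous phi}.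
Proof. exact: is_derive_continuous (dphi x). Qed.

Let cG x : {for x, continuous G}.
Proof. exact: is_derive_continuous (dG x). Qed.

Let cpsi x : {for x, continuous psi}.
Proof.
apply: cvgB.
  by apply: cvgM; [apply: cvgM; [exact: cvg_id|exact: cG]|exact: cphi].
by apply: cvgM; [exact: cvg_cst|apply: cvgM; [exact: cg|exact: cphi]].
Qed.

Let mG : measurable_fun setT G.
Proof. exact: continuous_measurable_fun. Qed.

Let mg : measurable_fun setT g.
Proof. exact: continuous_measurable_fun. Qed.

Let xGD x : `|x * G x| <= D * (1 + x ^+ 2) ^+ m.+1.
Proof.
rewrite normrM exprS mulrCA; apply: ler_pM => //.
have x0 : 0 <= x ^+ 2 by rewrite sqr_ge0.
have : 0 <= (`|x| - 1) ^+ 2 by rewrite sqr_ge0.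
by rewrite sqrrB1 real_normK ?num_real//; have := normr_ge0 x; lra.
Qed.

Let mxG : measurable_fun setT (fun x => x * G x).
Proof. by apply: measurable_funM. Qed.

Lemma gaussian_ibp_integrable1 : mu.-integrable setT (fun x => (x * G x * phi x)%:E).
Proof. exact: (gaussian_poly_integrable s0 mxG xGD). Qed.

Lemma gaussian_ibp_integrable2 : mu.-integrable setT (fun x => (g x * phi x)%:E).
Proof. exact: (gaussian_poly_integrable s0 mg gD). Qed.

Let ipsi : mu.-integrable setT (EFin \o psi).
Proof.
have H1 := gaussian_ibp_integrable1.
have H2 := integrableZl measurableT (s ^+ 2) gaussian_ibp_integrable2.
pose proof (integrableB measurableT H1 H2) as H3; exact: H3.
Qed.

(** The extra factor [1 + x^2] turns boundedness into decay at infinity. *)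
Let Psi_bounded : exists B, forall x, `|Psi x| * (1 + x ^+ 2) <= B.
Proof.
have [K K0 HK] := gaussian_poly_le s0 m.+1.
have r0 : Num.sqrt 2 * s != 0 by rewrite mulf_neq0// gt_eqF// sqrtr_gt0.
exists (s ^+ 2 * (`|D| * (K * normal_peak (Num.sqrt 2 * s)))) => x.
have p0 : 0 <= phi x := normal_pdf_ge0 _ _ _.
have x1 : 0 <= 1 + x ^+ 2 by rewrite addr_ge0// sqr_ge0.
rewrite /Psi normrN normrM ger0_norm ?sqr_ge0// -mulrA ler_wpM2l ?sqr_ge0//.
rewrite normrM (ger0_norm p0).
apply: (@le_trans _ _ (`|D| * ((1 + x ^+ 2) ^+ m.+1 * phi x))).
  have -> : `|D| * ((1 + x ^+ 2) ^+ m.+1 * phi x) =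
      `|D| * (1 + x ^+ 2) ^+ m * (phi x * (1 + x ^+ 2)).
    by rewrite [_ ^+ m.+1]exprS; ring.
  have -> : `|G x| * phi x * (1 + x ^+ 2) = `|G x| * (phi x * (1 + x ^+ 2)) by ring.
  rewrite ler_wpM2r// ?mulr_ge0//.
  by apply: (le_trans (GD x)); rewrite ler_wpM2r ?ler_norm// exprn_ge0.
rewrite ler_wpM2l// (le_trans (HK x))// ler_wpM2l//.
exact: normal_pdf_ub.
Qed.

Let Psi_cvg : Psi n%:R - Psi (- n%:R) @[n --> \oo] --> 0.
Proof.
have [B HB] := Psi_bounded.
have B0 : B *+ 2 * n.+1%:R^-1 @[n --> \oo] --> 0.
  rewrite -[X in _ --> X](mulr0 (B *+ 2)); apply: cvgM; first exact: cvg_cst.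
  exact: cvg_harmonic.
apply: (cvg_norm_le0 _ B0); near=> n.
have HPsi x : x ^+ 2 = n%:R ^+ 2 -> `|Psi x| <= B / n.+1%:R.
  move=> xn; have n1 : 0 < n.+1%:R :> R by rewrite ltr0n.
  rewrite ler_pdivlMr//; apply: le_trans (HB x); rewrite ler_wpM2l// xn.
  rewrite -natr1 addrC lerD2l -natrX ler_nat.
  by move: (n) => [|k]//; rewrite -[leqLHS]expn1 leq_pexp2l.
apply: (le_trans (ler_normB _ _)).
have -> : B *+ 2 / n.+1%:R = B / n.+1%:R + B / n.+1%:R by ring.
by apply: lerD; apply: HPsi; rewrite ?sqrrN.
Unshelve. all: by end_near. Qed.

(** The fundamental theorem on [[-n, n]], then dominated convergence with [|psi|] itself as
    majorant. *)
Let integral_psi : (\int[mu]_x (psi x)%:E = 0)%E.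
Proof.
pose f_ (n : nat) := (EFin \o psi) \_ `[- n%:R, n%:R]%classic.
have mpsi : measurable_fun setT (EFin \o psi) by case/integrableP: ipsi.
have mf_ n : measurable_fun setT (f_ n).
  by apply/(measurable_restrictT _ _).1 => //; exact: measurable_funTS.
have f_f x : f_ n x @[n --> \oo] --> (EFin \o psi) x.
  apply: cvg_near_cst; near=> n; rewrite /f_ patchE mem_set//= in_itv/=.
  by rewrite -ler_norml; near: n; exact: nbhs_infty_ger.
have f_g n x : (`|f_ n x| <= `|(EFin \o psi) x|)%E.
  by rewrite /f_ patchE; case: ifP => // _; rewrite abse0 abse_ge0.
have [_ _ H] := @dominated_convergence _ _ _ mu setT measurableT f_ (EFin \o psi)
  (abse \o (EFin \o psi)) mf_ mpsi (aeW mu (fun x (_ : setT x) => f_f x))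
  (integrable_abse ipsi) (aeW mu (fun x n (_ : setT x) => f_g n x)).
have HE : (fun n => \int[mu]_x f_ n x)%E = (fun n => (Psi n%:R - Psi (- n%:R))%:E).
  apply/funext => n; rewrite -integral_mkcond.
  case: n => [|n].
    by rewrite oppr0 subrr set_itv1 integral_set1.
  have lt : - n.+1%:R < n.+1%:R :> R by rewrite (@lt_trans _ _ 0)// ?oppr_lt0 ltr0n.
  exact: (@integral_segment_is_derive R Psi psi _ _ lt (fun x _ => @cpsi x)
    (fun x _ => dPsi x)).
rewrite HE in H; apply: cvg_unique H _ => //.
by apply/cvg_EFin; [exact: nearW|exact: Psi_cvg].
Unshelve. all: by end_near. Qed.

Lemma gaussian_ibp1 :
  (\int[mu]_x (x * G x * phi x)%:E = (s ^+ 2)%:E * \int[mu]_x (g x * phi x)%:E)%E.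
Proof.
have H1 := gaussian_ibp_integrable1.
have H2 := gaussian_ibp_integrable2.
have H3 := integrableZl measurableT (s ^+ 2) H2.
have : (\int[mu]_x ((x * G x * phi x)%:E - (s ^+ 2)%:E * (g x * phi x)%:E) = 0)%E.
  by rewrite -integral_psi; apply: eq_integral => x _.
rewrite integralB// integralZl//.
have /fineK <- := integrable_fin_num measurableT H1.
have /fineK <- := integrable_fin_num measurableT H2.
rewrite -EFinM -EFinB => -[] /eqP; rewrite subr_eq0 => /eqP ->.
by [].
Qed.

End gaussian_ibp.

(** * Independence and integration in one coordinate *)

Section independent_pair.
Context {R : realType} d d1 d2 (T : measurableType d) (T1 : measurableType d1)
  (T2 : measurableType d2) (P : probability T R).
Variables (X : {RV P >-> T1}) (Y : {RV P >-> T2}).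
Hypothesis XY_indep : forall A B, measurable A -> measurable B ->
  P (X @^-1` A `&` Y @^-1` B) = (P (X @^-1` A) * P (Y @^-1` B))%E.

Let XY w := (X w, Y w).

Let mXY : measurable_fun setT XY.
Proof. by apply: measurable_fun_pair; exact: measurable_funPT. Qed.

Let rvXY : {RV P >-> (T1 * T2)%type} :=
  HB.pack_for {RV P >-> (T1 * T2)%type} XY
    (@isMeasurableFun.Build _ _ T (T1 * T2)%type XY mXY).

Let distribution_XY A : measurable A ->
  distribution P rvXY A = (distribution P X \x distribution P Y)%E A.
Proof.
move=> mA; apply/esym; exact: product_measure_unique.
Qed.

Variable phi : T1 * T2 -> \bar R.
Hypothesis mphi : measurable_fun setT phi.
Hypothesis iphi : P.-integrable setT (fun w => phi (X w, Y w)).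

Let iphi_law : (distribution P X \x distribution P Y)%E.-integrable setT phi.
Proof.
apply/integrableP; split => //.
rewrite (eq_measure_integral (distribution P rvXY)); last first.
  by move=> A mA _; exact/esym/distribution_XY.
rewrite ge0_integral_distribution//; last exact: measurableT_comp.
by have /integrableP[] := iphi.
Qed.

(** The product formula on rectangles identifies the joint law with the product of the marginal
    laws; the rest is Fubini's theorem. *)
Lemma independent_pair_integral : (\int[P]_w phi (X w, Y w) =
  \int[P]_w \int[distribution P X]_x phi (x, Y w))%E.
Proof.
transitivity (\int[distribution P rvXY]_z phi z)%E.
  by rewrite integral_distribution.
rewrite (eq_measure_integral (distribution P X \x distribution P Y)%E); last first.
  by move=> A mA _; exact: distribution_XY.
rewrite -integral21_prod_meas1//.
have mG : measurable_fun setT (fubini_G (distribution P X) phi).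
  exact: measurable_fubini_G iphi_law.
rewrite (integral_distribution (X := Y))//.
apply/integrableP; split; first exact: measurableT_comp.
rewrite -(ge0_integral_distribution Y (f := abse \o fubini_G (distribution P X) phi))//; last 2 first.
- exact: measurableT_comp.
- by move=> y; exact: abse_ge0.
apply: le_lt_trans ((integrable21ltyP _ _ mphi).1 iphi_law).
apply: ge0_le_integral => //.
- by move=> y _; exact: abse_ge0.
- exact: measurableT_comp.
- apply: (measurable_fun_fubini_tonelli_G (abse \o phi)) => //=.
  exact: measurableT_comp.
- move=> y _; apply: le_abse_integral => //.
  exact/measurableT_comp.
Qed.

End independent_pair.

Section independent_family.
Context {R : realType} d (T : measurableType d) (P : probability T R).
Variables (I : finType) (X : I -> {RV P >-> R}).
Hypothesis X_indep : mutually_independent X.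
Variable i : I.

(** Cylinders over the coordinates other than [i], which [A i = setT] leaves free. They are stable
    under intersection and generate the sigma-algebra of these coordinates. *)
Definition others_cylinder : set (set T) :=
  [set E | exists2 A : I -> set R, (forall j, measurable (A j)) /\ A i = setT &
    E = \bigcap_j X j @^-1` A j].

Let mX j (A : set R) : measurable A -> measurable (X j @^-1` A).
Proof. by move=> mA; rewrite -[X in measurable X]setTI; exact: (measurable_funPT (X j)). Qed.

Let cylinder_measurable : others_cylinder `<=` measurable.
Proof.
move=> E [A [mA _] ->]; apply: fin_bigcap_measurable => //.
by move=> j _; exact: mX.
Qed.

Let cylinder_setI : setI_closed others_cylinder.
Proof.
move=> E F [A [mA Ai] ->] [B [mB Bi] ->].
exists (fun j => A j `&` B j).
  by split => [j|]; [exact: measurableI|rewrite Ai Bi setIT].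
by rewrite -bigcapI.
Qed.

Let cylinder_setT : others_cylinder setT.
Proof.
exists (fun=> setT) => //.
by apply/esym/seteqP; split.
Qed.

Let indep_cylinder (B : set R) E : measurable B -> others_cylinder E ->
  P (X i @^-1` B `&` E) = (P (X i @^-1` B) * P E)%E.
Proof.
move=> mB [A [mA Ai] ->].
have bigcapT (F : I -> set T) : \bigcap_j F j = \bigcap_(j in [set` [set: I]%SET]) F j.
  apply/seteqP; split => w H j _; first exact: (H j).
  by apply: H; rewrite /= inE.
pose A' j := if j == i then B else A j.
have mA' j : measurable (A' j) by rewrite /A'; case: ifP.
have -> : X i @^-1` B `&` \bigcap_j X j @^-1` A j = \bigcap_j X j @^-1` A' j.
  apply/seteqP; split => [w [Bw Aw] j _|w A'w] /=.
    by rewrite /A'; case: eqP => [->//|_]; exact: Aw.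
  split; first by have := A'w i; rewrite /A' eqxx; exact.
  move=> j _ /=; have := A'w j Logic.I; rewrite /A'; case: eqP => [->|//].
  by rewrite Ai.
rewrite !bigcapT !X_indep// !(bigD1 i (finset.in_setT i))/=.
rewrite {1}/A' eqxx Ai preimage_setT probability_setT mul1e; congr (_ * _)%E.
by apply: eq_bigr => j /andP[_ /negbTE ji]; rewrite /A' ji.
Qed.

Let mid : @measurable_fun _ _ T (g_sigma_algebraType others_cylinder) setT id.
Proof.
move=> _ E mE; rewrite setTI /=.
exact: (@smallest_sub _ _ _ _ (@sigma_algebra_measurable _ T) cylinder_measurable).
Qed.

(** The identity of [T], with the smaller sigma-algebra on the target, stands for the whole family
    of the other coordinates and makes pair independence applicable. *)
Let id_rv : {RV P >-> g_sigma_algebraType others_cylinder} :=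
  HB.pack_for {RV P >-> g_sigma_algebraType others_cylinder}
    (id : T -> g_sigma_algebraType others_cylinder)
    (@isMeasurableFun.Build _ _ T (g_sigma_algebraType others_cylinder) _ mid).

(** Two finite measures in [E], the probability of [X i] in [B] together with [E] and the product of
    the two probabilities, agree on the cylinders, hence on the sigma-algebra that these
    generate. *)
Let indep_others (B : set R) (E : set (g_sigma_algebraType others_cylinder)) :
  measurable B -> measurable E ->
  P (rv_measurableTypeR (X i) @^-1` B `&` id_rv @^-1` E) =
  (P (rv_measurableTypeR (X i) @^-1` B) * P (id_rv @^-1` E))%E.
Proof.
move=> mB mE.
have fB : P (X i @^-1` B) \is a fin_num by apply: fin_num_measure; exact: mX.
have B0 : 0 <= fine (P (X i @^-1` B)) by rewrite fine_ge0.
have cov : \bigcup_(k in [set: nat]) (fun=> setT : set T) k = setT.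
  by apply/seteqP; split => // w _; exists 0%N.
have := @g_sigma_algebra_measure_unique _ _ _ others_cylinder cylinder_measurable
  (fun=> setT) (fun=> cylinder_setT) cov
  (mrestr P (mX i mB)) (mscale (NngNum B0) P) cylinder_setI.
move=> /(_ _ _ E mE) H; rewrite setIC [LHS]H.
- transitivity ((fine (P (X i @^-1` B)))%:E * P E)%E => //.
  by rewrite fineK.
- move=> F HF; transitivity (P (X i @^-1` B `&` F)); first by rewrite /mrestr setIC.
  rewrite indep_cylinder//.
  transitivity ((fine (P (X i @^-1` B)))%:E * P F)%E => //.
  by rewrite fineK.
- move=> _; apply: (@le_lt_trans _ _ 1%E); last exact: ltry.
  by apply: probability_le1; apply: measurableI => //; exact: mX.
Qed.

Lemma measurable_others j : j != i ->
  @measurable_fun _ _ (g_sigma_algebraType others_cylinder) R setT (X j).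
Proof.
move=> ji _ B mB; rewrite setTI; apply: sub_sigma_algebra.
exists (fun k => if k == j then B else setT).
  by split => [k|]; [case: ifP|rewrite eq_sym (negbTE ji)].
apply/seteqP; split => [w Bw k _|w /(_ j Logic.I)] /=; last by rewrite eqxx.
by case: eqP => [->|].
Qed.

Definition upd (v : I -> R) (x : R) : I -> R := fun j => if j == i then x else v j.

(** Measurability is tested along measurable families, because it is used both on [T] and on the
    product of [R] with [T] under the sigma-algebra of the other coordinates. *)
Definition coord_measurable (G : (I -> R) -> R) :=
  forall d0 (T0 : measurableType d0) (Z : I -> T0 -> R),
  (forall j, measurable_fun setT (Z j)) -> measurable_fun setT (fun t => G (Z^~ t)).

Let upd_X w : upd (X^~ w) (X i w) = X^~ w.
Proof. by apply/funext => j; rewrite /upd; case: eqP => [->|]. Qed.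

Lemma independent_family_integral (G : (I -> R) -> R) : coord_measurable G ->
  P.-integrable setT (fun w => (G (X^~ w))%:E) ->
  (\int[P]_w (G (X^~ w))%:E =
   \int[P]_w \int[distribution P (rv_measurableTypeR (X i))]_x (G (upd (X^~ w) x))%:E)%E.
Proof.
move=> mG iG.
pose phi (z : measurableTypeR R * g_sigma_algebraType others_cylinder) :=
  (G (upd (X^~ z.2) z.1))%:E.
transitivity (\int[P]_w phi (rv_measurableTypeR (X i) w, id_rv w))%E.
  by apply: eq_integral => w _; rewrite /phi/= upd_X.
rewrite (@independent_pair_integral _ _ _ _ _ _ _ _ (rv_measurableTypeR (X i))
  id_rv indep_others phi)//.
- apply/measurable_EFinP; apply: mG => j; rewrite /upd.
  have [_|ji] := eqVneq j i.
    exact: (@measurable_fst _ _ (measurableTypeR R) _).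
  by apply: measurableT_comp (measurable_others ji) _; exact: measurable_snd.
- by under eq_fun do rewrite /phi/= upd_X.
Qed.

End independent_family.

Section gaussian_family.
Context {R : realType} d (T : measurableType d) (P : probability T R).
Local Notation mu := (@lebesgue_measure R).
Variables (I : finType) (X : I -> {RV P >-> R}) (s : I -> R).
Hypothesis s_gt0 : forall i, 0 < s i.
Hypothesis X_normal : forall i, has_law (X i) (normal_prob 0 (s i)).
Implicit Types (v : I -> R) (x D : R) (m : nat) (i j : I).

Definition poly_growth (G : (I -> R) -> R) := exists D m, 0 <= D /\
  forall v, `|G v| <= D * (1 + \sum_j v j ^+ 2) ^+ m.

Let sq_integrable i m : P.-integrable setT (fun w => ((X i w ^+ 2) ^+ m)%:E).
Proof.
have mg : measurable_fun setT (fun x : R => (x ^+ 2) ^+ m).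
  by apply: measurable_funX; exact: measurable_funX.
apply: (@integrable_expectation_density _ _ _ _ (X i) (normal_pdf 0 (s i)) _ _ _
  (fun x : R => ((x ^+ 2) ^+ m)%:E)).
- exact: measurable_normal_pdf.
- by move=> x; exact: normal_pdf_ge0.
- by move=> A mA; exact: X_normal.
- exact/measurable_EFinP.
- apply: (@gaussian_poly_integrable R (s i) (s_gt0 i) (fun x => (x ^+ 2) ^+ m) 1 m mg) => x.
  have x0 := sqr_ge0 x.
  rewrite mul1r ger0_norm ?(exprn_ge0 m x0)//.
  by rewrite lerXn2r ?nnegrE ?addr_ge0 ?ler01// lerDr ler01.
Qed.

Let exprD_le (a b : R) m : 0 <= a -> 0 <= b ->
  (a + b) ^+ m <= 2 ^+ m * (a ^+ m + b ^+ m).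
Proof.
have H (u v : R) : 0 <= u -> u <= v -> (u + v) ^+ m <= 2 ^+ m * (u ^+ m + v ^+ m).
  move=> u0 uv; have v0 := le_trans u0 uv.
  apply: (@le_trans _ _ (2 ^+ m * v ^+ m)).
    rewrite -exprMn lerXn2r ?nnegrE ?addr_ge0 ?mulr_ge0//.
    by rewrite mulr_natl mulr2n lerD2r.
  by rewrite ler_wpM2l// lerDr exprn_ge0.
move=> a0 b0; have [ab|/ltW ba] := leP a b; first exact: H.
by rewrite addrC [_ ^+ m + _]addrC; exact: H.
Qed.

(** Induction over the list of coordinates: [exprD_le] splits off one squared coordinate, so that
    integrability of the powers of a single one is enough. *)
Lemma gaussian_weight_integrable m :
  P.-integrable setT (fun w => ((1 + \sum_j X j w ^+ 2) ^+ m)%:E).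
Proof.
elim: (index_enum I) m => [|i r IH] m.
  under eq_fun do rewrite big_nil addr0 expr1n.
  exact: finite_measure_integrable_cst.
have := integrableZl measurableT (2 ^+ m) (integrableD measurableT (IH m) (sq_integrable i m)).
have S0 w : 0 <= \sum_(j <- r) X j w ^+ 2 by apply: sumr_ge0 => j _; exact: sqr_ge0.
apply: le_integrable => //.
  apply/measurable_EFinP; apply: measurable_funX; apply: measurable_funD => //.
  by apply: measurable_sum => j; apply: measurable_funX.
move=> w _; rewrite /= lee_fin big_cons.
have x0 := sqr_ge0 (X i w); have s0 := S0 w.
have S1 : 0 <= 1 + \sum_(j <- r) X j w ^+ 2 by rewrite addr_ge0.
rewrite addrCA addrC; rewrite ger0_norm; last by rewrite exprn_ge0// addr_ge0.
rewrite ger0_norm; first exact: exprD_le.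
by rewrite mulr_ge0 ?addr_ge0 ?(exprn_ge0 m S1) ?(exprn_ge0 m x0)// exprn_ge0.
Qed.

Lemma gaussian_poly_growth_integrable (G : (I -> R) -> R) :
  coord_measurable G -> poly_growth G ->
  P.-integrable setT (fun w => (G (X^~ w))%:E).
Proof.
move=> mG [D [m [D0 GD]]].
have := integrableZl measurableT D (gaussian_weight_integrable m).
apply: le_integrable => //; first by apply/measurable_EFinP; apply: mG.
move=> w _ /=; rewrite lee_fin (le_trans (GD _))//; exact: ler_norm.
Qed.

Hypothesis X_indep : mutually_independent X.

Section ibp.
Variables (i : I) (G G' : (I -> R) -> R).
Hypothesis mG : coord_measurable G.
Hypothesis mG' : coord_measurable G'.
Hypothesis GD : poly_growth G.
Hypothesis G'D : poly_growth G'.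
Hypothesis dG : forall v x, has_derive (fun t => G (upd i v t)) x (G' (upd i v x)).
Hypothesis cG' : forall v x, {for x, continuous (fun t => G' (upd i v t))}.

Let upd_growth (H : (I -> R) -> R) : poly_growth H -> forall v, exists D m, 0 <= D /\
  forall x, `|H (upd i v x)| <= D * (1 + x ^+ 2) ^+ m.
Proof.
move=> [D [m [D0 HD]]] v; pose S := \sum_j v j ^+ 2.
have S0 : 0 <= S by apply: sumr_ge0 => j _; exact: sqr_ge0.
exists (D * (1 + S) ^+ m), m; split; first by rewrite mulr_ge0// exprn_ge0// addr_ge0.
move=> x; apply: (le_trans (HD _)); rewrite -mulrA ler_wpM2l// -exprMn.
have x0 := sqr_ge0 x.
have S'0 : 0 <= \sum_j upd i v x j ^+ 2 by apply: sumr_ge0 => j _; exact: sqr_ge0.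
rewrite lerXn2r ?nnegrE ?mulr_ge0 ?addr_ge0//.
apply: (@le_trans _ _ (1 + (x ^+ 2 + S))); last by nra.
rewrite lerD2l /S (bigD1 i)//= [in leRHS](bigD1 i)//= /upd eqxx lerD2l.
under eq_bigr => j /negbTE -> do [].
by rewrite lerDr sqr_ge0.
Qed.

(** With the other coordinates frozen at [X^~ w] this is the one-dimensional formula; the growth
    bound stays polynomial in the free coordinate, with a constant that depends on [w]. *)
Lemma gaussian_family_ibp :
  (\int[P]_w (X i w * G (X^~ w))%:E = (s i ^+ 2)%:E * \int[P]_w (G' (X^~ w))%:E)%E.
Proof.
have [D [m [D0 HD]]] := GD; have [D' [m' [D'0 HD']]] := G'D.
have mxG : coord_measurable (fun v => v i * G v).
  by move=> d0 T0 Z mZ; apply: measurable_funM; [exact: mZ|exact: mG].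
have msG : coord_measurable (fun v => s i ^+ 2 * G' v).
  by move=> d0 T0 Z mZ; apply: measurable_funM; [exact: measurable_cst|exact: mG'].
have xGD : poly_growth (fun v => v i * G v).
  exists D, m.+1; split => // v; rewrite normrM exprS mulrCA.
  have S0 : 0 <= \sum_j v j ^+ 2 by apply: sumr_ge0 => j _; exact: sqr_ge0.
  apply: ler_pM => //.
  have : `|v i| <= 1 + v i ^+ 2.
    have : 0 <= (`|v i| - 1) ^+ 2 by rewrite sqr_ge0.
    by rewrite sqrrB1 real_normK ?num_real//; have := normr_ge0 (v i); lra.
  move=> /le_trans; apply; rewrite lerD2l (bigD1 i)//= lerDl.
  by apply: sumr_ge0 => j _; exact: sqr_ge0.
rewrite -integralZl//; last exact: gaussian_poly_growth_integrable.
have sGD : poly_growth (fun v => s i ^+ 2 * G' v).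
  exists (s i ^+ 2 * D'), m'; split; first by rewrite mulr_ge0// sqr_ge0.
  by move=> v; rewrite normrM ger0_norm ?sqr_ge0// -mulrA ler_wpM2l ?sqr_ge0.
rewrite (independent_family_integral X_indep i mxG); last first.
  exact: (gaussian_poly_growth_integrable mxG xGD).
rewrite [RHS](_ : _ = \int[P]_w (s i ^+ 2 * G' (X^~ w))%:E)%E//.
rewrite (independent_family_integral X_indep i msG); last first.
  exact: (gaussian_poly_growth_integrable msG sGD).
apply: eq_integral => w _; set v := X^~ w.
have [A [p [A0 HA]]] := upd_growth GD v.
have [A' [p' [A'0 HA']]] := upd_growth G'D v.
have HB x : `|G (upd i v x)| <= (A + A') * (1 + x ^+ 2) ^+ (p + p').
  apply: (le_trans (HA x)); have x1 : 1 <= 1 + x ^+ 2 by rewrite lerDl sqr_ge0.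
  by apply: ler_pM; rewrite ?exprn_ge0 ?(le_trans ler01 x1) ?lerDl// ler_weXn2l// leq_addr.
have HB' x : `|G' (upd i v x)| <= (A + A') * (1 + x ^+ 2) ^+ (p + p').
  apply: (le_trans (HA' x)); have x1 : 1 <= 1 + x ^+ 2 by rewrite lerDl sqr_ge0.
  by apply: ler_pM; rewrite ?exprn_ge0 ?(le_trans ler01 x1) ?lerDr// ler_weXn2l// leq_addl.
have dGv x : is_derive x 1 (fun t => G (upd i v t)) (G' (upd i v x)) := dG v x.
have I1 := gaussian_ibp_integrable1 (s_gt0 i) dGv HB.
have I2 := gaussian_ibp_integrable2 (s_gt0 i) (@cG' v) HB'.
have E0 := gaussian_ibp1 (s_gt0 i) dGv (@cG' v) HB HB'.
have cG x : {for x, continuous (fun t => G (upd i v t))}.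
  exact: is_derive_continuous (dGv x).
have mphi := measurable_normal_pdf 0 (s i).
have phi0 x : 0 <= normal_pdf 0 (s i) x by exact: normal_pdf_ge0.
have law (B : set R) : measurable B ->
    distribution P (rv_measurableTypeR (X i)) B = (\int[mu]_(x in B) (normal_pdf 0 (s i) x)%:E)%E.
  by move=> mB; exact: X_normal.
have J1 : (distribution P (rv_measurableTypeR (X i))).-integrable setT
    (fun x => (x * G (upd i v x))%:E).
  apply: (integrable_density mphi phi0 law) => //.
  apply/measurable_EFinP; apply: measurable_funM => //.
  exact: continuous_measurable_fun.
have J2 : (distribution P (rv_measurableTypeR (X i))).-integrable setT
    (fun x => (s i ^+ 2 * G' (upd i v x))%:E).
  apply: (integrable_density mphi phi0 law).
    apply/measurable_EFinP; apply: measurable_funM => //.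
    exact: (continuous_measurable_fun (@cG' v)).
  under eq_fun do rewrite EFinM -muleA.
  exact: integrableZl.
transitivity (\int[distribution P (rv_measurableTypeR (X i))]_x (x * G (upd i v x))%:E)%E.
  by apply: eq_integral => x _; rewrite {1}/upd eqxx.
rewrite (integral_density mphi phi0 law J1) (integral_density mphi phi0 law J2).
rewrite [LHS]E0 -(integralZl measurableT I2).
by apply: eq_integral => x _; rewrite /= -!EFinM mulrA.
Qed.
End ibp.

Lemma measurable_rv_eq (Y Z : {RV P >-> R}) : measurable [set w | Y w = Z w].
Proof.
have -> : [set w | Y w = Z w] = (fun t => Y t - Z t) @^-1` [set 0].
  apply/seteqP; split => t /=; first by move=> ->; rewrite subrr.
  by move/eqP; rewrite subr_eq0 => /eqP.
rewrite -[X in measurable X]setTI.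
have := @measurable_funB _ T R setT Y Z (measurable_funPT _) (measurable_funPT _).
exact.
Qed.

(** Once the other coordinates are frozen, [X a] still has a density, and a point has Lebesgue
    measure [0]. *)
Lemma gaussian_family_eq0 a b : a != b -> P [set w | X a w = X b w] = 0%E.
Proof.
move=> ab; pose G (v : I -> R) : R := (v a == v b)%:R.
have GE v : G v = (v a == v b)%:R by [].
have mG : coord_measurable G.
  move=> d0 T0 Z mZ.
  have -> : (fun t => G (Z^~ t)) = \1_((fun t => Z a t - Z b t) @^-1` [set 0]).
    apply/funext => t; rewrite GE indicE; congr (_%:R).
    case: eqP => H; first by rewrite mem_set//= H subrr.
    by rewrite memNset//= => /eqP; rewrite subr_eq0 => /eqP.
  apply: measurable_indic; rewrite -[X in measurable X]setTI.
  exact: (measurable_funB (mZ a) (mZ b)).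
have GD : poly_growth G.
  exists 1, 0%N; split => // v; rewrite GE expr0 mulr1.
  by case: (_ == _); rewrite ?normr0 ?normr1.
have E := independent_family_integral X_indep a mG (gaussian_poly_growth_integrable mG GD).
have mE := measurable_rv_eq (X a) (X b).
transitivity (\int[P]_w (G (X^~ w))%:E)%E.
  transitivity (\int[P]_w (\1_[set w | X a w = X b w] w)%:E)%E.
    by rewrite integral_indic// setIT.
  apply: eq_integral => w _; rewrite GE indicE.
  by case: eqP => H; [rewrite mem_set|rewrite memNset].
rewrite E; apply: integral0_eq => w _.
have mset1 : measurable [set X b w] by exact: measurable_set1.
transitivity (\int[distribution P (rv_measurableTypeR (X a))]_x (\1_[set X b w] x)%:E)%E.
  apply: eq_integral => x _; rewrite GE indicE /upd eqxx [b == a]eq_sym (negbTE ab).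
  by case: eqP => H; [rewrite mem_set|rewrite memNset].
rewrite integral_indic// setIT.
transitivity (normal_prob 0 (s a) [set X b w]); first exact: X_normal.
by rewrite /normal_prob integral_set1.
Qed.

End gaussian_family.

(** * Functionals of polynomial growth and their Gaussian means *)

Section tame_functionals.
Context {R : realType} (I : finType).
Implicit Types (G H : (I -> R) -> R).

(** A class closed under the algebraic operations and integrable for Gaussian families, so that
    integrability is checked by closure and not by estimates. *)
Definition tame G := coord_measurable G /\ poly_growth G.

Lemma tame_cst (c : R) : tame (fun=> c).
Proof.
split; first by move=> d0 T0 Z mZ; exact: measurable_cst.
by exists `|c|, 0%N; split => // v; rewrite expr0 mulr1.
Qed.

Lemma tame_coord i : tame (fun v => v i).
Proof.
split; first by move=> d0 T0 Z mZ; exact: mZ.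
exists 1, 1%N; split => // v; rewrite mul1r expr1.
apply: (@le_trans _ _ (1 + v i ^+ 2)).
  have : 0 <= (`|v i| - 1) ^+ 2 by rewrite sqr_ge0.
  by rewrite sqrrB1 real_normK ?num_real//; have := normr_ge0 (v i); lra.
rewrite lerD2l (bigD1 i)//= lerDl.
by apply: sumr_ge0 => j _; exact: sqr_ge0.
Qed.

Let weight_ge1 (v : I -> R) : 1 <= 1 + \sum_j v j ^+ 2.
Proof. by rewrite lerDl; apply: sumr_ge0 => j _; exact: sqr_ge0. Qed.

Lemma tameD G H : tame G -> tame H -> tame (fun v => G v + H v).
Proof.
move=> [mG [D [m [D0 GD]]]] [mH [D' [m' [D'0 HD]]]]; split.
  by move=> d0 T0 Z mZ; apply: measurable_funD; [exact: mG|exact: mH].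
exists (D + D'), (m + m')%N; split => [|v]; first exact: addr_ge0.
apply: (le_trans (ler_normD _ _)); rewrite mulrDl; have v1 := weight_ge1 v.
apply: lerD; [apply: (le_trans (GD v))|apply: (le_trans (HD v))];
  by rewrite ler_wpM2l// ler_weXn2l// ?leq_addr// leq_addl.
Qed.

Lemma tameM G H : tame G -> tame H -> tame (fun v => G v * H v).
Proof.
move=> [mG [D [m [D0 GD]]]] [mH [D' [m' [D'0 HD]]]]; split.
  by move=> d0 T0 Z mZ; apply: measurable_funM; [exact: mG|exact: mH].
exists (D * D'), (m + m')%N; split => [|v]; first exact: mulr_ge0.
by rewrite normrM exprD mulrACA ler_pM.
Qed.

Lemma tameZ (c : R) G : tame G -> tame (fun v => c * G v).
Proof. by move=> tG; apply: tameM => //; exact: tame_cst. Qed.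

Lemma tameB G H : tame G -> tame H -> tame (fun v => G v - H v).
Proof.
move=> tG tH; have -> : (fun v => G v - H v) = (fun v => G v + (-1) * H v).
  by apply/funext => v; rewrite mulN1r.
by apply: tameD => //; exact: tameZ.
Qed.

Lemma tameX G m : tame G -> tame (fun v => G v ^+ m).
Proof.
move=> tG; elim: m => [|m IH]; first exact: tame_cst.
have -> : (fun v => G v ^+ m.+1) = (fun v => G v * G v ^+ m).
  by apply/funext => v; rewrite exprS.
exact: tameM.
Qed.

Lemma tame_sum (J : Type) (r : seq J) (p : pred J) (G : J -> (I -> R) -> R) :
  (forall j, tame (G j)) -> tame (fun v => \sum_(j <- r | p j) G j v).
Proof.
move=> tG; elim: r => [|j r IH].
  by under eq_fun do rewrite big_nil; exact: tame_cst.
case: (boolP (p j)) => pj.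
  have -> : (fun v => \sum_(j <- j :: r | p j) G j v) =
      (fun v => G j v + \sum_(j <- r | p j) G j v).
    by apply/funext => v; rewrite big_cons pj.
  exact: tameD.
have -> : (fun v => \sum_(j <- j :: r | p j) G j v) = (fun v => \sum_(j <- r | p j) G j v).
  by apply/funext => v; rewrite big_cons (negbTE pj).
exact: IH.
Qed.

Lemma tame_norm G : tame G -> tame (fun v => `|G v|).
Proof.
move=> [mG [D [m [D0 GD]]]]; split.
  by move=> d0 T0 Z mZ; apply: measurableT_comp => //; exact: mG.
by exists D, m; split => // v; rewrite normr_id.
Qed.

Lemma tame_comp G (g : R -> R) (D : R) m : tame G -> (forall v, 0 <= G v) ->
  measurable_fun setT g -> (forall x, 0 <= x -> `|g x| <= D * (1 + x) ^+ m) ->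
  tame (fun v => g (G v)).
Proof.
move=> tG G0 mg gD; split.
  by move=> d0 T0 Z mZ; apply: measurableT_comp => //; exact: tG.1.
have [_ [D' [p [D'0 HD]]]] := tameX m (tameD (tame_cst 1) tG).
exists (`|D| * D'), p; split => [|v]; first exact: mulr_ge0.
apply: (le_trans (gD _ (G0 v))).
have H0 : 0 <= (1 + G v) ^+ m by rewrite exprn_ge0// addr_ge0.
rewrite -mulrA; apply: (@le_trans _ _ (`|D| * (1 + G v) ^+ m)).
  by rewrite ler_wpM2r// ler_norm.
by rewrite ler_wpM2l// -[leLHS](ger0_norm H0).
Qed.

(** [g] is controlled on the half-line only. As [G v + e] stays there, [g] may first be replaced by
    its restriction, which is measurable everywhere. *)
Lemma tame_comp_shift G (g : R -> R) (e D : R) m : tame G -> (forall v, 0 <= G v) -> 0 < e ->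
  measurable_fun `](0:R), +oo[ g -> (forall x, 0 <= x -> `|g (x + e)| <= D * (1 + x) ^+ m) ->
  tame (fun v => g (G v + e)).
Proof.
move=> tG G0 e0 mg gD; pose g' := g \_ `]0, +oo[.
have g'E x : 0 <= x -> g' (x + e) = g (x + e).
  by move=> x0; rewrite /g' patchE mem_set//= in_itv/= andbT ltr_wpDl.
have -> : (fun v => g (G v + e)) = (fun v => (fun x => g' (x + e)) (G v)).
  by apply/funext => v; rewrite g'E.
apply: (@tame_comp _ (fun x => g' (x + e)) D m) => //; last by move=> x x0; rewrite g'E// gD.
apply: (measurableT_comp (f := g')); last exact: measurable_funD.
by apply/(measurable_restrictT _ _).1.
Qed.

End tame_functionals.

Section gaussian_mean.
Context {R : realType} d (T : measurableType d) (P : probability T R).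
Variables (I : finType) (X : I -> {RV P >-> R}) (s : I -> R).
Hypothesis s_gt0 : forall i, 0 < s i.
Hypothesis X_normal : forall i, has_law (X i) (normal_prob 0 (s i)).
Hypothesis X_indep : mutually_independent X.
Implicit Types (G H : (I -> R) -> R).

Definition mean_of G := \int[P]_w G (X^~ w).

Lemma tame_integrable G : tame G -> P.-integrable setT (fun w => (G (X^~ w))%:E).
Proof. by case; exact: (gaussian_poly_growth_integrable s_gt0 X_normal). Qed.

Lemma mean_ofD G H : tame G -> tame H ->
  mean_of (fun v => G v + H v) = mean_of G + mean_of H.
Proof.
by move=> /tame_integrable iG /tame_integrable iH; rewrite /mean_of RintegralD.
Qed.

Lemma mean_ofZ (c : R) G : tame G -> mean_of (fun v => c * G v) = c * mean_of G.
Proof. by move=> /tame_integrable iG; rewrite /mean_of RintegralZl. Qed.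

Lemma mean_ofB G H : tame G -> tame H ->
  mean_of (fun v => G v - H v) = mean_of G - mean_of H.
Proof.
by move=> /tame_integrable iG /tame_integrable iH; rewrite /mean_of RintegralB.
Qed.

Lemma mean_of_cst (c : R) : mean_of (fun=> c) = c.
Proof.
rewrite /mean_of Rintegral_cst// [X in _ * fine X](_ : _ = 1%E) ?mulr1//.
exact: probability_setT.
Qed.

Lemma mean_of_sum (J : Type) (r : seq J) (p : pred J) (G : J -> (I -> R) -> R) :
  (forall j, tame (G j)) ->
  mean_of (fun v => \sum_(j <- r | p j) G j v) = \sum_(j <- r | p j) mean_of (G j).
Proof.
move=> tG; elim: r => [|j r IH].
  by rewrite big_nil -[RHS](mean_of_cst 0); congr mean_of; apply/funext => v; rewrite big_nil.
rewrite big_cons; case: ifP => pj.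
  rewrite -IH -mean_ofD//; last exact: tame_sum.
  by congr mean_of; apply/funext => v; rewrite big_cons pj.
by rewrite -IH; congr mean_of; apply/funext => v; rewrite big_cons pj.
Qed.

Lemma le_mean_of G H : tame G -> tame H -> (forall v, G v <= H v) ->
  mean_of G <= mean_of H.
Proof.
by move=> /tame_integrable iG /tame_integrable iH GH; rewrite /mean_of le_Rintegral.
Qed.

Lemma norm_mean_of_le G H : tame G -> tame H -> (forall v, `|G v| <= H v) ->
  `|mean_of G| <= mean_of H.
Proof.
move=> tG tH GH; rewrite ler_norml; apply/andP; split.
  rewrite -mulN1r -mean_ofZ//; apply: le_mean_of => //; first exact: tameZ.
  by move=> v; rewrite mulN1r lerNl (le_trans (ler_norm _))// normrN.
by apply: le_mean_of => // v; rewrite (le_trans (ler_norm _)).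
Qed.

(** This allows corrections on a null event; it is applied to the event [W = 0]. *)
Lemma mean_of_null G H : tame G -> tame H -> P [set w | G (X^~ w) != 0] = 0%E ->
  mean_of (fun v => G v * H v) = 0.
Proof.
move=> tG tH G0; rewrite /mean_of /Rintegral.
suff -> : (\int[P]_w (G (X^~ w) * H (X^~ w))%:E = \int[P]_w 0)%E by rewrite integral0.
apply: ae_eq_integral => //.
- by apply: measurable_int (tame_integrable (tameM tG tH)).
exists [set w | G (X^~ w) != 0]; split => //.
  have mG := measurable_int _ (tame_integrable tG).
  have -> : [set w | G (X^~ w) != 0] = (fun w => G (X^~ w)) @^-1` (~` [set 0]).
    by apply/seteqP; split => w /=; move/eqP.
  rewrite -[X in measurable X]setTI; move/measurable_EFinP : mG; apply => //.
  exact: measurableC.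
move=> w /= /not_implyP[_]; apply: contra_not_neq => ->.
by rewrite mul0r.
Qed.

Lemma mean_of_ibp i G G' : tame G -> tame G' ->
  (forall v (x : R), has_derive (fun t => G (upd i v t)) x (G' (upd i v x))) ->
  (forall v (x : R), {for x, continuous (fun t => G' (upd i v t))}) ->
  mean_of (fun v => v i * G v) = s i ^+ 2 * mean_of G'.
Proof.
move=> tG tG' dG cG'; rewrite /mean_of /Rintegral.
rewrite (gaussian_family_ibp s_gt0 X_normal X_indep tG.1 tG'.1 tG.2 tG'.2 dG cG').
by rewrite fineM// (integrable_fin_num measurableT (tame_integrable tG')).
Qed.

End gaussian_mean.

(** * Sample variances *)

Section sample_variance.
Context {R : realType} (K : nat) (n : 'I_K -> nat).
Hypothesis n_ge2 : forall k, (2 <= n k)%N.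
Local Notation I := {k : 'I_K & 'I_(n k)}.
Implicit Types (v : I -> R) (k l : 'I_K).

Definition crd k (i : 'I_(n k)) v : R := v (Tagged (fun k => 'I_(n k)) i).

Let N k : R := (n k)%:R.

Let N_gt1 k : 1 < N k.
Proof. by rewrite /N ltr1n. Qed.

Let N_neq0 k : N k != 0.
Proof. by rewrite gt_eqF// (lt_trans ltr01). Qed.

Let N1_neq0 k : N k - 1 != 0.
Proof. by rewrite gt_eqF// subr_gt0. Qed.

(** The factor that turns the sum of squared deviations into [S_k^2 / n_k]; also
    [tau_k = sigma_k^2 c k]. *)
Let c k : R := (N k * (N k - 1))^-1.

Let c_gt0 k : 0 < c k.
Proof. by rewrite invr_gt0 mulr_gt0// ?subr_gt0// (lt_trans ltr01). Qed.

Definition var_mean k v : R := sample_variance crd k v / (n k)%:R.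

Let m k v : R := sample_mean crd k v.

Let sum_crd k v : \sum_(i < n k) crd i v = N k * m k v.
Proof. by rewrite /m /sample_mean mulVKf. Qed.

Let var_meanE k v : var_mean k v = c k * \sum_(i < n k) (crd i v - m k v) ^+ 2.
Proof. by rewrite /var_mean /sample_variance /c -/(m k v) -/(N k); field; rewrite N_neq0 N1_neq0. Qed.

(** The deviations sum to [0], so one factor can be left uncentred. This exposes the factor
    [crd i v] on which the integration by parts acts. *)
Let sum_sqB k v : \sum_(i < n k) (crd i v - m k v) ^+ 2 =
  \sum_(i < n k) crd i v * (crd i v - m k v).
Proof.
have E i : (crd i v - m k v) ^+ 2 = crd i v * (crd i v - m k v) - m k v * (crd i v - m k v).
  by rewrite -mulrBl expr2.
under eq_bigr do rewrite E.
rewrite sumrB -[X in _ - X = _]mulr_sumr sumrB sum_crd sumr_const card_ord.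
by rewrite -(mulr_natl (m k v)) subrr mulr0 subr0.
Qed.

Lemma var_mean_ge0 k v : 0 <= var_mean k v.
Proof. by rewrite var_meanE mulr_ge0 ?(ltW (c_gt0 k))// sumr_ge0// => i _; rewrite sqr_ge0. Qed.

Lemma W_stat_ge0 v : 0 <= W_stat crd v.
Proof. by apply: sumr_ge0 => k _; exact: var_mean_ge0. Qed.

Lemma W_stat_eq0 k (i j : 'I_(n k)) v : W_stat crd v = 0 -> crd i v = crd j v.
Proof.
move=> /eqP; rewrite psumr_eq0 => [|l _]; last exact: var_mean_ge0.
move=> /allP /(_ k (mem_index_enum k)) /=; rewrite -/(var_mean k v) var_meanE.
rewrite mulf_eq0 gt_eqF//= psumr_eq0 => [|l _]; last exact: sqr_ge0.
move=> /allP H; have E (l : 'I_(n k)) : crd l v = m k v.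
  have := H l (mem_index_enum l); rewrite /= sqrf_eq0 subr_eq0.
  by move/eqP.
by rewrite !E.
Qed.

Let tame_crd k (i : 'I_(n k)) : tame (crd i).
Proof. exact: tame_coord. Qed.

Let tame_m k : tame (m k).
Proof. by apply: tameZ; apply: tame_sum => i. Qed.

Lemma tame_var_mean k : tame (var_mean k).
Proof.
have -> : var_mean k = fun v => c k * \sum_(i < n k) (crd i v - m k v) ^+ 2.
  by apply/funext => v; rewrite var_meanE.
by apply: tameZ; apply: tame_sum => i; apply: tameX; exact: tameB.
Qed.

Lemma tame_W_stat : tame (W_stat crd).
Proof. by apply: tame_sum => k; exact: tame_var_mean. Qed.

Section coordinate_derivative.
Variables (k : 'I_K) (i : 'I_(n k)) (v : I -> R).
Let p : I := Tagged (fun k => 'I_(n k)) i.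

Let crd_upd (j : 'I_(n k)) t : crd j (upd p v t) = if j == i then t else crd j v.
Proof. by rewrite /crd /upd eq_Tagged. Qed.

Let crd_upd_ne l (j : 'I_(n l)) t : l != k -> crd j (upd p v t) = crd j v.
Proof.
move=> lk; rewrite /crd /upd; case: eqP => // /(congr1 tag) /= lk'.
by rewrite lk' eqxx in lk.
Qed.

Let m_upd t : m k (upd p v t) =
  (N k)^-1 * (t + \sum_(j < n k | j != i) crd j v).
Proof.
rewrite /m /sample_mean (bigD1 i)//= crd_upd eqxx; congr (_ * (_ + _)).
by apply: eq_bigr => j /negbTE ji; rewrite crd_upd ji.
Qed.

Let dm (x : R) : has_derive (fun t => m k (upd p v t)) x (N k)^-1.
Proof.
under eq_fun do rewrite m_upd.
apply: is_derive_eq (deriveM_fun (deriveC_fun (N k)^-1 x)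
  (deriveD_fun (deriveI_fun x) (deriveC_fun _ x))) _.
by rewrite mul0r addr0 add0r mulr1.
Qed.

Let dcrd (x : R) : has_derive (fun t => crd i (upd p v t)) x 1.
Proof. by under eq_fun do rewrite crd_upd eqxx; exact: deriveI_fun. Qed.

(** Moving one observation also moves the sample mean, so [V_k] is first expanded as [c k] times the
    sum of squares minus [N m^2], of which only two terms depend on the free coordinate. *)
Let dvar_mean (x : R) : has_derive (fun t => var_mean k (upd p v t)) x
  (2 * c k * (crd i (upd p v x) - m k (upd p v x))).
Proof.
pose B := \sum_(j < n k | j != i) crd j v ^+ 2.
have E t : var_mean k (upd p v t) =
    c k * (t * t + B - N k * (m k (upd p v t) * m k (upd p v t))).
  rewrite var_meanE sum_sqB; congr (_ * _).
  have F j : crd j (upd p v t) * (crd j (upd p v t) - m k (upd p v t)) =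
      crd j (upd p v t) ^+ 2 - m k (upd p v t) * crd j (upd p v t) by ring.
  under eq_bigr do rewrite F.
  rewrite sumrB -mulr_sumr sum_crd mulrCA; congr (_ - _).
  rewrite (bigD1 i)//= crd_upd eqxx expr2; congr (_ + _).
  by apply: eq_bigr => j /negbTE ji; rewrite crd_upd ji.
under eq_fun do rewrite E.
apply: is_derive_eq (deriveM_fun (deriveC_fun (c k) x)
  (deriveB_fun (deriveD_fun (deriveM_fun (deriveI_fun x) (deriveI_fun x)) (deriveC_fun B x))
    (deriveM_fun (deriveC_fun (N k) x) (deriveM_fun (dm x) (dm x))))) _.
by rewrite crd_upd eqxx; field; exact: N_neq0.
Qed.

Let dW_stat (x : R) : has_derive (fun t => W_stat crd (upd p v t)) x
  (2 * c k * (crd i (upd p v x) - m k (upd p v x))).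
Proof.
pose B := \sum_(l < K | l != k) var_mean l v.
have E t : W_stat crd (upd p v t) = var_mean k (upd p v t) + B.
  rewrite /W_stat (bigD1 k)//=; congr (_ + _); apply: eq_bigr => l lk.
  rewrite /var_mean /sample_variance /sample_mean; congr (_ * _ / _).
  have F : \sum_(j < n l) crd j (upd p v t) = \sum_(j < n l) crd j v.
    by apply: eq_bigr => j _; rewrite crd_upd_ne.
  by rewrite F; apply: eq_bigr => j _; rewrite crd_upd_ne.
under eq_fun do rewrite E.
by apply: is_derive_eq (deriveD_fun (dvar_mean x) (deriveC_fun B x)) _; rewrite addr0.
Qed.

Variables (g g' : R -> R) (e : R).
Hypothesis e_gt0 : 0 < e.
Hypothesis dg : forall x, 0 < x -> has_derive g x (g' x).
Hypothesis cg' : forall x, 0 < x -> {for x, continuous g'}.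

Let We_gt0 u : 0 < W_stat crd u + e.
Proof. by rewrite ltr_wpDl// W_stat_ge0. Qed.

(** Up to [c k], the cofactor of [crd i] when [V_k g(W + e)] is expanded with [sum_sqB]. *)
Let stein_term u := (crd i u - m k u) * g (W_stat crd u + e).

Let stein_term' u := (1 - (N k)^-1) * g (W_stat crd u + e) +
  2 * c k * ((crd i u - m k u) ^+ 2 * g' (W_stat crd u + e)).

Let dg_W (x : R) : has_derive (fun t => g (W_stat crd (upd p v t) + e)) x
  (g' (W_stat crd (upd p v x) + e) * (2 * c k * (crd i (upd p v x) - m k (upd p v x)))).
Proof.
have dWe : has_derive (fun t => W_stat crd (upd p v t) + e) x
    (2 * c k * (crd i (upd p v x) - m k (upd p v x))).
  by apply: is_derive_eq (deriveD_fun (dW_stat x) (deriveC_fun e x)) _; rewrite addr0.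
exact: (@derive_comp _ g (fun t => W_stat crd (upd p v t) + e) x _ _ (dg (We_gt0 _)) dWe).
Qed.

Lemma stein_term_derive (x : R) :
  has_derive (fun t => stein_term (upd p v t)) x (stein_term' (upd p v x)).
Proof.
apply: is_derive_eq (deriveM_fun (deriveB_fun (dcrd x) (dm x)) (dg_W x)) _.
by rewrite /stein_term'; ring.
Qed.

Lemma stein_term'_continuous (x : R) :
  {for x, continuous (fun t => stein_term' (upd p v t))}.
Proof.
have cgW := is_derive_continuous (dg_W x).
have cm := is_derive_continuous (dm x).
have cc := is_derive_continuous (dcrd x).
have cW := is_derive_continuous (dW_stat x).
have cWe : {for x, continuous (fun t => W_stat crd (upd p v t) + e)}.
  by apply: cvgD; [exact: cW|exact: cvg_cst].
have cg'W : {for x, continuous (fun t => g' (W_stat crd (upd p v t) + e))}.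
  by apply: (@continuous_comp _ _ _ (fun t => W_stat crd (upd p v t) + e) g' x cWe);
    exact: cg'.
have cd : {for x, continuous (fun t => crd i (upd p v t) - m k (upd p v t))}.
  by apply: cvgB; [exact: cc|exact: cm].
apply: cvgD; first by apply: cvgM; [exact: cvg_cst|exact: cgW].
apply: cvgM; first exact: cvg_cst.
apply: cvgM; last exact: cg'W.
exact: (@cvgM _ _ _ _ _ _ _ _ cd cd).
Qed.

End coordinate_derivative.

Section stein_identity.
Context d (T : measurableType d) (P : probability T R).
Variables (X : I -> {RV P >-> R}) (sigma : 'I_K -> R).
Hypothesis sigma_gt0 : forall k, 0 < sigma k.
Hypothesis X_normal : forall q, has_law (X q) (normal_prob 0 (sigma (tag q))).
Hypothesis X_indep : mutually_independent X.
Variables (g g' : R -> R) (e : R).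
Hypothesis e_gt0 : 0 < e.
Hypothesis dg : forall x, 0 < x -> has_derive g x (g' x).
Hypothesis cg' : forall x, 0 < x -> {for x, continuous g'}.
Hypothesis tg : tame (fun v => g (W_stat crd v + e)).
Hypothesis tg' : tame (fun v => g' (W_stat crd v + e)).
Local Notation E := (mean_of X).

(** Summed over [i], the factors [1 - 1 / N] give [N - 1] and the squared deviations rebuild [V_k].
    Multiplication by [sigma_k^2 c k] then produces [sigma_k^2 / n_k] and [2 tau_k]. *)
Lemma var_mean_stein k :
  E (fun v => var_mean k v * g (W_stat crd v + e)) =
  sigma k ^+ 2 / (n k)%:R * E (fun v => g (W_stat crd v + e)) +
  2 * tau_ n sigma k * E (fun v => var_mean k v * g' (W_stat crd v + e)).
Proof.
have s0 (q : I) : 0 < sigma (tag q) by [].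
pose t (i : 'I_(n k)) v := (crd i v - m k v) * g (W_stat crd v + e).
pose t' (i : 'I_(n k)) v := (1 - (N k)^-1) * g (W_stat crd v + e) +
  2 * c k * ((crd i v - m k v) ^+ 2 * g' (W_stat crd v + e)).
have tt i : tame (t i) by apply: tameM => //; exact: tameB.
have tt' i : tame (t' i).
  apply: tameD; first exact: tameZ.
  by apply: tameZ; apply: tameM => //; apply: tameX; exact: tameB.
have ibp i : E (fun v => crd i v * t i v) = sigma k ^+ 2 * E (t' i).
  pose q : I := Tagged (fun k => 'I_(n k)) i.
  have Dt v (x : R) : has_derive (fun u => t i (upd q v u)) x (t' i (upd q v x)).
    exact: stein_term_derive.
  have Ct v (x : R) : {for x, continuous (fun u => t' i (upd q v u))}.
    exact: stein_term'_continuous.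
  have H := mean_of_ibp s0 X_normal X_indep (tt i) (tt' i) Dt (@Ct).
  exact: H.
have -> : (fun v => var_mean k v * g (W_stat crd v + e)) =
    (fun v => c k * \sum_(i < n k) crd i v * t i v).
  apply/funext => v; rewrite var_meanE sum_sqB -mulrA mulr_suml; congr (_ * _).
  by apply: eq_bigr => i _; rewrite mulrA.
have tct i : tame (fun v => crd i v * t i v) by apply: tameM.
rewrite (mean_ofZ s0)//; last exact: tame_sum.
rewrite (mean_of_sum s0)//.
under eq_bigr do rewrite ibp.
rewrite -mulr_sumr -(mean_of_sum s0 X_normal)//.
have -> : (fun v => \sum_i t' i v) = (fun v => (N k - 1) * g (W_stat crd v + e) +
    2 * (var_mean k v * g' (W_stat crd v + e))).
  apply/funext => v; rewrite /t' big_split/= sumr_const card_ord -mulr_sumr -mulr_suml.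
  congr (_ + _); last by rewrite var_meanE; ring.
  by rewrite -mulr_natl -/(N k); field; exact: N_neq0.
have tV : tame (fun v => var_mean k v * g' (W_stat crd v + e)).
  by apply: tameM => //; exact: tame_var_mean.
rewrite (mean_ofD s0)//; [|exact: tameZ|exact: tameZ].
rewrite !(mean_ofZ s0)// /tau_ /c -/(N k).
by field; rewrite N_neq0 N1_neq0.
Qed.

End stein_identity.
End sample_variance.

(** * Comparison with the gamma law for one test function *)

Section stein_bound.
Context {R : realType} (K : nat) (n : 'I_K -> nat) (sigma : 'I_K -> R).
Hypothesis K_ge1 : (1 <= K)%N.
Hypothesis n_ge2 : forall k, (2 <= n k)%N.
Hypothesis sigma_gt0 : forall k, 0 < sigma k.
Local Notation I := {k : 'I_K & 'I_(n k)}.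
Local Notation mu := (mu_ n sigma).
Local Notation nu := (nu_ n sigma).
Let a := nu / 2.
Let b := 2 * mu / nu.

Let S4 := \sum_(k < K) sigma k ^+ 4 / ((n k)%:R ^+ 2 * ((n k)%:R - 1)).

Let N_gt1 k : 1 < (n k)%:R :> R.
Proof. by rewrite ltr1n. Qed.

Let sumr_gt0 (F : 'I_K -> R) : (forall k, 0 < F k) -> 0 < \sum_k F k.
Proof.
move=> F0; rewrite (bigD1 (Ordinal K_ge1))//= ltr_wpDr//.
by apply: sumr_ge0 => k _; rewrite ltW.
Qed.

Lemma mu_gt0 : 0 < mu.
Proof.
by apply: sumr_gt0 => k; rewrite divr_gt0 ?exprn_gt0// (lt_trans ltr01).
Qed.

Let S4_gt0 : 0 < S4.
Proof.
apply: sumr_gt0 => k; rewrite divr_gt0 ?exprn_gt0// mulr_gt0 ?subr_gt0//.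
by rewrite exprn_gt0// (lt_trans ltr01).
Qed.

Let nuE : nu = mu ^+ 2 / S4. Proof. by []. Qed.

Lemma nu_gt0 : 0 < nu.
Proof. by rewrite nuE divr_gt0// exprn_gt0// mu_gt0. Qed.

Let mu_neq0 : mu != 0. Proof. by rewrite gt_eqF// mu_gt0. Qed.
Let nu_neq0 : nu != 0. Proof. by rewrite gt_eqF// nu_gt0. Qed.
Let S4_neq0 : S4 != 0. Proof. by rewrite gt_eqF. Qed.

Let a_gt0 : 0 < a. Proof. by rewrite divr_gt0// nu_gt0. Qed.
Let b_gt0 : 0 < b.
Proof. by rewrite divr_gt0 ?nu_gt0// mulr_gt0// mu_gt0. Qed.

Let ab : a * b = mu. Proof. by rewrite /a /b; field. Qed.

(** The scale of the gamma law of [S_k^2 / n_k]; [b - theta k] measures how far it is from the scale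
    of [U]. *)
Let theta k := 2 * tau_ n sigma k.

Let tau_gt0 k : 0 < tau_ n sigma k.
Proof.
by rewrite divr_gt0 ?exprn_gt0// mulr_gt0 ?subr_gt0// (lt_trans ltr01).
Qed.

(* The gamma law is the one with the mean and the variance of [W]. *)
Let variance_match : \sum_(k < K) (b - theta k) * (sigma k ^+ 2 / (n k)%:R) = 0.
Proof.
have E k : (b - theta k) * (sigma k ^+ 2 / (n k)%:R) =
    b * (sigma k ^+ 2 / (n k)%:R) -
    2 * (sigma k ^+ 4 / ((n k)%:R ^+ 2 * ((n k)%:R - 1))).
  have N0 : (n k)%:R != 0 :> R by rewrite gt_eqF// (lt_trans ltr01).
  have N1 : (n k)%:R - 1 != 0 :> R by rewrite gt_eqF// subr_gt0.
  by rewrite /theta /tau_; field; rewrite N0 N1.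
under eq_bigr do rewrite E.
rewrite sumrB -!mulr_sumr -/(mu) -/S4 /b nuE; field.
by rewrite S4_neq0 mu_neq0.
Qed.

(** [(b - theta k) theta k] equals [- 2 b (tau_k / (mu / nu) - 1) tau_k], a multiple of the quantity
    maximised in [Delta_]. *)
Let theta_le k : `|(b - theta k) * theta k| <= 2 * b * Delta_ n sigma 1%N.
Proof.
have t0 := tau_gt0 k.
have -> : `|(b - theta k) * theta k| =
    2 * b * (`|tau_ n sigma k / (mu / nu) - 1| * tau_ n sigma k ^+ 1).
  have -> : (b - theta k) * theta k =
      - (2 * b * ((tau_ n sigma k / (mu / nu) - 1) * tau_ n sigma k ^+ 1)).
    by rewrite /b /theta expr1; field; rewrite mu_neq0 nu_neq0.
  have b0 : 0 <= 2 * b by rewrite mulr_ge0// ltW.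
  by rewrite normrN normrM (ger0_norm b0) normrM [X in _ * (_ * X)]ger0_norm// exprn_ge0// ltW.
have b0 : 0 <= 2 * b by rewrite mulr_ge0// ltW.
by rewrite ler_wpM2l// /Delta_ (bigD1 k)//= le_max lexx.
Qed.

Let M_ge0 : 0 <= 2 * b * Delta_ n sigma 1%N.
Proof. exact: le_trans (theta_le (Ordinal K_ge1)). Qed.

Context d (T : measurableType d) (P : probability T R).
Variable X : I -> {RV P >-> R}.
Hypothesis X_normal : forall q, has_law (X q) (normal_prob 0 (sigma (tag q))).
Hypothesis X_indep : mutually_independent X.
Local Notation E := (mean_of X).
Let W : (I -> R) -> R := W_stat (@crd R K n).

Let s0 (q : I) : 0 < sigma (tag q). Proof. by []. Qed.

Let tW : tame W. Proof. exact: tame_W_stat. Qed.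
Let W_ge0 v : 0 <= W v. Proof. exact: W_stat_ge0. Qed.

(** The Stein identity of each [V_k] with [g = 1] and [g' = 0]. *)
Lemma mean_W : E W = mu.
Proof.
have t1 : tame (fun v : I -> R => (1 : R)) := tame_cst _ _.
have t0 : tame (fun v : I -> R => (0 : R)) := tame_cst _ _.
have H k : E (var_mean (n := n) k) = sigma k ^+ 2 / (n k)%:R.
  have := var_mean_stein n_ge2 sigma_gt0 X_normal X_indep ltr01 (g := fun=> 1) (g' := fun=> 0)
    (fun x _ => deriveC_fun 1 x) (fun x _ => cvg_cst _) t1 t0 k.
  rewrite mean_of_cst mulr1.
  have -> : (fun v : I -> R => var_mean k v * 0) = (fun=> 0) by apply/funext => v; rewrite mulr0.
  rewrite mean_of_cst mulr0 addr0 => <-.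
  by congr mean_of; apply/funext => v; rewrite mulr1.
rewrite (_ : W = fun v => \sum_(k < K) var_mean k v)//.
rewrite (mean_of_sum s0)//; last by move=> k; exact: tame_var_mean.
by apply: eq_bigr => k _; rewrite H.
Qed.

(** [W = 0] forces the first two observations of the first sample to coincide, which is a null
    event. *)
Lemma W_stat_null : P [set w | W (X^~ w) = 0] = 0%E.
Proof.
pose k : 'I_K := Ordinal K_ge1.
pose i : 'I_(n k) := Ordinal (ltnW (n_ge2 k)).
pose j : 'I_(n k) := Ordinal (n_ge2 k).
have ij : Tagged (fun k => 'I_(n k)) i != Tagged (fun k => 'I_(n k)) j.
  by rewrite eq_Tagged.
have H := gaussian_family_eq0 s0 X_normal X_indep ij.
apply/eqP; rewrite eq_le measure_ge0 andbT -H; apply: le_measure.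
- rewrite inE (_ : [set w | W (X^~ w) = 0] = (fun w => W (X^~ w)) @^-1` [set 0])//.
  rewrite -[X in measurable X]setTI.
  have mW := measurable_int _ (tame_integrable s0 X_normal tW).
  by move/measurable_EFinP : mW; apply.
- by rewrite inE; exact: measurable_rv_eq.
- by move=> w /= /(W_stat_eq0 n_ge2 i j).
Qed.

Section test_function.
Variables (h h1 f f1 f2 l : R -> R) (C : R).
Hypothesis dh : forall x, 0 < x -> has_derive h x (h1 x).
Hypothesis hC : forall x, 0 < x -> `|h x| <= C * (1 + x) ^+ 2.
Hypothesis h1C : forall x, 0 < x -> `|h1 x| <= C * (1 + x).
Hypothesis sol : gamma_stein_sol a b h f f1 f2.
Hypothesis tl : tame (fun v => l (W v)).
Hypothesis f2l : forall x e, 0 <= x -> 0 < e -> e <= 1 -> x * `|f2 (x + e)| <= l x.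

Let C_ge0 : 0 <= C.
Proof.
have := hC ltr01; move=> /(le_trans (normr_ge0 _)).
by rewrite pmulr_lge0// exprn_gt0.
Qed.

Let tame_shift (g : R -> R) (D e : R) m : 0 < e ->
  (forall x, 0 < x -> {for x, continuous g}) ->
  (forall x, 0 < x -> `|g x| <= D * (1 + x) ^+ m) -> tame (fun v => g (W v + e)).
Proof.
move=> e0 cg gD; have D0 : 0 <= D.
  have := gD _ ltr01; move=> /(le_trans (normr_ge0 _)).
  by rewrite pmulr_lge0// exprn_gt0.
apply: (@tame_comp_shift _ _ _ g e (D * (1 + e) ^+ m) m) => //.
  exact: itv0_measurable.
move=> x x0; apply: le_trans (gD _ (ltr_wpDl x0 e0)) _.
rewrite -mulrA ler_wpM2l// -exprMn lerXn2r ?nnegrE ?mulr_ge0 ?addr_ge0 ?(ltW e0)//.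
by have := mulr_ge0 x0 (ltW e0); nra.
Qed.

Let Eh := E (fun v => (h \_ `]0, +oo[) (W v)).

Lemma tame_restrict_W_stat : tame (fun v => (h \_ `]0, +oo[) (W v)).
Proof.
apply: (@tame_comp _ _ W _ C 2 tW W_ge0).
  apply/(measurable_restrictT _ _).1 => //; apply: itv0_measurable => x x0.
  exact: is_derive_continuous (dh x0).
move=> x x0; rewrite patchE; case: ifP => [|_].
  by rewrite inE/= in_itv/= andbT; exact: hC.
by rewrite normr0 mulr_ge0// exprn_ge0// addr_ge0.
Qed.

Let tame_zero : tame (fun v => (W v == 0)%:R : R).
Proof.
apply: (@tame_comp _ _ W (fun x => (x == 0)%:R) 1 0 tW W_ge0).
  have -> : (fun x : R => (x == 0)%:R) = \1_[set 0] :> (R -> R).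
    apply/funext => x; rewrite indicE; case: eqP => x0; first by rewrite mem_set.
    by rewrite memNset.
  by apply: measurable_indic; exact: measurable_set1.
by move=> x _; rewrite mul1r expr0; case: eqP; rewrite ?normr1 ?normr0.
Qed.

Let tame_hs e : 0 < e -> tame (fun v => h (W v + e)).
Proof.
move=> e0; apply: (@tame_shift h C e 2) => // x x0.
exact: is_derive_continuous (dh x0).
Qed.

Let tame_W2 : tame (fun v => 2 + W v).
Proof. by apply: tameD => //; exact: tame_cst. Qed.

(** Where [W > 0], the increment of [h] is at most [e C (2 + W)]. On the null event [W = 0] the
    restricted [h] is [0] and the difference is [h e] up to sign; a term carrying the indicator of
    that event absorbs it and has mean [0]. *)
Let shift_error e : 0 < e -> e <= 1 ->
  `|Eh - E (fun v => h (W v + e))| <= e * (C * E (fun v => 2 + W v)).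
Proof.
move=> e0 e1; have th := tame_hs e0; have tr := tame_restrict_W_stat.
rewrite -(mean_ofB s0)//.
have tn := tame_norm th.
have tZ := tameZ e (tameZ C tame_W2).
have -> : e * (C * E (fun v => 2 + W v)) =
    E (fun v => e * (C * (2 + W v)) + (W v == 0)%:R * `|h (W v + e)|).
  rewrite (mean_ofD s0 X_normal tZ)//; last exact: tameM.
  rewrite (mean_of_null s0 X_normal tame_zero tn); last first.
    rewrite -[RHS]W_stat_null; congr (P _); apply/seteqP; split => w /=.
      by rewrite pnatr_eq0 eqb0 negbK => /eqP.
    by move=> ->; rewrite eqxx oner_eq0.
  rewrite addr0 !(mean_ofZ s0)//; exact: tameZ.
apply: (norm_mean_of_le s0) => //; [exact: tameB| |move=> v].
  by apply: tameD => //; exact: tameM.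
rewrite patchE; case: eqP => [->|/eqP W0].
  rewrite memNset/= ?in_itv/= ?ltxx// sub0r normrN mul1r lerDr.
  by rewrite !mulr_ge0// ?(ltW e0)// addr_ge0.
have Wv : 0 < W v by rewrite lt_def W0 W_ge0.
rewrite mem_set/= ?in_itv/= ?Wv// mul0r addr0 distrC.
have H : `|h (W v + e) - h (W v)| <= C * (2 + W v) * (W v + e - W v).
  apply: (@is_derive_increment_le _ h h1); first by rewrite lerDl ltW.
    by move=> x /andP[Wx _]; apply: dh; exact: lt_le_trans Wx.
  move=> x /andP[Wx xe]; apply: (le_trans (h1C (lt_le_trans Wv Wx))).
  by rewrite ler_wpM2l//; lra.
have -> : e * (C * (2 + W v)) = C * (2 + W v) * (W v + e - W v) by ring.
exact: H.
Qed.

(** The growth constant found here blows up as [e] tends to [0]. It serves integrability only;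
    uniformity in [e] comes from the envelope [l]. *)
Let tame_f2 e : 0 < e -> tame (fun v => f2 (W v + e)).
Proof.
move=> e0; have [_ _ cf2 _ [D D0 HD]] := sol.
apply: (@tame_comp_shift _ _ _ f2 e (D * (1 + e) ^+ 3 / e) 3) => //.
  exact: itv0_measurable.
move=> x x0; have xe0 : 0 < x + e := ltr_wpDl x0 e0.
have [_ _ H] := HD _ xe0.
have -> : D * (1 + e) ^+ 3 / e * (1 + x) ^+ 3 = D * ((1 + e) * (1 + x)) ^+ 3 / e.
  by field; rewrite gt_eqF.
rewrite ler_pdivlMr// mulrC.
apply: (@le_trans _ _ ((x + e) * `|f2 (x + e)|)); first by rewrite ler_wpM2r// lerDr.
apply: (le_trans H); rewrite ler_wpM2l// lerXn2r ?nnegrE ?mulr_ge0 ?addr_ge0 ?(ltW e0)//.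
by have := mulr_ge0 x0 (ltW e0); nra.
Qed.

Let stein_expansion e : 0 < e ->
  E (fun v => h (W v + e)) - gamma_mean a b h =
  \sum_(k < K) (b - theta k) * theta k * E (fun v => var_mean k v * f2 (W v + e)) +
  e * (b * E (fun v => f1 (W v + e)) - E (fun v => f (W v + e))).
Proof.
move=> e0; have [df df1 cf2 feq [D D0 HD]] := sol.
have tf : tame (fun v => f (W v + e)).
  apply: (@tame_shift f D e 3) => // x x0; first exact: is_derive_continuous (df x x0).
  by have [] := HD x x0.
have tf1 : tame (fun v => f1 (W v + e)).
  apply: (@tame_shift f1 D e 3) => // x x0; first exact: is_derive_continuous (df1 x x0).
  by have [] := HD x x0.
have tf2 := tame_f2 e0.
have EW (G : (I -> R) -> R) : tame G ->
    E (fun v => W v * G v) = \sum_(k < K) E (fun v => var_mean k v * G v).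
  move=> tG; rewrite -(mean_of_sum s0 X_normal)//; last first.
    by move=> k; apply: tameM => //; exact: tame_var_mean.
  by congr mean_of; apply/funext => v; rewrite -mulr_suml.
have S0 k := var_mean_stein n_ge2 sigma_gt0 X_normal X_indep e0 df
  (fun x x0 => is_derive_continuous (df1 x x0)) tf tf1 k.
have S1 k := var_mean_stein n_ge2 sigma_gt0 X_normal X_indep e0 df1 cf2 tf1 tf2 k.
have th := tame_hs e0; have tg := tame_cst I (gamma_mean a b h).
have tWf := tameM tW tf; have tWf1 := tameM tW tf1.
(* The Stein equation at [W + e], with the terms that carry [e] explicitly kept apart: they form the
   remainder. *)
transitivity (b * E (fun v => W v * f1 (W v + e)) + b * e * E (fun v => f1 (W v + e)) +
    (mu - e) * E (fun v => f (W v + e)) - E (fun v => W v * f (W v + e))).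
  rewrite -[X in _ - X](mean_of_cst X) -(mean_ofB s0)// -!(mean_ofZ s0)//.
  have tb := tameZ b tWf1; have tbe := tameZ (b * e) tf1; have tm := tameZ (mu - e) tf.
  rewrite -(mean_ofD s0 X_normal tb tbe) -(mean_ofD s0 X_normal (tameD tb tbe) tm).
  rewrite -(mean_ofB s0 X_normal (tameD (tameD tb tbe) tm) tWf).
  congr mean_of; apply/funext => v; rewrite -feq ?ab; last by rewrite ltr_wpDl.
  by ring.
rewrite !EW//; under [X in _ - X]eq_bigr do rewrite S0.
rewrite big_split/= -mulr_suml -/(mu) mulr_sumr.
set F := E (fun v => f (W v + e)); set F1 := E (fun v => f1 (W v + e)).
have -> : \sum_(k < K) (b - theta k) * theta k * E (fun v => var_mean k v * f2 (W v + e)) =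
    \sum_(k < K) b * E (fun v => var_mean k v * f1 (W v + e)) -
    \sum_(k < K) 2 * tau_ n sigma k * E (fun v => var_mean k v * f1 (W v + e)).
  rewrite -sumrB; apply/eqP; rewrite -subr_eq0 -sumrB.
  rewrite (_ : \sum_(i < K) _ = - ((\sum_(k < K) (b - theta k) * (sigma k ^+ 2 / (n k)%:R)) * F1)).
    by rewrite variance_match mul0r oppr0.
  rewrite mulr_suml -sumrN; apply: eq_bigr => k _.
  by rewrite S1 -/F1 -/(theta k); ring.
by ring.
Qed.

(** After the coefficients are bounded by their maximum, the sum of the [V_k] rebuilds [W], which is
    the factor [x] in the envelope condition on [x f''(x + e)]. *)
Let expansion_sum e : 0 < e -> e <= 1 ->
  `|\sum_(k < K) (b - theta k) * theta k * E (fun v => var_mean k v * f2 (W v + e))| <=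
  2 * b * Delta_ n sigma 1%N * E (fun v => l (W v)).
Proof.
move=> e0 e1; have tf2 := tame_f2 e0; have tn := tame_norm tf2.
have tV k : tame (fun v => var_mean (n := n) k v * `|f2 (W v + e)|).
  by apply: tameM => //; exact: tame_var_mean.
apply: (@le_trans _ _ (\sum_(k < K) 2 * b * Delta_ n sigma 1%N *
    E (fun v => var_mean k v * `|f2 (W v + e)|))).
  apply: (le_trans (ler_norm_sum _ _ _)); apply: ler_sum => k _.
  rewrite normrM; apply: ler_pM => //.
  apply: (norm_mean_of_le s0) => //.
    by apply: tameM => //; exact: tame_var_mean.
  by move=> v; rewrite normrM ger0_norm// var_mean_ge0.
rewrite -mulr_sumr ler_wpM2l// -(mean_of_sum s0 X_normal)//.
apply: (le_mean_of s0) => //; first exact: tame_sum.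
by move=> v; rewrite -mulr_suml; exact: (f2l (W_ge0 v) e0 e1).
Qed.

Lemma stein_bound :
  `|Eh - gamma_mean a b h| <= 2 * b * Delta_ n sigma 1%N * E (fun v => l (W v)).
Proof.
have [df df1 _ _ [D D0 HD]] := sol.
have tZ : tame (fun v => D * (2 + W v) ^+ 3) by apply: tameZ; exact: tameX.
pose A := E (fun v => D * (2 + W v) ^+ 3); pose B := C * E (fun v => 2 + W v).
have fA (g : R -> R) (e : R) : 0 < e -> e <= 1 ->
    (forall x, 0 < x -> {for x, continuous g}) ->
    (forall x, 0 < x -> `|g x| <= D * (1 + x) ^+ 3) -> `|E (fun v => g (W v + e))| <= A.
  move=> e0 e1 cg gD; apply: (norm_mean_of_le s0) => //; first exact: (@tame_shift g D e 3).
  move=> v; apply: (le_trans (gD _ (ltr_wpDl (W_ge0 v) e0))).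
  rewrite ler_wpM2l// lerXn2r ?nnegrE ?addr_ge0 ?(ltW e0)//.
  by rewrite addrA addrAC lerD2r -[leRHS]/(1 + 1) lerD2l.
have A0 : 0 <= A.
  have := fA (fun=> 0) 1 ltr01 (lexx _) (fun x _ => cvg_cst _).
  rewrite mean_of_cst normr0; apply => x x0.
  by rewrite mulr_ge0// exprn_ge0// addr_ge0// ltW.
have B0 : 0 <= B.
  rewrite mulr_ge0// -[leLHS](mean_of_cst X); apply: (le_mean_of s0) => //.
    exact: tame_cst.
  by move=> v; rewrite addr_ge0.
(* [B] pays for replacing [W] by [W + e] in [h], and [b A + A] for the remainder of
   [stein_expansion]; neither depends on [e]. *)
pose Q := B + (b * A + A).
have Q0 : 0 <= Q by rewrite !addr_ge0// mulr_ge0// ltW.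
have main e : 0 < e -> e <= 1 ->
    `|Eh - gamma_mean a b h| <= 2 * b * Delta_ n sigma 1%N * E (fun v => l (W v)) + e * Q.
  move=> e0 e1; have H1 := shift_error e0 e1; have H2 := stein_expansion e0.
  have H3 := expansion_sum e0 e1.
  have H4 : `|E (fun v => f (W v + e))| <= A.
    apply: fA => // x x0; first exact: is_derive_continuous (df x x0).
    by have [] := HD x x0.
  have H5 : `|E (fun v => f1 (W v + e))| <= A.
    apply: fA => // x x0; first exact: is_derive_continuous (df1 x x0).
    by have [] := HD x x0.
  have -> : Eh - gamma_mean a b h = (Eh - E (fun v => h (W v + e))) +
      (E (fun v => h (W v + e)) - gamma_mean a b h) by ring.
  rewrite H2; apply: (le_trans (ler_normD _ _)).
  rewrite /Q [leRHS]addrC [in leRHS]mulrDr -addrA; apply: lerD => //.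
  rewrite [leRHS]addrC.
  apply: (le_trans (ler_normD _ _)); apply: lerD => //.
  rewrite normrM (ger0_norm (ltW e0)) ler_wpM2l ?(ltW e0)//.
  apply: (le_trans (ler_normB _ _)); apply: lerD => //.
  by rewrite normrM (ger0_norm (ltW b_gt0)) ler_wpM2l// ltW.
apply/ler_addgt0Pr => eps eps0.
have Q1 : 0 < Q + 1 by rewrite ltr_wpDl.
(* [Q] may be [0], hence the denominator [Q + 1]; the minimum with [1] keeps the shift in the range
   of the estimates. *)
have e0 : 0 < Num.min 1 (eps / (Q + 1)) by rewrite lt_min ltr01 divr_gt0.
apply: (le_trans (main _ e0 _)); first by rewrite ge_min lexx.
rewrite lerD2l; apply: (@le_trans _ _ (eps / (Q + 1) * Q)).
  by rewrite ler_wpM2r// ge_min lexx orbT.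
by rewrite mulrAC ler_pdivrMr// ler_wpM2l ?(ltW eps0)// lerDl.
Qed.

End test_function.
End stein_bound.

Section gamma_expectation.
Context {R : realType} d (T : measurableType d) (Q : probability T R).
Local Notation mu := (@lebesgue_measure R).
Variables (a b : R) (U : {RV Q >-> R}).
Hypotheses (a_gt0 : 0 < a) (b_gt0 : 0 < b).
Hypothesis U_gamma : has_law U (gamma_prob a b).

Lemma gamma_pdf_ge0 (x : R) : 0 <= gamma_pdf a b x.
Proof.
rewrite /gamma_pdf; case: ifP => // x0.
by rewrite !mulr_ge0 ?expR_ge0 ?powR_ge0// invr_ge0 mulr_ge0 ?powR_ge0// ltW// gamma_function_gt0.
Qed.

Lemma measurable_gamma_pdf : measurable_fun setT (gamma_pdf a b).
Proof.
have -> : gamma_pdf a b = (gamma_pdf a b) \_ `]0, +oo[.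
  apply/funext => x; rewrite patchE; case: ifPn => //.
  by rewrite notin_setE/= in_itv/= andbT => /negP x0; rewrite /gamma_pdf (negbTE x0).
apply/(measurable_restrictT _ _).1 => //; apply: itv0_measurable => x x0.
by apply: gamma_pdf_continuous => //; rewrite gt_eqF.
Qed.

Lemma expect_pos_gamma (h : R -> R) : measurable_fun `](0:R), +oo[ h ->
  mu.-integrable `]0%R, +oo[ (EFin \o (fun x => h x * gamma_pdf a b x)) ->
  expect_pos Q U h = (gamma_mean a b h)%:E.
Proof.
move=> mh ih; pose g (x : R) := ((h \_ `]0, +oo[) x)%:E.
have mg : measurable_fun setT g.
  by apply/measurable_EFinP; apply/(measurable_restrictT _ _).1.
have gE x : (g x * (gamma_pdf a b x)%:E)%E =
    ((EFin \o (fun x => h x * gamma_pdf a b x)) \_ `]0, +oo[) x.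
  by rewrite /g !patchE; case: ifP => // _; rewrite mul0e.
have ig : mu.-integrable setT (fun x => g x * (gamma_pdf a b x)%:E)%E.
  by under eq_fun do rewrite gE; apply/(integrable_mkcond _ _).1.
have iU := integrable_expectation_density measurable_gamma_pdf gamma_pdf_ge0 U_gamma mg ig.
rewrite /expect_pos unlock.
rewrite [LHS](expectation_density measurable_gamma_pdf gamma_pdf_ge0 U_gamma mg iU).
under eq_integral do rewrite gE.
rewrite -integral_mkcond /gamma_mean /Rintegral fineK//.
exact: integrable_fin_num.
Qed.

End gamma_expectation.

(** * Growth of the test functions and the smooth distances *)

Section test_functions.
Context {R : realType}.
Implicit Types (h : R -> R) (x : R).

Lemma Z_derive (j i : nat) h x : Z_ j h -> 0 < x -> (i < j)%N ->
  has_derive (derive1n i h) x (derive1n i.+1 h x).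
Proof.
move=> Zh x0 ij; have [/(_ i ij) dh _ _] := Zh x x0.
by rewrite /= derive1E; exact: derivableP.
Qed.

(** The base point is [1], because a test function has no controlled value at [0] to start from. *)
Lemma increment_from1 (F f : R -> R) (M x : R) : 0 < x ->
  (forall t, 0 < t -> has_derive F t (f t)) ->
  (forall t, 0 < t -> t <= 1 + x -> `|f t| <= M) -> `|F x| <= `|F 1| + M * (1 + x).
Proof.
move=> x0 dF fM.
have M0 : 0 <= M by apply: (le_trans (normr_ge0 _) (fM 1 ltr01 _)); rewrite lerDl ltW.
suff : `|F x - F 1| <= M * (1 + x).
  by rewrite -lerBlDl; apply: le_trans; exact: lerB_dist.
have [x1|/ltW x1] := leP x 1.
  rewrite distrC; apply: (@le_trans _ _ (M * (1 - x))); last first.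
    by rewrite ler_wpM2l//; lra.
  apply: (@is_derive_increment_le _ F f) => // t /andP[xt t1].
    by apply: dF; exact: lt_le_trans xt.
  by apply: fM; [exact: lt_le_trans xt|lra].
apply: (@le_trans _ _ (M * (x - 1))); last by rewrite ler_wpM2l//; lra.
apply: (@is_derive_increment_le _ F f) => // t /andP[xt t1].
  by apply: dF; exact: lt_le_trans xt.
by apply: fM; [exact: lt_le_trans xt|lra].
Qed.

Lemma Z1_growth h : Z_ 1 h -> exists C, forall x, 0 < x ->
  `|h x| <= C * (1 + x) ^+ 2 /\ `|derive1n 1 h x| <= C * (1 + x).
Proof.
move=> Zh; have h1 x : 0 < x -> `|derive1n 1 h x| <= 1 by move=> x0; have [] := Zh x x0.
exists (`|h 1| + 1) => x x0; have n0 := normr_ge0 (h 1); split.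
  have := increment_from1 x0 (fun t t0 => Z_derive Zh t0 (ltnSn 0)) (fun t t0 _ => h1 t t0).
  by move=> /le_trans; apply => /=; nra.
by apply: (le_trans (h1 x x0)); nra.
Qed.

Lemma Z2_growth h : Z_ 2 h -> exists C, forall x, 0 < x ->
  `|h x| <= C * (1 + x) ^+ 2 /\ `|derive1n 1 h x| <= C * (1 + x).
Proof.
move=> Zh; have h2 x : 0 < x -> `|derive1n 2 h x| <= 1 by move=> x0; have [] := Zh x x0.
pose A := `|derive1n 1 h 1| + 1; have A0 : 0 <= A by rewrite addr_ge0.
have h1 x : 0 < x -> `|derive1n 1 h x| <= A * (1 + x).
  move=> x0; have n0 := normr_ge0 (derive1n 1 h 1).
  have := increment_from1 x0 (fun t t0 => Z_derive Zh t0 (ltnSn 1)) (fun t t0 _ => h2 t t0).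
  by move=> /le_trans; apply; rewrite /A; nra.
have n0 := normr_ge0 (h 1).
exists (`|h 1| + 2 * A) => x x0; split; last first.
  by apply: (le_trans (h1 x x0)); nra.
have B t : 0 < t -> t <= 1 + x -> `|derive1n 1 h t| <= A * (2 + x).
  by move=> t0 tx; apply: (le_trans (h1 t t0)); rewrite ler_wpM2l//; lra.
have := increment_from1 x0 (fun t t0 => Z_derive Zh t0 (ltn0Sn 1)) B.
move=> /le_trans; apply; rewrite [leRHS]mulrDl; apply: lerD.
  by rewrite ler_peMr// exprn_ege1// lerDl ltW.
have -> : A * (2 + x) * (1 + x) = A * ((2 + x) * (1 + x)) by ring.
by rewrite (mulrC 2) -mulrA ler_wpM2l//; nra.
Qed.

End test_functions.

Section smooth_distances.
Context {R : realType} (d : measure_display) (T : measurableType d) (P : probability T R)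
  (d' : measure_display) (T' : measurableType d') (Q : probability T' R)
  (K : nat) (n : 'I_K -> nat) (sigma : 'I_K -> R)
  (X : forall k : 'I_K, 'I_(n k) -> {RV P >-> R}) (U : {RV Q >-> R}).
Hypothesis K_ge1 : (1 <= K)%N.
Hypothesis n_ge2 : forall k, (2 <= n k)%N.
Hypothesis sigma_gt0 : forall k, 0 < sigma k.
Hypothesis X_normal : forall k (i : 'I_(n k)), has_law (X i) (normal_prob 0 (sigma k)).
Hypothesis X_indep : mutually_independent
  (fun p : {k : 'I_K & 'I_(n k)} => X (tagged p)).
Local Notation mu := (mu_ n sigma).
Local Notation nu := (nu_ n sigma).
Local Notation a := (nu / 2).
Local Notation b := (2 * mu / nu).
Hypothesis U_gamma : has_law U (gamma_prob a b).
Local Notation D1 := (Delta_ n sigma 1%N).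

Let Y (q : {k : 'I_K & 'I_(n k)}) : {RV P >-> R} := X (tagged q).

Let Y_normal q : has_law (Y q) (normal_prob 0 (sigma (tag q))).
Proof. exact: X_normal. Qed.

Let a_gt0 : 0 < a. Proof. by rewrite divr_gt0// nu_gt0. Qed.

Let b_gt0 : 0 < b. Proof. by rewrite divr_gt0 ?nu_gt0// mulr_gt0// mu_gt0. Qed.

Let D1_ge0 : 0 <= D1.
Proof. by rewrite /Delta_; elim/big_rec : _ => // k x _ x0; rewrite le_max x0 orbT. Qed.

Let W := W_stat (@crd R K n).

Let tW : tame W. Proof. exact: tame_W_stat. Qed.

Lemma smooth_difference (h f f1 f2 l : R -> R) (C : R) :
  (forall x, 0 < x -> has_derive h x (derive1n 1 h x)) ->
  (forall x, 0 < x -> {for x, continuous (derive1n 1 h)}) ->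
  (forall x, 0 < x -> `|h x| <= C * (1 + x) ^+ 2 /\ `|derive1n 1 h x| <= C * (1 + x)) ->
  gamma_stein_sol a b h f f1 f2 -> tame (fun v => l (W v)) ->
  (forall x e, 0 <= x -> 0 < e -> e <= 1 -> x * `|f2 (x + e)| <= l x) ->
  (`|expect_pos P (W_stat X) h - expect_pos Q U h| <=
   (2 * b * D1 * mean_of Y (fun v => l (W v)))%:E)%E.
Proof.
move=> dh ch1 hC sol tl f2l.
have hC1 x (x0 : 0 < x) := (hC x x0).1; have hC2 x (x0 : 0 < x) := (hC x x0).2.
have s0 (q : {k : 'I_K & 'I_(n k)}) : 0 < sigma (tag q) by [].
have mh : measurable_fun `](0:R), +oo[ h.
  by apply: itv0_measurable => x x0; exact: is_derive_continuous (dh x x0).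
rewrite (expect_pos_gamma a_gt0 b_gt0 U_gamma mh); last first.
  exact: (gamma_mean_integrable a_gt0 b_gt0 dh hC1).
have th : tame (fun v => (h \_ `]0, +oo[) (W v)) by exact: (tame_restrict_W_stat n_ge2 dh hC1).
have -> : expect_pos P (W_stat X) h = (mean_of Y (fun v => (h \_ `]0, +oo[) (W v)))%:E.
  rewrite /expect_pos unlock /mean_of /Rintegral fineK//.
  exact: integrable_fin_num (tame_integrable s0 Y_normal th).
rewrite -EFinB lee_fin.
exact: (stein_bound K_ge1 n_ge2 sigma_gt0 Y_normal X_indep dh hC1 hC2 sol tl f2l).
Qed.

Lemma dist_Z1_le : (dist_Z 1 P (W_stat X) Q U <= (4 * D1)%:E)%E.
Proof.
apply: ge_ereal_sup => _ [h Zh <-].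
have [C hC] := Z1_growth Zh.
have dh x (x0 : 0 < x) := Z_derive Zh x0 (ltnSn 0).
have ch x : 0 < x -> {for x, continuous (derive1n 1 h)} by move=> x0; have [] := Zh x x0.
have h1 x : 0 < x -> `|derive1n 1 h x| <= 1 by move=> x0; have [] := Zh x x0.
have [f [f1 [f2 [sol f2b]]]] := gamma_stein1 a_gt0 b_gt0 dh ch
  (fun x x0 => (hC x x0).1) (fun x x0 => (hC x x0).2) h1.
(* For [Z_ 1] the envelope is the constant [2 / b], and [2 b D1 (2 / b) = 4 D1]. *)
have := @smooth_difference h f f1 f2 (fun=> 2 / b) C dh ch hC sol (tame_cst _ _).
rewrite mean_of_cst; have -> : 2 * b * D1 * (2 / b) = 4 * D1.
  by field; rewrite !gt_eqF// ?mu_gt0// nu_gt0.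
apply => x e x0 e0 _; have xe : 0 < x + e by rewrite ltr_wpDl.
by apply: le_trans (f2b _ xe); rewrite ler_wpM2r// lerDl ltW.
Qed.

Lemma dist_Z2_le : (dist_Z 2 P (W_stat X) Q U <=
  (8 * Delta_ n sigma 2%N)%:E + (2 * mu)%:E * e_ a * D1%:E)%E.
Proof.
have D2_ge0 : 0 <= Delta_ n sigma 2%N.
  by rewrite /Delta_; elim/big_rec : _ => // k x _ x0; rewrite le_max x0 orbT.
apply: ge_ereal_sup => _ [h Zh <-].
have [C hC] := Z2_growth Zh.
have dh x (x0 : 0 < x) := Z_derive Zh x0 (ltn0Sn 1).
have dh1 x (x0 : 0 < x) := Z_derive Zh x0 (ltnSn 1).
have ch x : 0 < x -> {for x, continuous (derive1n 1 h)}.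
  by move=> x0; exact: is_derive_continuous (dh1 x x0).
have h2 x : 0 < x -> `|derive1n 2 h x| <= 1 by move=> x0; have [] := Zh x x0.
have [f [f1 [f2 [sol f2b]]]] := gamma_stein2 a_gt0 b_gt0 dh ch
  (fun x x0 => (hC x x0).1) (fun x x0 => (hC x x0).2) dh1 h2.
have C2e x : 0 < x -> ((C2 a x)%:E <= e_ a)%E.
  by move=> x0; apply: ereal_sup_ubound; exists x => //=; rewrite in_itv/= x0.
have [_ _ _ _ [D D0 HD]] := sol.
(* [e_ a] is an extended real. If [D1 = 0], its product with [D1] is [0] even when it is [+oo], so
   the difference of expectations must vanish: any polynomial envelope shows it, its mean being
   multiplied by [D1]. *)
have [D10|D1_neq0] := eqVneq D1 0.
  have tl : tame (fun v => D * (2 + W v) ^+ 3).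
    by apply: tameZ; apply: tameX; apply: tameD => //; exact: tame_cst.
  have := @smooth_difference h f f1 f2 (fun x => D * (2 + x) ^+ 3) C dh ch hC sol tl.
  rewrite D10 mulr0 mul0r mule0 adde0 => H.
  apply: (@le_trans _ _ 0%E); last by rewrite lee_fin mulr_ge0.
  apply: H => x e x0 e0 e1; have xe : 0 < x + e by rewrite ltr_wpDl.
  have [_ _ H] := HD _ xe.
  apply: (@le_trans _ _ ((x + e) * `|f2 (x + e)|)).
    by rewrite ler_wpM2r// lerDl ltW.
  apply: (le_trans H); rewrite ler_wpM2l// lerXn2r ?nnegrE ?addr_ge0 ?(ltW e0)//.
  by lra.
have D1_gt0 : 0 < D1 by rewrite lt_def D1_neq0.
have mu0 : 0 < 2 * mu by rewrite mulr_gt0// mu_gt0.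
(* With [D1 > 0] an infinite [e_ a] makes the bound infinite, and the value of [C2] at [1] excludes
   [-oo]. *)
case E : (e_ a) => [e| |]; last 2 first.
- by rewrite gt0_muley ?lte_fin// gt0_mulye ?lte_fin// addey// leey.
- by have := C2e 1 ltr01; rewrite E leeNy_eq.
(* The linear envelope has mean [e / b * mu] by [mean_W], which yields [2 mu e D1]. *)
have := @smooth_difference h f f1 f2 (fun x => e / b * x) C dh ch hC sol (tameZ _ tW).
have s0 (q : {k : 'I_K & 'I_(n k)}) : 0 < sigma (tag q) by [].
rewrite (mean_ofZ s0 Y_normal)//.
rewrite (mean_W n_ge2 sigma_gt0 Y_normal X_indep) => H.
apply: (@le_trans _ _ (2 * b * D1 * (e / b * mu))%:E); last first.
  rewrite -!EFinM -EFinD lee_fin.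
  have -> : 2 * b * D1 * (e / b * mu) = 2 * mu * e * D1.
    by field; rewrite !gt_eqF// ?mu_gt0// nu_gt0.
  by rewrite lerDr mulr_ge0.
apply: H => x eps x0 eps0 _; have xe : 0 < x + eps by rewrite ltr_wpDl.
rewrite mulrC ler_wpM2r//; apply: (le_trans (f2b _ xe)).
rewrite ler_wpM2r ?invr_ge0 ?(ltW b_gt0)//.
by rewrite -lee_fin -E C2e// divr_gt0.
Qed.

End smooth_distances.

(** * From smooth test functions to the Kolmogorov distance *)

Section smooth_ramp.
Context {R : realType}.
Implicit Types (x u z e delta : R).

(** A smooth positive part, within [delta] of [Num.max 0 u], whose derivative lies between [0] and
    [1]. *)
Let spos delta u := (u + Num.sqrt (u ^+ 2 + delta ^+ 2)) / 2.

Let spos' delta u := (1 + u / Num.sqrt (u ^+ 2 + delta ^+ 2)) / 2.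

(* A smooth version of the ramp equal to [e] before [z] and to [0] after [z + e]. *)
Definition ramp delta z e x := spos delta (z + e - x) - spos delta (z - x).

Let root_gt0 delta u : 0 < delta -> 0 < Num.sqrt (u ^+ 2 + delta ^+ 2).
Proof. by move=> d0; rewrite sqrtr_gt0 ltr_wpDl ?sqr_ge0// exprn_gt0. Qed.

Let root_le delta u : 0 < delta -> `|u| <= Num.sqrt (u ^+ 2 + delta ^+ 2) <= `|u| + delta.
Proof.
move=> d0; apply/andP; split.
  by rewrite -sqrtr_sqr ler_sqrt ?addr_ge0 ?sqr_ge0// lerDl sqr_ge0.
rewrite -[leRHS]ger0_norm ?addr_ge0 ?(ltW d0)// -sqrtr_sqr ler_sqrt ?sqr_ge0//.
rewrite sqrrD real_normK ?num_real// lerD2r lerDl mulrn_wge0// mulr_ge0//.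
exact: ltW.
Qed.

Let spos_le delta u : 0 < delta -> Num.max 0 u <= spos delta u <= Num.max 0 u + delta.
Proof.
move=> d0; have /andP[h1 h2] := root_le u d0; rewrite /spos.
have [u0|/ltW u0] := leP 0 u.
  by rewrite (ger0_norm u0) in h1 h2; apply/andP; split; lra.
by rewrite (ler0_norm u0) in h1 h2; apply/andP; split; lra.
Qed.

Let droot delta u : 0 < delta ->
  has_derive (fun t => Num.sqrt (t ^+ 2 + delta ^+ 2)) u (u / Num.sqrt (u ^+ 2 + delta ^+ 2)).
Proof.
move=> d0; have r0 := root_gt0 u d0.
have E : (fun t : R => t ^+ 2 + delta ^+ 2) = (fun t => t * t + delta ^+ 2).
  by apply/funext => t; rewrite expr2.
have dq : is_derive u 1 (fun t : R => t ^+ 2 + delta ^+ 2) (2 * u).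
  rewrite E; apply: is_derive_eq (deriveD_fun (deriveM_fun (deriveI_fun u) (deriveI_fun u))
    (deriveC_fun (delta ^+ 2) u)) _; by ring.
have pq : 0 < u ^+ 2 + delta ^+ 2 by rewrite -sqrtr_gt0.
apply: is_derive_eq (@derive_comp _ Num.sqrt (fun t : R => t ^+ 2 + delta ^+ 2) u _ _
  (is_derive1_sqrt pq) dq) _.
by field; rewrite gt_eqF.
Qed.

Let dspos delta u : 0 < delta -> has_derive (spos delta) u (spos' delta u).
Proof.
move=> d0; apply: is_derive_eq (deriveM_fun (deriveD_fun (deriveI_fun u) (droot u d0))
  (deriveC_fun 2^-1 u)) _.
by rewrite mulr0 addr0.
Qed.

Let spos'_01 delta u : 0 < delta -> 0 <= spos' delta u <= 1.
Proof.
move=> d0; have r0 := root_gt0 u d0; have /andP[h1 _] := root_le u d0.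
have : `|u / Num.sqrt (u ^+ 2 + delta ^+ 2)| <= 1.
  by rewrite normrM normfV (ger0_norm (ltW r0)) ler_pdivrMr// mul1r.
by rewrite ler_norml /spos' => /andP[? ?]; apply/andP; split; lra.
Qed.

Let cspos' delta u : 0 < delta -> {for u, continuous (spos' delta)}.
Proof.
move=> d0; have c := is_derive_continuous (droot u d0).
have n0 : Num.sqrt (u ^+ 2 + delta ^+ 2) != 0 by rewrite gt_eqF// root_gt0.
apply: cvgM; last exact: cvg_cst.
apply: cvgD; first exact: cvg_cst.
by apply: cvgM; [exact: cvg_id|exact: (@cvgV _ _ _ _ _ _ n0 c)].
Qed.

Let ramp' delta z e x := spos' delta (z - x) - spos' delta (z + e - x).

Let dramp delta z e x : 0 < delta -> has_derive (ramp delta z e) x (ramp' delta z e x).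
Proof.
move=> d0.
have dl (c : R) : is_derive x 1 (fun t => c - t) (- 1).
  by apply: is_derive_eq (deriveB_fun (deriveC_fun c x) (deriveI_fun x)) _; rewrite sub0r.
apply: is_derive_eq (deriveB_fun
  (@derive_comp _ (spos delta) (fun t => z + e - t) x _ _ (dspos _ d0) (dl (z + e)))
  (@derive_comp _ (spos delta) (fun t => z - t) x _ _ (dspos _ d0) (dl z))) _.
by rewrite /ramp'; ring.
Qed.

(** The derivative is a difference of two values in [[0, 1]]. The ramp falls by [e] over a width
    [e], so its slope is that of a unit test function and the step is the indicator scaled by
    [e]. *)
Lemma ramp_Z1 delta z e : 0 < delta -> Z_ 1 (ramp delta z e).
Proof.
move=> d0 x _.
have E : derive1n 1 (ramp delta z e) = ramp' delta z e.
  apply/funext => y; rewrite /= derive1E.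
  by have [_ ->] : is_derive y 1 (ramp delta z e) (ramp' delta z e y) := dramp z e y d0.
split.
- move=> i; rewrite ltnS leqn0 => /eqP -> /=.
  have H : is_derive x 1 (ramp delta z e) (ramp' delta z e x) := dramp z e x d0.
  by case: H => + _; exact.
- rewrite E; have cl (c : R) : {for x, continuous (fun t : R => c - t)}.
    by apply: cvgB; [exact: cvg_cst|exact: cvg_id].
  apply: cvgB.
    by apply: (@continuous_comp _ _ _ (fun t => z - t) (spos' delta) x (cl z)); exact: cspos'.
  by apply: (@continuous_comp _ _ _ (fun t => z + e - t) (spos' delta) x (cl (z + e)));
    exact: cspos'.
- rewrite E /ramp'; have /andP[? ?] := spos'_01 (z - x) d0.
  have /andP[? ?] := spos'_01 (z + e - x) d0.
  by rewrite ler_norml; apply/andP; split; lra.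
Qed.

Lemma ramp_ge0 delta z e x : 0 < delta -> 0 <= e -> 0 <= ramp delta z e x.
Proof.
move=> d0 e0; rewrite subr_ge0; apply: (@is_derive_le _ _ (spos' delta)).
- by rewrite lerD2r lerDl.
- by move=> u _; exact: dspos.
- by move=> u _; have /andP[] := spos'_01 u d0.
Qed.

Lemma measurable_ramp delta z e : 0 < delta -> measurable_fun setT (ramp delta z e).
Proof.
move=> d0; apply: continuous_measurable_fun => x.
exact: is_derive_continuous (dramp z e x d0).
Qed.

Lemma ramp_ge delta z e x : 0 < delta -> 0 <= e ->
  Num.min e (Num.max 0 (z + e - x)) <= ramp delta z e x + delta.
Proof.
move=> d0 e0; have /andP[h1 _] := spos_le (z + e - x) d0.
have /andP[_ h2] := spos_le (z - x) d0; rewrite /ramp.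
by move: h1 h2; rewrite /Num.max /Num.min; do 3 case: ifPn; rewrite -?leNgt; lra.
Qed.

Lemma ramp_le delta z e x : 0 < delta -> 0 <= e ->
  ramp delta z e x <= Num.min e (Num.max 0 (z + e - x)) + delta.
Proof.
move=> d0 e0; have /andP[_ h1] := spos_le (z + e - x) d0.
have /andP[h2 _] := spos_le (z - x) d0; rewrite /ramp.
by move: h1 h2; rewrite /Num.max /Num.min; do 3 case: ifPn; rewrite -?leNgt; lra.
Qed.

End smooth_ramp.

Section ramp_expectation.
Context {R : realType} d (T : measurableType d) (P : probability T R).
Variable V : T -> R.
Hypothesis mV : measurable_fun setT V.
Hypothesis V_gt0 : P [set w | V w <= 0] = 0%E.
Variables (h k : R -> R) (z e delta : R).
Hypothesis mh : measurable_fun setT h.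
Hypothesis mk : measurable_fun setT k.
Hypothesis h_ge0 : forall x, 0 <= h x.
Hypothesis k_ge0 : forall x, 0 <= k x.
Hypothesis e_ge0 : 0 <= e.
Hypothesis delta_ge0 : 0 <= delta.
Local Open Scope ereal_scope.

Let step (c : R) w : R := (e * \1_[set w | (V w <= c)%R] w)%R.

Let mle (c : R) : measurable [set w | (V w <= c)%R].
Proof.
rewrite (_ : [set w | _] = V @^-1` `]-oo, c]%classic).
  by rewrite -[X in measurable X]setTI; exact: mV.
by apply/seteqP; split => w /=; rewrite in_itv.
Qed.

Let mstep c : measurable_fun setT (step c).
Proof. by apply: measurable_funM => //; exact: measurable_indic. Qed.

Let step_ge0 c w : (0 <= step c w)%R.
Proof. by rewrite mulr_ge0// indicE. Qed.

Let stepE c w : step c w = if (V w <= c)%R then e else 0%R.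
Proof.
rewrite /step indicE; case: ifPn => Vc; first by rewrite mem_set ?mulr1.
by rewrite memNset ?mulr0//; exact/negP.
Qed.

Let integral_step c : \int[P]_w (step c w)%:E = e%:E * P [set w | (V w <= c)%R].
Proof.
under eq_integral do rewrite EFinM.
rewrite ge0_integralZl//; last by apply/measurable_EFinP; exact: measurable_indic.
by rewrite integral_indic// setIT.
Qed.

Let hV w : R := ((h \_ `]0%R, +oo[) (V w))%R.

Let mhV : measurable_fun setT hV.
Proof.
apply: measurableT_comp => //; apply/(measurable_restrictT _ _).1 => //.
exact: measurable_funTS.
Qed.

Let hVE w : hV w = if (V w <= 0)%R then 0%R else h (V w).
Proof.
rewrite /hV patchE; case: (leP (V w) 0%R) => V0.
  by rewrite memNset//= in_itv/= andbT ltNge V0.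
by rewrite mem_set//= in_itv/= andbT.
Qed.

Let hV_ge0 w : (0 <= hV w)%R.
Proof. by rewrite hVE; case: ifP. Qed.

Let expect_posE : expect_pos P V h = \int[P]_w (hV w)%:E.
Proof. by rewrite /expect_pos unlock. Qed.

Let mkV : measurable_fun setT (k \o V).
Proof. exact: measurableT_comp. Qed.

Let integral4 (g1 g2 g3 : T -> R) :
  measurable_fun setT g1 -> measurable_fun setT g2 -> measurable_fun setT g3 ->
  (forall w, (0 <= g1 w)%R) -> (forall w, (0 <= g2 w)%R) -> (forall w, (0 <= g3 w)%R) ->
  \int[P]_w (g1 w + delta + g2 w + g3 w)%:E =
  \int[P]_w (g1 w)%:E + delta%:E + \int[P]_w (g2 w)%:E + \int[P]_w (g3 w)%:E.
Proof.
move=> m1 m2 m3 p1 p2 p3.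
have md : measurable_fun setT (fun _ : T => delta) by exact: measurable_cst.
have m12 := measurable_funD m1 md; have m123 := measurable_funD m12 m2.
under eq_integral do rewrite EFinD.
rewrite ge0_integralD//; last 4 first.
- by move=> w _; rewrite lee_fin !addr_ge0.
- exact/measurable_EFinP.
- by move=> w _; rewrite lee_fin.
- exact/measurable_EFinP.
under eq_integral do rewrite EFinD.
rewrite ge0_integralD//; last 4 first.
- by move=> w _; rewrite lee_fin !addr_ge0.
- exact/measurable_EFinP.
- by move=> w _; rewrite lee_fin.
- exact/measurable_EFinP.
under eq_integral do rewrite EFinD.
rewrite ge0_integralD//; last 2 first.
- by move=> w _; rewrite lee_fin.
- exact/measurable_EFinP.
rewrite integral_cst// (_ : _ [set: T] = 1) ?mule1//.
exact: probability_setT.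
Qed.

(** [k] makes up for the points where the step exceeds [h]. As [expect_pos] discards [V <= 0], a
    second step at [0], of mean [e] times a null probability, is added to keep the inequality
    pointwise. *)
Lemma step_le_ramp :
  (forall x, (if x <= z then e else 0) <= h x + delta + k x)%R ->
  e%:E * P [set w | (V w <= z)%R] <=
  expect_pos P V h + delta%:E + \int[P]_w (k (V w))%:E.
Proof.
move=> H; rewrite -(integral_step z) expect_posE.
rewrite -[leRHS]adde0 -[X in _ <= _ + X](mule0 e%:E) -V_gt0 -(integral_step 0).
rewrite -integral4//; apply: ge0_le_integral => //.
- by move=> w _; rewrite lee_fin.
- exact/measurable_EFinP.
- apply/measurable_EFinP; apply: measurable_funD => //; apply: measurable_funD => //.
  by apply: measurable_funD => //; exact: measurable_cst.
- move=> w _; rewrite lee_fin !stepE hVE; have := H (V w).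
  case: (leP (V w) 0%R) => V0; last by rewrite addr0.
  move=> _; apply: (@le_trans _ _ e); first by case: ifP.
  by rewrite lerDr !addr_ge0// k_ge0.
Qed.

Lemma ramp_le_step :
  (forall x, h x <= (if x <= z then e else 0) + delta + k x)%R ->
  expect_pos P V h <=
  e%:E * P [set w | (V w <= z)%R] + delta%:E + \int[P]_w (k (V w))%:E.
Proof.
move=> H; rewrite -(integral_step z) expect_posE.
have := @integral4 (step z) (k \o V) (fun=> 0%R) (mstep z) mkV (measurable_cst _)
  (step_ge0 z) (fun w => k_ge0 (V w)) (fun=> lexx _).
rewrite integral0 adde0 => <-; apply: ge0_le_integral => //.
- by move=> w _; rewrite lee_fin.
- exact/measurable_EFinP.
- apply/measurable_EFinP; apply: measurable_funD; last exact: measurable_cst.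
  by apply: measurable_funD => //; apply: measurable_funD => //; exact: measurable_cst.
- move=> w _; rewrite lee_fin addr0 stepE hVE.
  case: (leP (V w) 0%R) => V0; last exact: H.
  by rewrite !addr_ge0 ?k_ge0//; case: ifP.
Qed.

End ramp_expectation.

Section kolmogorov.
Context {R : realType} d (T : measurableType d) (P : probability T R)
  d' (T' : measurableType d') (Q : probability T' R).
Local Notation mu := (@lebesgue_measure R).
Variables (W : T -> R) (U : {RV Q >-> R}) (f : R -> R) (D C : R).
Hypothesis mW : measurable_fun setT W.
Hypothesis W_gt0 : P [set w | W w <= 0] = 0%E.
Hypothesis mf : measurable_fun setT f.
Hypothesis f_ge0 : forall x, 0 <= f x.
Hypothesis f_eq0 : forall x, x <= 0 -> f x = 0.
Hypothesis f_le : forall x, f x <= C.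
Hypothesis U_law : has_law U (fun A => \int[mu]_(x in A) (f x)%:E)%E.
Hypothesis C_gt0 : 0 < C.
Hypothesis D_ge0 : 0 <= D.
Hypothesis WU : (dist_Z 1 P W Q U <= D%:E)%E.

Let mU : measurable_fun setT U. Proof. exact: measurable_funPT. Qed.

Let leE (c : R) : [set x : R | x <= c] = `]-oo, c]%classic.
Proof. by apply/seteqP; split => x /=; rewrite in_itv. Qed.

Let U_gt0 : Q [set w | U w <= 0] = 0%E.
Proof.
transitivity (distribution Q U [set x | x <= 0]) => //.
rewrite U_law; last by rewrite leE.
apply: integral0_eq => x /= x0; by rewrite f_eq0.
Qed.

(** The density of [U] is at most [C], so the mean is at most [C] times the Lebesgue integral, which
    the primitive [L] evaluates. *)
Let segment_mean (l L : R -> R) (lo hi : R) : lo < hi ->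
  (forall x, {for x, continuous l}) -> (forall x, has_derive L x (l x)) ->
  (forall x, lo <= x <= hi -> 0 <= l x) ->
  [/\ measurable_fun setT (l \_ `[lo, hi]), (forall x, 0 <= (l \_ `[lo, hi]) x) &
  (\int[Q]_w ((l \_ `[lo, hi]) (U w))%:E <= (C * (L hi - L lo))%:E)%E].
Proof.
move=> lohi cl dL l0.
have ml : measurable_fun setT (l \_ `[lo, hi]).
  apply/(measurable_restrictT _ _).1 => //; apply: measurable_funTS.
  exact: continuous_measurable_fun.
have l0' x : 0 <= (l \_ `[lo, hi]) x.
  by rewrite patchE; case: ifP => //; rewrite inE/= in_itv/=; exact: l0.
split => //.
pose g (x : R) := ((l \_ `[lo, hi]) x)%:E.
have mg : measurable_fun setT g by exact/measurable_EFinP.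
have g0 x : (0 <= g x)%E by rewrite lee_fin.
rewrite [leLHS](ge0_expectation_density mf U_law mg g0) EFinM.
rewrite -(@integral_segment_is_derive R L l lo hi lohi (fun x _ => @cl x) (fun x _ => dL x)).
have mL : measurable_fun setT ((EFin \o l) \_ `[lo, hi]).
  apply/(measurable_restrictT _ _).1 => //; apply/measurable_EFinP.
  by apply: measurable_funTS; exact: continuous_measurable_fun.
have L0 x : (0 <= ((EFin \o l) \_ `[lo, hi]) x)%E.
  by rewrite patchE; case: ifP => //; rewrite inE/= in_itv/= lee_fin; exact: l0.
have -> : (C%:E * \int[mu]_(x in `[lo, hi]) (l x)%:E =
    \int[mu]_x (C%:E * ((EFin \o l) \_ `[lo, hi]) x))%E.
  by rewrite integral_mkcond ge0_integralZl// lee_fin ltW.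
apply: ge0_le_integral => //.
- by move=> x _; rewrite lee_fin mulr_ge0.
- apply/measurable_EFinP; exact: measurable_funM.
- by apply: emeasurable_funM => //; exact: measurable_cst.
- move=> x _; rewrite /g !patchE; case: ifPn => xl; last by rewrite mul0e mule0.
  rewrite -!EFinM lee_fin mulrC ler_wpM2r//.
  by move: xl; rewrite inE/= in_itv/=; exact: l0.
Qed.

Let restrictE (l : R -> R) (lo hi x : R) :
  (l \_ `[lo, hi]) x = if lo <= x <= hi then l x else 0.
Proof. by rewrite patchE mem_setE in_itv. Qed.

Let p z := fine (P [set w | W w <= z]).
Let q z := fine (Q [set w | U w <= z]).

Let pE z : P [set w | W w <= z] = (p z)%:E.
Proof.
rewrite /p fineK//; apply: fin_num_measure.
rewrite (_ : [set w | _] = W @^-1` `]-oo, z]%classic).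
  by rewrite -[X in measurable X]setTI; exact: mW.
by rewrite -leE.
Qed.

Let qE z : Q [set w | U w <= z] = (q z)%:E.
Proof.
rewrite /q fineK//; apply: fin_num_measure.
rewrite (_ : [set w | _] = U @^-1` `]-oo, z]%classic).
  by rewrite -[X in measurable X]setTI; exact: mU.
by rewrite -leE.
Qed.

Let ramp_close delta z e : 0 < delta ->
  0 <= e ->
  (expect_pos P W (ramp delta z e) <= expect_pos Q U (ramp delta z e) + D%:E)%E /\
  (expect_pos Q U (ramp delta z e) <= expect_pos P W (ramp delta z e) + D%:E)%E.
Proof.
move=> d0 e0; have : (`|expect_pos P W (ramp delta z e) - expect_pos Q U (ramp delta z e)| <= D%:E)%E.
  by apply: le_trans WU; apply: ereal_sup_ubound; exists (ramp delta z e) => //; exact: ramp_Z1.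
have ge0 d0' (T0 : measurableType d0') (P0 : probability T0 R) (V : T0 -> R) :
    (0 <= expect_pos P0 V (ramp delta z e))%E.
  rewrite /expect_pos unlock; apply: integral_ge0 => w _; rewrite lee_fin /= patchE.
  by case: ifP => // _; exact: ramp_ge0.
have := ge0 _ _ P W; have := ge0 _ _ Q U.
case: (expect_pos P W _) => [x| |]; case: (expect_pos Q U _) => [y| |] //=; rewrite ?leye_eq//.
move=> _ _; rewrite !lee_fin ler_norml => /andP[h1 h2].
by split; lra.
Qed.

(** The ramp that falls on [[z, z + e]] lies above the step at [z]. Its excess is paid for under
    [U]: a triangle of area [e^2 / 2] times the density bound. Each passage between step and ramp
    costs one [delta]. *)
Let upper z e delta : 0 < e -> 0 < delta ->
  e * p z <= e * q z + (D + C * (e ^+ 2 / 2)) + 2 * delta.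
Proof.
move=> e0 d0; have e0' := ltW e0; have d0' := ltW d0.
have mr := measurable_ramp z e d0.
have r0 x := ramp_ge0 z x d0 e0'.
have dL x : has_derive (fun t : R => - ((z + e - t) * (z + e - t) / 2)) x (z + e - x).
  have dl : is_derive x 1 (fun t : R => z + e - t) (- 1).
    by apply: is_derive_eq (deriveB_fun (deriveC_fun (z + e) x) (deriveI_fun x)) _; rewrite sub0r.
  apply: is_derive_eq (deriveN_fun (deriveM_fun (deriveM_fun dl dl) (deriveC_fun 2^-1 x))) _.
  by field.
have lz : z < z + e by rewrite ltrDl.
have cl x : {for x, continuous (fun t : R => z + e - t)}.
  by apply: cvgB; [exact: cvg_cst|exact: cvg_id].
have l0 x : z <= x <= z + e -> 0 <= z + e - x by move=> /andP[_ ?]; lra.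
have [mk k0 Hk] := segment_mean lz (@cl) dL l0.
have [H1 _] := ramp_close z d0 e0'.
have m0 : measurable_fun setT (fun _ : R => 0 : R) by exact: measurable_cst.
have H2 := step_le_ramp mW W_gt0 (z := z) mr m0 r0 (fun=> lexx 0) e0' d0'.
have H3 := ramp_le_step Q mU (z := z) mr mk r0 k0 e0' d0'.
have {}H2 : (e%:E * (p z)%:E <= expect_pos P W (ramp delta z e) + delta%:E)%E.
  rewrite -pE; move: H2; rewrite integral0 adde0; apply => x; rewrite addr0.
  have := ramp_ge z x d0 e0'; apply: le_trans.
  by case: ifP => xz; rewrite le_min le_max ?lexx ?e0'//=; apply/orP; right; lra.
have {}H3 : (expect_pos Q U (ramp delta z e) <=
    e%:E * (q z)%:E + delta%:E + (C * (e ^+ 2 / 2))%:E)%E.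
  rewrite -qE; apply: (le_trans (H3 _)); last first.
    rewrite leeD2l//; apply: (le_trans Hk); rewrite lee_fin ler_wpM2l ?(ltW C_gt0)//.
    by rewrite le_eqVlt; apply/orP; left; apply/eqP; field.
  move=> x; apply: (le_trans (ramp_le z x d0 e0')).
  rewrite [leRHS]addrAC lerD2r restrictE; case: (boolP (z <= x <= z + e)) => [/andP[zx xze]|].
    rewrite ge_min; apply/orP; right; rewrite ge_max; apply/andP; split.
      by rewrite addr_ge0 ?subr_ge0//; case: ifP.
    by case: ifP => _; lra.
  rewrite negb_and -!ltNge.
  rewrite addr0 ge_min ge_max; case: (leP x z) => [_ _|zx]; first by rewrite lexx.
  by rewrite lexx /= => /orP[xz|xz]; apply/orP; right; lra.
have : (e%:E * (p z)%:E <= e%:E * (q z)%:E + delta%:E + (C * (e ^+ 2 / 2))%:E + D%:E + delta%:E)%E.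
  apply: (le_trans H2); rewrite leeD2r//; apply: (le_trans H1); rewrite leeD2r//.
by rewrite -!EFinM -!EFinD lee_fin => H; lra.
Qed.

(** The ramp now falls on [[z - e, z]], below the step, so that the triangle is again integrated
    against the law of [U], for which a density bound is available. *)
Let lower z e delta : 0 < e -> 0 < delta ->
  e * q z <= e * p z + (D + C * (e ^+ 2 / 2)) + 2 * delta.
Proof.
move=> e0 d0; have e0' := ltW e0; have d0' := ltW d0.
have mr := measurable_ramp (z - e) e d0.
have r0 x := ramp_ge0 (z - e) x d0 e0'.
have dL x : has_derive (fun t : R => (t - (z - e)) * (t - (z - e)) / 2) x (x - (z - e)).
  have dl : is_derive x 1 (fun t : R => t - (z - e)) 1.
    by apply: is_derive_eq (deriveB_fun (deriveI_fun x) (deriveC_fun (z - e) x)) _; rewrite subr0.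
  apply: is_derive_eq (deriveM_fun (deriveM_fun dl dl) (deriveC_fun 2^-1 x)) _.
  by field.
have lz : z - e < z by rewrite ltrBlDr ltrDl.
have cl x : {for x, continuous (fun t : R => t - (z - e))}.
  by apply: cvgB; [exact: cvg_id|exact: cvg_cst].
have l0 x : z - e <= x <= z -> 0 <= x - (z - e) by move=> /andP[? _]; lra.
have [mk k0 Hk] := segment_mean lz (@cl) dL l0.
have [_ H1] := ramp_close (z - e) d0 e0'.
have m0 : measurable_fun setT (fun _ : R => 0 : R) by exact: measurable_cst.
have H2 := step_le_ramp mU U_gt0 (z := z) mr mk r0 k0 e0' d0'.
have H3 := ramp_le_step P mW (z := z) mr m0 r0 (fun=> lexx 0) e0' d0'.
have {}H3 : (expect_pos P W (ramp delta (z - e) e) <= e%:E * (p z)%:E + delta%:E)%E.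
  rewrite -pE; move: H3; rewrite integral0 adde0; apply => x; rewrite addr0.
  apply: (le_trans (ramp_le (z - e) x d0 e0')); rewrite lerD2r ge_min ge_max.
  by case: (leP x z) => xz; rewrite lexx//=; apply/orP; right; lra.
have {}H2 : (e%:E * (q z)%:E <=
    expect_pos Q U (ramp delta (z - e) e) + delta%:E + (C * (e ^+ 2 / 2))%:E)%E.
  rewrite -qE; apply: (le_trans (H2 _)); last first.
    rewrite leeD2l//; apply: (le_trans Hk); rewrite lee_fin ler_wpM2l ?(ltW C_gt0)//.
    by rewrite le_eqVlt; apply/orP; left; apply/eqP; field.
  move=> x; have := ramp_ge (z - e) x d0 e0'; rewrite -(lerD2r ((fun t => t - (z - e)) \_ `[z - e, z] x)).
  apply: le_trans; rewrite -lerBlDr le_min le_max restrictE.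
  case: (leP x z) => [xz|zx]; last by rewrite andbF subr0 e0' lexx.
  rewrite andbT; case: (leP (z - e) x) => zx.
    by rewrite -subr_ge0 in zx; apply/andP; split; [|apply/orP; right]; lra.
  by rewrite subr0 lexx; apply/orP; right; lra.
have : (e%:E * (q z)%:E <= e%:E * (p z)%:E + delta%:E + D%:E + delta%:E + (C * (e ^+ 2 / 2))%:E)%E.
  apply: (le_trans H2); rewrite leeD2r//; rewrite leeD2r//.
  by apply: (le_trans H1); rewrite leeD2r.
by rewrite -!EFinM -!EFinD lee_fin => H; lra.
Qed.

Let close z e : 0 < e -> `|p z - q z| <= D / e + C * e / 2.
Proof.
move=> e0.
have E : D / e + C * e / 2 = (D + C * (e ^+ 2 / 2)) / e by field; rewrite gt_eqF.
rewrite E ler_pdivlMr//.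
have -> : `|p z - q z| * e = `|e * p z - e * q z|.
  by rewrite -mulrBr normrM (gtr0_norm e0) mulrC.
apply/ler_addgt0Pr => eps eps0; have d0 : 0 < eps / 2 by rewrite divr_gt0.
have := upper z e0 d0; have := lower z e0 d0.
by rewrite ler_norml => h1 h2; apply/andP; split; lra.
Qed.

(** [D / e + C e / 2] is minimal at [e = sqrt (2 D C) / C], with value [sqrt (2 D C)]. For [D = 0]
    this choice degenerates, and [e] is made arbitrarily small instead. *)
Lemma dist_Kol_le : (dist_Kol P W Q U <= (Num.sqrt (2 * D * C))%:E)%E.
Proof.
apply: ge_ereal_sup => _ [z _ <-]; rewrite pE qE -EFinB lee_fin.
have [D0|D_neq0] := eqVneq D 0.
  rewrite D0 mulr0 mul0r sqrtr0; apply/ler_addgt0Pr => eps eps0; rewrite add0r.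
  have e0 : 0 < 2 * eps / C by rewrite divr_gt0 ?mulr_gt0.
  apply: (le_trans (close z e0)); rewrite D0 mul0r add0r.
  by rewrite le_eqVlt; apply/orP; left; apply/eqP; field; rewrite gt_eqF.
have D_gt0 : 0 < D by rewrite lt_def D_neq0.
have DC0 : 0 < 2 * D * C by rewrite !mulr_gt0.
have s0 : 0 < Num.sqrt (2 * D * C) by rewrite sqrtr_gt0.
have e0 : 0 < Num.sqrt (2 * D * C) / C by rewrite divr_gt0.
apply: (le_trans (close z e0)).
have ss : Num.sqrt (2 * D * C) ^+ 2 = 2 * D * C by rewrite sqr_sqrtr// ltW.
set S := Num.sqrt _ in ss s0 e0 *.
have DE : D = S ^+ 2 / (2 * C) by rewrite ss; field; rewrite gt_eqF.
rewrite [X in X / _]DE le_eqVlt; apply/orP; left; apply/eqP; field.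
by rewrite !gt_eqF.
Qed.

End kolmogorov.

(** * A lower bound on the gamma function *)

Section logarithm_bounds.
Context {R : realType}.
Implicit Types u v y : R.

Let dln1p (c v : R) : 0 < 1 + c * v -> is_derive v 1 (fun t => ln (1 + c * t)) (c / (1 + c * v)).
Proof.
move=> v0; have dl : is_derive v 1 (fun t : R => 1 + c * t) c.
  apply: is_derive_eq (deriveD_fun (deriveC_fun 1 v)
    (deriveM_fun (deriveC_fun c v) (deriveI_fun v))) _.
  by rewrite mul0r mulr1 !add0r.
apply: is_derive_eq (@derive_comp _ (@ln R) (fun t => 1 + c * t) v _ _ (is_derive1_ln v0) dl) _.
by rewrite mulrC.
Qed.

(** With [c t^3] added to the Taylor remainder, the derivative is [t^2 (1 / (1 + t) + 3 c)]. Take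
    [c = 1] for [v >= 0], and [c = -1] for [v <= 0], where [1 / (1 + t) <= 2]. *)
Lemma ln1D_ge v : `|v| <= 2^-1 -> v - v ^+ 2 / 2 - `|v| ^+ 3 <= ln (1 + v).
Proof.
rewrite ler_norml => /andP[v1 v2].
pose q (c t : R) := ln (1 + 1 * t) - t + t * t / 2 + c * (t * (t * t)).
have dq c t : 0 < 1 + 1 * t ->
    has_derive (q c) t (1 / (1 + 1 * t) - 1 + t + c * (3 * t ^+ 2)).
  move=> t0; apply: is_derive_eq (deriveD_fun (deriveD_fun (deriveB_fun (dln1p t0)
    (deriveI_fun t)) (deriveM_fun (deriveM_fun (deriveI_fun t) (deriveI_fun t))
    (deriveC_fun 2^-1 t))) (deriveM_fun (deriveC_fun c t) (deriveM_fun (deriveI_fun t)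
    (deriveM_fun (deriveI_fun t) (deriveI_fun t))))) _.
  by field; rewrite gt_eqF//; lra.
have q0 c : q c 0 = 0 by rewrite /q !(mulr0, mul0r, addr0, subr0) ln1.
have qE (t c : R) : 0 < 1 + 1 * t -> 1 / (1 + 1 * t) - 1 + t + c * (3 * t ^+ 2) =
    t ^+ 2 * ((1 + t)^-1 + 3 * c).
  by rewrite mul1r => t0; field; rewrite gt_eqF//; lra.
have [v0|/ltW v0] := leP 0 v.
  have : q 1 0 <= q 1 v.
    apply: (@is_derive_le _ _ (fun t => 1 / (1 + 1 * t) - 1 + t + 1 * (3 * t ^+ 2))) => //.
      by move=> t /andP[t0 _]; apply: dq; lra.
    move=> t /andP[t0 _]; have t1 : 0 < 1 + 1 * t by lra.
    by rewrite qE// mulr_ge0 ?sqr_ge0// addr_ge0// invr_ge0; lra.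
  by rewrite q0 /q (ger0_norm v0) mul1r => H; rewrite !exprS expr0; lra.
have : q (-1) 0 <= q (-1) v.
  apply: (@is_derive_ge _ _ (fun t => 1 / (1 + 1 * t) - 1 + t + (-1) * (3 * t ^+ 2))) => //.
    by move=> t /andP[t0 _]; apply: dq; lra.
  move=> t /andP[t0 t0']; have t1 : 0 < 1 + 1 * t by lra.
  have t2 : 0 < 1 + t by lra.
  rewrite qE// mulr_ge0_le0 ?sqr_ge0// mulrN1 subr_le0.
  by rewrite -[leLHS]mul1r ler_pdivrMr//; lra.
by rewrite q0 /q (ler0_norm v0) mul1r => H; rewrite !exprS expr0; lra.
Qed.

(* For [u := 1 / (2 y + 1)] the fraction is [2 u] times the increment of [1 / (12 y + 1)]. *)
Let ln_ratio_ge u : 0 <= u -> u < 1 ->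
  2 * u + 24 * u ^+ 3 / ((6 - 5 * u) * (6 + 7 * u)) <= ln (1 + u) - ln (1 - u).
Proof.
move=> u0 u1.
pose q (t : R) := 36 + 12 * t - 35 * t ^+ 2.
have qE (t : R) : (6 - 5 * t) * (6 + 7 * t) = q t by rewrite /q; ring.
pose L (t : R) := ln (1 + 1 * t) - ln (1 + (-1) * t) - 2 * t -
  24 * (t * (t * t) * (q t)^-1).

pose d (t : R) := 2 / (1 - t ^+ 2) - 2 -
  24 * (3 * t ^+ 2 / q t - t ^+ 3 * (12 - 70 * t) / q t ^+ 2).
have dL t : 0 <= t -> t < 1 -> has_derive L t (d t).
  move=> t0 t1.
  have p1 : 0 < 1 + 1 * t by lra.
  have p2 : 0 < 1 + (-1) * t by lra.
  have q0 : q t != 0 by rewrite -qE mulf_neq0// gt_eqF//; lra.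
  have dq : is_derive t 1 q (12 - 70 * t).
    have -> : q = fun t => 36 + 12 * t - 35 * (t * t).
      by apply/funext => s; rewrite /q expr2.
    apply: is_derive_eq (deriveB_fun (deriveD_fun (deriveC_fun 36 t)
      (deriveM_fun (deriveC_fun 12 t) (deriveI_fun t))) (deriveM_fun (deriveC_fun 35 t)
      (deriveM_fun (deriveI_fun t) (deriveI_fun t)))) _.
    by ring.
  apply: is_derive_eq (deriveB_fun (deriveB_fun (deriveB_fun (dln1p p1) (dln1p p2))
    (deriveM_fun (deriveC_fun 2 t) (deriveI_fun t))) (deriveM_fun (deriveC_fun 24 t)
    (deriveM_fun (deriveM_fun (deriveI_fun t) (deriveM_fun (deriveI_fun t)
    (deriveI_fun t))) (@deriveV_fun _ q t _ q0 dq)))) _.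
  have E1 : 2 / (1 - t ^+ 2) = 1 / (1 + 1 * t) - (-1) / (1 + (-1) * t).
    have n2 : 1 - t ^+ 2 != 0 by rewrite gt_eqF// subr_gt0 expr_lt1.
    by field; rewrite n2 !gt_eqF//; lra.
  rewrite /d E1.
  have S (x1 x2 y1 y2 : R) : x1 = x2 -> y1 = y2 -> x1 - y1 = x2 - y2 by move=> -> ->.
  apply: S; first by rewrite mul0r add0r mulr1.
  by field.
have : L 0 <= L u.
  apply: (@is_derive_le _ _ d) => //.
    by move=> t /andP[t0 tu]; apply: dL => //; exact: le_lt_trans u1.
  move=> t /andP[t0 tu]; have t1 : t < 1 by exact: le_lt_trans u1.
  have n2 : 0 < 1 - t ^+ 2 by rewrite subr_gt0 expr_lt1.
  have q0 : 0 < q t by rewrite -qE mulr_gt0//; lra.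
  have -> : d t = 2 * t ^+ 3 * (576 - 660 * t - 552 * t ^+ 2 + 805 * t ^+ 3) /
      ((1 - t ^+ 2) * q t ^+ 2).
    have n2' := lt0r_neq0 n2; have q0' := lt0r_neq0 q0.
    by rewrite /d; move: q0'; rewrite /q => q0'; field; rewrite n2' q0'.
  have t3 : 0 <= t ^+ 3 by rewrite exprn_ge0.
  apply: divr_ge0; last by apply: mulr_ge0; [exact: ltW|apply: exprn_ge0; exact: ltW].
  apply: mulr_ge0; first by apply: mulr_ge0; [lra|exact: t3].
  (* Sign of the cubic factor. Up to [1 / 2] the bound [t^2 <= 1 / 4] is enough. Beyond, [t^3] is
     bounded below by its tangent at [4 / 5] and [t^2] above by its chord over [[1 / 2, 1]], and the
     inequality becomes linear. *)
  have [th|th] := leP t 2^-1.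
    have : t ^+ 2 <= 4^-1.
      have -> : 4^-1 = 2^-1 ^+ 2 :> R by rewrite expr2; field.
      by rewrite lerXn2r ?nnegrE ?invr_ge0.
    lra.
  have : 0 <= (t - 4 / 5) ^+ 2 * (t + 8 / 5) by rewrite mulr_ge0 ?sqr_ge0//; lra.
  have -> : (t - 4 / 5) ^+ 2 * (t + 8 / 5) = t ^+ 3 - 48 / 25 * t + 128 / 125 by field.
  have : 0 <= (t - 2^-1) * (1 - t) by rewrite mulr_ge0//; lra.
  have -> : (t - 2^-1) * (1 - t) = - t ^+ 2 + 3 / 2 * t - 2^-1 by field.
  lra.
rewrite /L !(mulr0, mul0r, addr0, subr0) ln1 subrr mul1r mulN1r => H.
have -> : 24 * u ^+ 3 / ((6 - 5 * u) * (6 + 7 * u)) = 24 * (u * (u * u) / q u).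
  by rewrite qE -mulrA; congr (24 * (_ / _)); ring.
by lra.
Qed.

(** At [u = 1 / (2 y + 1)] the quotient of [1 + u] by [1 - u] is [(y + 1) / y], and
    [y + 1 / 2 = 1 / (2 u)]. *)
Lemma robbins_increment y : 0 < y ->
  1 + 12 / ((12 * y + 1) * (12 * y + 13)) <= (y + 2^-1) * (ln (y + 1) - ln y).
Proof.
move=> y0; pose u := (2 * y + 1)^-1.
have w0 : 0 < 2 * y + 1 by lra.
have u0 : 0 < u by rewrite invr_gt0.
have u1 : u < 1 by rewrite invf_lt1//; lra.
have := ln_ratio_ge (ltW u0) u1.
have -> : 1 + u = 2 * (y + 1) / (2 * y + 1) by rewrite /u; field; rewrite gt_eqF.
have -> : 1 - u = 2 * y / (2 * y + 1) by rewrite /u; field; rewrite gt_eqF.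
have pos1 : 0 < 2 * (y + 1) by lra.
have pos2 : 0 < 2 * y by lra.
rewrite !ln_div ?posrE// !lnM ?posrE//; last by lra.
have -> : ln 2 + ln (y + 1) - ln (2 * y + 1) - (ln 2 + ln y - ln (2 * y + 1)) =
  ln (y + 1) - ln y by ring.
rewrite -(ler_pM2l (_ : 0 < y + 2^-1)); last by lra.
apply: le_trans; rewrite le_eqVlt; apply/orP; left; apply/eqP.
rewrite /u; field.
by rewrite !gt_eqF//; lra.
Qed.

End logarithm_bounds.

Section gamma_function_lower_bound.
Context {R : realType}.
Local Notation mu := (@lebesgue_measure R).
Implicit Types (t x y s A : R).

Let w x t := t `^ x * expR (- t).

Let w_ge0 x t : 0 <= w x t.
Proof. by rewrite mulr_ge0 ?powR_ge0 ?expR_ge0. Qed.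

Let dw x t : 0 < t -> is_derive t 1 (w x) ((x / t - 1) * w x t).
Proof.
move=> t0; have := gamma_weight_derive (x + 1) t0 (oner_neq0 R).
have E : (fun s : R => s `^ (x + 1 - 1) * expR (- s / 1)) = w x.
  by apply/funext => s; rewrite /w addrK divr1.
rewrite E => H; apply: is_derive_eq H _.
by rewrite /w addrK invr1 !mulr1.
Qed.

Let cw x t : 0 < t -> {for t, continuous (w x)}.
Proof. by move=> t0; exact: is_derive_continuous (dw x t0). Qed.

Let wK x t : 0 < t -> `|w x t| <= 1 * ((1 + t) ^+ 0 * (t `^ (x + 1 - 1) * expR (- t / 1))).
Proof. by move=> t0; rewrite expr0 !mul1r addrK divr1 ger0_norm. Qed.

Let gamma_functionE x : gamma_function (x + 1) = \int[mu]_(t in `]0, +oo[) w x t.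
Proof. by rewrite /gamma_function addrK. Qed.

(** Integration by parts: if [H] is the primitive of [w (x - 1)], then [x H - w x] is one of [w x],
    and [w x] vanishes at both ends. *)
Lemma gamma_functionS x : 0 < x -> gamma_function (x + 1) = x * gamma_function x.
Proof.
move=> x0; pose x' := x - 1.
have xE : x = x' + 1 by rewrite /x' subrK.
have x'0 : 0 < x' + 1 by rewrite -xE.
pose H y := \int[mu]_(t in `]0, y[) w x' t.
have dH y : 0 < y -> is_derive y 1 H (w x' y).
  exact: (weighted_primitive_derive x'0 ltr01 (@cw x') (@wK x')).
have H0 : H t @[t --> 0^'+] --> 0.
  exact: (@weighted_primitive_cvg0 _ _ _ x'0 ltr01 _ _ _ (@cw x') (@wK x')).
have Hy : H t @[t --> +oo] --> gamma_function x.
  rewrite xE gamma_functionE.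
  exact: (@weighted_primitive_cvgy _ _ _ x'0 ltr01 _ _ _ (@cw x') (@wK x')).
pose F t := x * H t - w x t.
have dF t : 0 < t -> has_derive F t (w x t).
  move=> t0; apply: is_derive_eq (deriveB_fun (deriveM_fun (deriveC_fun x t) (dH t t0))
    (dw x t0)) _.
  have -> : w x' t = w x t / t.
    by rewrite /w /x' -(mulr_powRB1 (ltW t0) x0); field; rewrite gt_eqF.
  by rewrite mul0r add0r; field; rewrite gt_eqF.
have w0 : w x t @[t --> 0^'+] --> 0.
  have : t `^ x * 1 @[t --> 0^'+] --> 0 * (1 : R).
    by apply: cvgM; [exact: powR_cvg0|exact: cvg_cst].
  rewrite mul0r => px0; apply: (cvg_norm_le0 _ px0); near=> t.
  rewrite ger0_norm// ler_wpM2l ?powR_ge0// -expR0 ler_expR oppr_le0 ltW//.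
have wy : w x t @[t --> +oo] --> 0.
  have := gamma_weight_cvgy (addr_gt0 x0 ltr01) (ltr01 : 0 < 1 :> R) 0.
  by under eq_cvg do rewrite expr0 mul1r addrK divr1.
rewrite gamma_functionE /Rintegral.
rewrite (@ge0_integral_0y R F (w x) 0 (x * gamma_function x) (@cw x) _ dF)//=.
- by rewrite subr0.
- have : x * H t - w x t @[t --> 0^'+] --> x * 0 - 0.
    by apply: cvgB => //; apply: cvgM => //; exact: cvg_cst.
  by rewrite mulr0 subr0.
- have : x * H t - w x t @[t --> +oo] --> x * gamma_function x - 0.
    by apply: cvgB => //; apply: cvgM => //; exact: cvg_cst.
  by rewrite subr0.
Unshelve. all: by end_near. Qed.

Let bump A : R := \int[mu]_(t in `[- A, A]) expR (- t ^+ 2 / 2).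

(* Chebyshev's inequality for the standard normal law. *)
Let bump_ge A : 0 < A -> Num.sqrt (pi *+ 2) * (1 - A ^- 2) <= bump A.
Proof.
move=> A0; pose phi := normal_pdf (0 : R) 1.
have D1 (t : R) : `|t| <= 1 * (1 + t ^+ 2) ^+ 1.
  have : 0 <= (`|t| - 1) ^+ 2 by rewrite sqr_ge0.
  by rewrite mul1r expr1 sqrrB1 real_normK ?num_real//; have := normr_ge0 t; lra.
have D1' (t : R) : `|1 : R| <= 1 * (1 + t ^+ 2) ^+ 1.
  by rewrite mul1r expr1 normr1 lerDl sqr_ge0.
have I1 := gaussian_ibp_integrable1 ltr01 (@deriveI_fun R) D1.
have c1 (t : R) : {for t, continuous (fun _ : R => 1 : R)} by exact: cvg_cst.
have E := gaussian_ibp1 ltr01 (@deriveI_fun R) c1 D1 D1'.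
have ip : mu.-integrable setT (EFin \o phi) by exact: integrable_normal_pdf.
(* The second moment of the standard normal law, by Gaussian integration by parts of the identity
   function. *)
have E2 : \int[mu]_t (t * t * phi t) = 1.
  rewrite /Rintegral E expr1n mul1e.
  under eq_integral do rewrite mul1r.
  by rewrite integral_normal_pdf.
have E1 : \int[mu]_t phi t = 1 by rewrite /Rintegral integral_normal_pdf.
have pE t : phi t = (Num.sqrt (pi *+ 2))^-1 * expR (- t ^+ 2 / 2).
  by rewrite /phi /normal_pdf (negbTE (oner_neq0 R)) /normal_peak /normal_fun subr0 expr1n mul1r.
have s0 : 0 < Num.sqrt (pi *+ 2 : R) by rewrite sqrtr_gt0 mulrn_wgt0// pi_gt0.
have ipA : mu.-integrable `[- A, A] (EFin \o phi) by exact: integrableS ip.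
have -> : bump A = Num.sqrt (pi *+ 2) * \int[mu]_(t in `[- A, A]) phi t.
  rewrite -RintegralZl//; apply: eq_Rintegral => t _.
  by rewrite pE mulrA divff ?mul1r// gt_eqF.
rewrite ler_pM2l// Rintegral_mkcond.
have iA : mu.-integrable setT (EFin \o (phi \_ `[- A, A])).
  by rewrite -restrict_EFin; apply/(integrable_mkcond _ _).1.
have iZ : mu.-integrable setT (EFin \o (fun t => A ^- 2 * (t * t * phi t))).
  exact: (integrableZl measurableT (A ^- 2) I1).
have -> : 1 - A ^- 2 = \int[mu]_t (phi t - A ^- 2 * (t * t * phi t)).
  by rewrite RintegralB// E1 RintegralZl// E2 mulr1.
apply: le_Rintegral => //; first exact: (integrableB measurableT ip iZ).
move=> t _; have p0 : 0 <= phi t by exact: normal_pdf_ge0.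
have A2 : 0 < A ^- 2 by rewrite invr_gt0 exprn_gt0.
rewrite patchE; case: ifPn => [_|].
  by rewrite lerBlDr lerDl mulr_ge0 ?(ltW A2)// mulr_ge0// -expr2 sqr_ge0.
rewrite notin_setE/= in_itv/= -ler_norml => /negP; rewrite -ltNge => At.
rewrite -[X in X - _]mul1r mulrA -mulrBl mulr_le0_ge0// subr_le0.
rewrite mulrC ler_pdivlMr ?exprn_gt0// mul1r -expr2 -[leRHS]real_normK ?num_real//.
by rewrite lerXn2r ?nnegrE ?(ltW A0)// ltW.
Qed.

(** Laplace's method: [t = y + sqrt y s] centres the integrand at its maximum [y]. For [|s| <= A]
    the exponent is at least [y ln y - y - s^2 / 2 - A^3 / sqrt y], by [ln1D_ge] at [s / sqrt y],
    which [2 A <= sqrt y] keeps within [1 / 2]. *)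
Let integral_w_segment y A : 0 < A -> 2 * A <= Num.sqrt y ->
  Num.sqrt y * expR (y * ln y - y - A ^+ 3 / Num.sqrt y) * bump A <= gamma_function (y + 1).
Proof.
move=> A0 Ay; set r := Num.sqrt y in Ay *.
have r0 : 0 < r by apply: lt_le_trans Ay; rewrite mulr_gt0.
have y0 : 0 < y by rewrite -sqrtr_gt0.
have yE : y = r ^+ 2 by rewrite sqr_sqrtr// ltW.
pose F s := y + r * s.
have dF s : is_derive s 1 F r.
  apply: is_derive_eq (deriveD_fun (deriveC_fun y s)
    (deriveM_fun (deriveC_fun r s) (deriveI_fun s))) _.
  by rewrite mul0r mulr1 !add0r.
have dFE : F^`()%classic = cst r.
  by apply/funext => s; rewrite derive1E; have [_ ->] := dF s.
have cF s : {for s, continuous F} by exact: is_derive_continuous (dF s).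
have F0 s : `|s| <= A -> 0 < F s.
  rewrite ler_norml /F yE => /andP[s1 s2]; have := ltW r0; nra.
have NAA : - A <= A by lra.
have FA s : - A <= s <= A -> 0 < F s by rewrite -ler_norml; exact: F0.
have E : (\int[mu]_(x in `[F (- A)%R, F A]) (w y x)%:E =
    \int[mu]_(s in `[(- A)%R, A]) (w y (F s) * r)%:E)%E.
  rewrite (integration_by_substitution_increasing (F := F) (G := w y) NAA)//.
  - by apply: eq_integral => s _; rewrite dFE.
  - by move=> s t _ _ st; rewrite /F ltrD2l ltr_pM2l.
  - by rewrite dFE => s _; exact: cst_continuous.
  - by rewrite dFE; exact: is_cvg_cst.
  - by rewrite dFE; exact: is_cvg_cst.
  - by apply: derivable_segment_LRcontinuous => // s _; exact: dF.
  - apply: continuous_in_subspaceT => t; rewrite inE/= in_itv/= => /andP[t1 _].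
    by apply: cw; apply: lt_le_trans t1; apply: FA; rewrite lexx.
have iw : mu.-integrable `]0%R, +oo[ (EFin \o w y).
  have y1 : 0 < y + 1 by rewrite addr_gt0.
  exact: (weighted_integrable y1 ltr01 (@cw y) (@wK y)).
rewrite -lee_fin gamma_functionE.
apply: (@le_trans _ _ (\int[mu]_(x in `[F (- A)%R, F A]) (w y x)%:E)%E); last first.
  rewrite /Rintegral fineK; last exact: integrable_fin_num iw.
  apply: ge0_subset_integral => //.
  - by case/integrableP: iw.
  - by move=> t _; rewrite lee_fin.
  - move=> t; rewrite /= !in_itv/= andbT => /andP[t1 _].
    by apply: lt_le_trans t1; apply: FA; rewrite lexx.
have ce t : {for t, continuous (fun t : R => expR (- t ^+ 2 / 2))}.
  have : is_derive t 1 (fun t : R => expR (- t ^+ 2 / 2)) (expR (- t ^+ 2 / 2) * (- t)).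
    have dl : is_derive t 1 (fun t : R => - t ^+ 2 / 2) (- t).
      have -> : (fun t : R => - t ^+ 2 / 2) = fun t => - (t * t) * 2^-1.
        by apply/funext => u; rewrite expr2.
      apply: is_derive_eq (deriveM_fun (deriveN_fun (deriveM_fun (deriveI_fun t)
        (deriveI_fun t))) (deriveC_fun 2^-1 t)) _.
      by field.
    exact: (@derive_comp _ expR (fun t : R => - t ^+ 2 / 2) t _ _ (is_derive_expR _) dl).
  exact: is_derive_continuous.
have ie : mu.-integrable `[- A, A] (EFin \o (fun t : R => expR (- t ^+ 2 / 2))).
  apply: continuous_compact_integrable; first exact: segment_compact.
  by apply: continuous_in_subspaceT => t _; exact: ce.
rewrite E /bump EFinM /Rintegral fineK; last exact: integrable_fin_num ie.
have me : measurable_fun setT (fun t : R => expR (- t ^+ 2 / 2)).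
  exact: (continuous_measurable_fun (@ce)).
rewrite -ge0_integralZl//; last 2 first.
- by apply/measurable_EFinP; exact: measurable_funTS.
- by rewrite lee_fin mulr_ge0 ?expR_ge0// ltW.
apply: ge0_le_integral => //.
- by move=> t _; rewrite -EFinM lee_fin mulr_ge0 ?expR_ge0// mulr_ge0 ?expR_ge0// ltW.
- apply: emeasurable_funM; first exact: measurable_cst.
  by apply/measurable_EFinP; exact: measurable_funTS.
- apply/measurable_EFinP; apply: measurable_funM; last exact: measurable_cst.
  apply: subspace_continuous_measurable_fun => //.
  apply: continuous_in_subspaceT => s; rewrite inE/= in_itv/= => sA.
  by apply: (@continuous_comp _ _ _ F (w y) s (@cF s)); apply: cw; exact: FA.
move=> s; rewrite /= in_itv/= => sA; rewrite lee_fin -mulrA [leRHS]mulrC ler_wpM2l ?(ltW r0)//.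
have Fs0 := FA s sA; have sA' : `|s| <= A by rewrite ler_norml.
rewrite /w powR_expR// -!expRD ler_expR.
pose v := s / r.
have FsE : F s = y * (1 + v) by rewrite /F /v yE; field; rewrite gt_eqF.
have v2 : `|v| <= 2^-1.
  rewrite normrM normfV (gtr0_norm r0) ler_pdivrMr// (le_trans sA')//.
  by rewrite ler_pdivlMl.
have v1 : 0 < 1 + v by move: v2; rewrite ler_norml => /andP[? ?]; lra.
have := ln1D_ge v2; rewrite -(ler_pM2l y0).
have -> : ln (F s) = ln y + ln (1 + v) by rewrite FsE lnM.
have -> : y * (v - v ^+ 2 / 2 - `|v| ^+ 3) = r * s - s ^+ 2 / 2 - `|s| ^+ 3 / r.
  by rewrite normrM normfV (gtr0_norm r0) /v yE; field; rewrite gt_eqF.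
have : `|s| ^+ 3 / r <= A ^+ 3 / r.
  by rewrite ler_wpM2r ?invr_ge0 ?(ltW r0)// lerXn2r ?nnegrE// ltW.
by rewrite /F => h1 h2; lra.
Qed.

(** Stirling's leading term for [gamma_function (y + 1)]. *)
Let K y := Num.sqrt (pi *+ 2) * Num.sqrt y * expR (y * ln y - y).

Let K_gt0 y : 0 < y -> 0 < K y.
Proof.
by move=> y0; rewrite !mulr_gt0 ?expR_gt0// sqrtr_gt0// mulrn_wgt0// pi_gt0.
Qed.

Let stirling_ratio y := gamma_function (y + 1) / (K y * expR (1 / (12 * y + 1))).

(** In logarithms this is [robbins_increment], whose fraction is the difference of [1 / (12 y + 1)]
    and its value at [y + 1]. *)
Let stirling_ratio_decr y : 0 < y -> stirling_ratio (y + 1) <= stirling_ratio y.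
Proof.
move=> y0; have y1 : 0 < y + 1 by rewrite addr_gt0.
rewrite /stirling_ratio (gamma_functionS y1).
have g0 : 0 < gamma_function (y + 1) by exact: gamma_function_gt0.
have d0 z : 0 < z -> 0 < K z * expR (1 / (12 * z + 1)).
  by move=> z0; rewrite mulr_gt0 ?expR_gt0// K_gt0.
rewrite ler_pdivrMr ?d0// [leRHS]mulrAC ler_pdivlMr ?d0//.
have -> : (y + 1) * gamma_function (y + 1) * (K y * expR (1 / (12 * y + 1))) =
    gamma_function (y + 1) * ((y + 1) * (K y * expR (1 / (12 * y + 1)))) by ring.
rewrite ler_pM2l//.
have KE z : 0 < z -> K z = Num.sqrt (pi *+ 2) * expR (2^-1 * ln z + (z * ln z - z)).
  move=> z0; have sE : Num.sqrt z = expR (2^-1 * ln z).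
    by rewrite -powR12_sqrt ?(ltW z0)// powR_expR.
  by rewrite /K sE -mulrA -expRD.
rewrite !KE// -{1}(lnK (_ : y + 1 \is Num.pos))//.
rewrite -!mulrA [leLHS]mulrCA ler_wpM2l ?sqrtr_ge0// -!expRD ler_expR.
have := robbins_increment y0.
have -> : 12 / ((12 * y + 1) * (12 * y + 13)) = 1 / (12 * y + 1) - 1 / (12 * (y + 1) + 1).
  by field; rewrite !gt_eqF//; lra.
by lra.
Qed.

(** The first factor accounts for the mass outside [[-A, A]]. The second bounds from below, by
    [1 + x <= exp x], the combined Taylor error and Robbins factor. *)
Let stirling_ratio_large y A : 1 <= A -> 2 * A <= Num.sqrt y ->
  (1 - A ^- 2) * (1 - (A ^+ 3 / Num.sqrt y + 1 / (12 * y + 1))) <= stirling_ratio y.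
Proof.
move=> A1 Ay; have A0 : 0 < A := lt_le_trans ltr01 A1.
have H := integral_w_segment A0 Ay; have Hb := bump_ge A0.
have r0 : 0 < Num.sqrt y by apply: lt_le_trans Ay; rewrite mulr_gt0.
have y0 : 0 < y by rewrite -sqrtr_gt0.
have d0 : 0 < K y * expR (1 / (12 * y + 1)) by rewrite mulr_gt0 ?expR_gt0// K_gt0.
rewrite /stirling_ratio ler_pdivlMr//; apply: le_trans H.
set q := A ^+ 3 / Num.sqrt y; set e := 1 / (12 * y + 1).
have p0 : 0 <= 1 - A ^- 2 by rewrite subr_ge0 invf_le1 ?exprn_gt0// exprn_ege1.
have c0 : 0 <= Num.sqrt (pi *+ 2) * Num.sqrt y * expR (y * ln y - y) * (1 - A ^- 2).
  by rewrite !mulr_ge0 ?expR_ge0 ?sqrtr_ge0.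
have He : (1 - (q + e)) * expR e <= expR (- q).
  have -> : expR (- q) = expR (- (q + e)) * expR e by rewrite -expRD; congr expR; ring.
  by rewrite ler_wpM2r ?expR_ge0//; exact: expR_ge1Dx.
apply: (@le_trans _ _ (Num.sqrt (pi *+ 2) * Num.sqrt y * expR (y * ln y - y) * (1 - A ^- 2) *
    expR (- q))).
  have -> : (1 - A ^- 2) * (1 - (q + e)) * (K y * expR e) =
      Num.sqrt (pi *+ 2) * Num.sqrt y * expR (y * ln y - y) * (1 - A ^- 2) *
      ((1 - (q + e)) * expR e) by rewrite /K; ring.
  by rewrite ler_wpM2l.
have -> : Num.sqrt (pi *+ 2) * Num.sqrt y * expR (y * ln y - y) * (1 - A ^- 2) * expR (- q) =
    Num.sqrt y * (expR (y * ln y - y) * expR (- q)) * (Num.sqrt (pi *+ 2) * (1 - A ^- 2)).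
  by ring.
have -> : expR (y * ln y - y - q) = expR (y * ln y - y) * expR (- q) by rewrite -expRD.
by rewrite ler_wpM2l// !mulr_ge0 ?expR_ge0 ?sqrtr_ge0.
Qed.

Lemma gamma_function_ge y : 0 < y ->
  Num.sqrt (2 * pi * y) * expR (y * ln y - y) * expR (1 / (12 * y + 1)) <=
  gamma_function (y + 1).
Proof.
move=> y0.
suff : 1 <= stirling_ratio y.
  rewrite /stirling_ratio ler_pdivlMr; last by rewrite mulr_gt0 ?expR_gt0// K_gt0.
  have -> : Num.sqrt (2 * pi * y) = Num.sqrt (pi *+ 2) * Num.sqrt y.
    have -> : 2 * pi = pi *+ 2 :> R by rewrite mulr_natl.
    by rewrite sqrtrM// mulrn_wge0// pi_ge0.
  by move=> H; rewrite -[leLHS]mul1r; exact: H.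
have decr N : stirling_ratio (y + N%:R) <= stirling_ratio y.
  elim: N => [|N IH]; first by rewrite addr0.
  apply: le_trans IH; rewrite -natr1 addrA; apply: stirling_ratio_decr.
  by rewrite ltr_wpDr.
apply/ler_addgt0Pr => eps eps0.
(* The three losses add up to [eps]: [A] makes [A^-2] at most [eps / 2], then [B] and the term
   [4 / eps] in [N] make the other two at most [eps / 4] each. *)
pose A := 2 / eps + 1; have A1 : 1 <= A by rewrite lerDr divr_ge0// ltW.
have A0 : 0 < A by rewrite (lt_le_trans ltr01).
pose B := 2 * A + 4 * A ^+ 3 / eps.
have A3 : 0 < A ^+ 3 by rewrite exprn_gt0.
have B0 : 0 < B by rewrite addr_gt0 ?divr_gt0 ?mulr_gt0.
have Be0 : 0 < 4 / eps by rewrite divr_gt0.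
pose N := Num.bound (B ^+ 2 + 4 / eps).
have HN : B ^+ 2 + 4 / eps < N%:R.
  by apply: archi_boundP; rewrite addr_ge0 ?sqr_ge0// ltW.
have sN : B <= Num.sqrt (y + N%:R).
  rewrite -(ger0_norm (ltW B0)) -sqrtr_sqr ler_sqrt; last by rewrite addr_ge0// ltW.
  by lra.
have sN0 : 0 < Num.sqrt (y + N%:R) := lt_le_trans B0 sN.
have A2 : 2 * A <= Num.sqrt (y + N%:R).
  by apply: le_trans sN; rewrite lerDl ltW// divr_gt0 ?mulr_gt0.
have := le_trans (stirling_ratio_large A1 A2) (decr N).
have h1 : A ^- 2 <= eps / 2.
  apply: (@le_trans _ _ A^-1).
    by rewrite lef_pV2 ?posrE ?exprn_gt0// expr2 ler_peMr// ltW.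
  by rewrite -[leRHS]invrK lef_pV2 ?posrE ?invr_gt0 ?divr_gt0// invf_div lerDl.
have h2 : A ^+ 3 / Num.sqrt (y + N%:R) <= eps / 4.
  rewrite ler_pdivrMr//; apply: (@le_trans _ _ (eps / 4 * B)); last first.
    by rewrite ler_wpM2l// ltW// divr_gt0.
  rewrite /B mulrDr; have -> : eps / 4 * (4 * A ^+ 3 / eps) = A ^+ 3 by field; rewrite gt_eqF.
  by rewrite lerDr mulr_ge0// ltW// ?divr_gt0// mulr_gt0.
have Y1 : 4 / eps <= 12 * (y + N%:R) + 1 by have := sqr_ge0 B; lra.
have h3 : 1 / (12 * (y + N%:R) + 1) <= eps / 4.
  rewrite mul1r -[leRHS]invrK lef_pV2 ?posrE ?invr_gt0 ?divr_gt0//; last exact: lt_le_trans Y1.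
  by rewrite invf_div.
have h4 : 0 <= A ^- 2 by rewrite invr_ge0 exprn_ge0// ltW.
have h5 : 0 <= A ^+ 3 / Num.sqrt (y + N%:R) by rewrite divr_ge0 ?ltW.
have h6 : 0 <= 1 / (12 * (y + N%:R) + 1) by rewrite divr_ge0// (le_trans (ltW Be0)).
move=> H; apply: (@le_trans _ _ (1 - A ^- 2 - (A ^+ 3 / Num.sqrt (y + N%:R) +
  1 / (12 * (y + N%:R) + 1)) + eps)); first by lra.
rewrite lerD2r; apply: le_trans H; rewrite -subr_ge0.
have -> : forall u v : R, (1 - u) * (1 - v) - (1 - u - v) = u * v by move=> u v; ring.
by rewrite mulr_ge0// addr_ge0.
Qed.

(* The maximum of the density is attained at [b (a - 1)]. *)
Lemma gamma_pdf_le a b x : 1 < a -> 0 < b ->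
  gamma_pdf a b x <= (b * Num.sqrt (2 * pi * (a - 1)) * r_ a)^-1.
Proof.
move=> a1 b0; have a0 : 0 < a := lt_trans ltr01 a1.
have m0 : 0 < a - 1 by rewrite subr_gt0.
have s0 : 0 < Num.sqrt (2 * pi * (a - 1)) by rewrite sqrtr_gt0 !mulr_gt0 ?pi_gt0.
have r0 : 0 < r_ a by exact: expR_gt0.
have [x0|x0] := leP x 0.
  by rewrite /gamma_pdf ltNge x0/= invr_ge0 !mulr_ge0 ?ltW.
have u0 : 0 < x / b by rewrite divr_gt0.
have -> : gamma_pdf a b x = b^-1 * gamma_pdf a 1 (x / b).
  rewrite -(gamma_pdf_scale a0 b0 u0) (mulrC x) mulVKf ?gt_eqF// mulKf ?gt_eqF//.
have -> : (b * Num.sqrt (2 * pi * (a - 1)) * r_ a)^-1 =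
    b^-1 * (Num.sqrt (2 * pi * (a - 1)) * r_ a)^-1 by rewrite -mulrA invfM.
rewrite ler_pM2l ?invr_gt0// gamma_pdf_pos// powR1 mulr1 divr1 powR_expR// -expRD.
have g0 := gamma_function_gt0 a0.
have G := gamma_function_ge m0; rewrite subrK in G.
(* [12 a - 11] is [12 (a - 1) + 1]: the constant [r_ a] is Robbins' factor at [a - 1]. *)
have rE : r_ a = expR (1 / (12 * (a - 1) + 1)).
  by rewrite /r_; congr (expR (1 / _)); ring.
rewrite mulrC ler_pdivrMr// [leRHS]mulrC ler_pdivlMr ?mulr_gt0//.
apply: le_trans G; rewrite -rE mulrCA mulrA ler_pM2r// ler_pM2l// ler_expR.
(* With [u = x / b] this is [1 + ln (u / (a - 1)) <= u / (a - 1)], so [(a - 1) ln u - u] is at most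
   its value at [u = a - 1]. *)
have := expR_ge1Dx (ln (x / b / (a - 1))).
rewrite lnK ?posrE ?divr_gt0// ln_div ?posrE// -(ler_pM2r m0) divfK ?gt_eqF//.
by lra.
Qed.

End gamma_function_lower_bound.

Theorem corollary3p1 (R : realType)
    (d : measure_display) (T : measurableType d) (P : probability T R)
    (d' : measure_display) (T' : measurableType d') (Q : probability T' R)
    (K : nat) (n : 'I_K -> nat) (sigma : 'I_K -> R)
    (X : forall k : 'I_K, 'I_(n k) -> {RV P >-> R}) (U : {RV Q >-> R})
    (K_ge1 : (1 <= K)%N)
    (n_ge2 : forall k, (2 <= n k)%N)
    (sigma_gt0 : forall k, 0 < sigma k)
    (X_normal : forall k (i : 'I_(n k)),
      has_law (X k i) (normal_prob 0 (sigma k)))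
    (X_indep : mutually_independent
      (fun p : {k : 'I_K & 'I_(n k)} => X (tag p) (tagged p)))
    (U_gamma : has_law U
      (gamma_prob (nu_ n sigma / 2) (2 * mu_ n sigma / nu_ n sigma))) :
  let W : T -> R := W_stat X in
  let mu := mu_ n sigma in
  let nu := nu_ n sigma in
  let Delta := Delta_ n sigma in
  [/\ (dist_Z 1 P W Q U <= (4 * Delta 1%N)%:E)%E,
      (dist_Z 2 P W Q U <=
        (8 * Delta 2%N)%:E +
        (2 * mu)%:E * e_ (nu / 2)%R * (Delta 1%N)%:E)%E &
      2 < nu ->
      (dist_Kol P W Q U <=
        (2 * Num.sqrt (nu * Delta 1%N /
           (mu * Num.sqrt (2 * pi * (nu / 2 - 1)) * r_ (nu / 2))))%:E)%E].
Proof.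
have mu0 := mu_gt0 K_ge1 n_ge2 sigma_gt0; have nu0 := nu_gt0 K_ge1 n_ge2 sigma_gt0.
split.
- exact: (dist_Z1_le K_ge1 n_ge2 sigma_gt0 X_normal X_indep U_gamma).
- exact: (dist_Z2_le K_ge1 n_ge2 sigma_gt0 X_normal X_indep U_gamma).
move=> nu2; set mu := mu_ n sigma in mu0 U_gamma *; set nu := nu_ n sigma in nu0 nu2 U_gamma *.
pose a := nu / 2; pose b := 2 * mu / nu.
have a1 : 1 < a by rewrite ltr_pdivlMr// mul1r.
have a0 : 0 < a := lt_trans ltr01 a1.
have b0 : 0 < b by rewrite divr_gt0// mulr_gt0.
pose Y (q : {k : 'I_K & 'I_(n k)}) : {RV P >-> R} := X (tag q) (tagged q).
have Yn q : has_law (Y q) (normal_prob 0 (sigma (tag q))) by exact: X_normal.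
have s0 (q : {k : 'I_K & 'I_(n k)}) : 0 < sigma (tag q) by [].
pose W := W_stat X.
have mW : measurable_fun setT W.
  have := measurable_int _ (tame_integrable s0 Yn (tame_W_stat n_ge2)).
  by move/measurable_EFinP.
have W0 : P [set w | W w <= 0] = 0%E.
  rewrite -(W_stat_null K_ge1 n_ge2 sigma_gt0 Yn X_indep); congr (P _).
  apply/seteqP; split => w /= W0.
    apply/eqP; rewrite eq_le; apply/andP; split; first exact: W0.
    exact: (W_stat_ge0 n_ge2 (fun q => Y q w)).
  by move/eqP: W0; rewrite eq_le => /andP[W0 _]; exact: W0.
have D0 : 0 <= 4 * Delta_ n sigma 1%N.
  rewrite mulr_ge0// /Delta_; elim/big_rec : _ => // k x _ x0.
  by rewrite le_max x0 orbT.
have s1 : 0 < Num.sqrt (2 * pi * (a - 1)).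
  by rewrite sqrtr_gt0 !mulr_gt0 ?pi_gt0// subr_gt0.
have r0 : 0 < r_ a by exact: expR_gt0.
pose C := (b * Num.sqrt (2 * pi * (a - 1)) * r_ a)^-1.
have C0 : 0 < C.
  by rewrite invr_gt0; apply: mulr_gt0 => //; exact: mulr_gt0.
have pdf0 x : x <= 0 -> gamma_pdf a b x = 0 by rewrite /gamma_pdf leNgt => /negbTE ->.
have := dist_Kol_le mW W0 (measurable_gamma_pdf a b0) (gamma_pdf_ge0 b a0) pdf0
  (fun x => gamma_pdf_le x a1 b0) U_gamma C0 D0
  (dist_Z1_le K_ge1 n_ge2 sigma_gt0 X_normal X_indep U_gamma).
move=> /le_trans; apply; rewrite lee_fin.
(* With [D = 4 Delta], [C] the density bound and [b = 2 mu / nu], the product [2 D C] is [2^2] times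
   the expression under the root in the statement. *)
have sq (z : R) : 2 * Num.sqrt z = Num.sqrt (2 ^+ 2 * z).
  by rewrite sqrtrM ?sqr_ge0// sqrtr_sqr ger0_norm.
rewrite sq /C /b le_eqVlt; apply/orP; left; apply/eqP; congr Num.sqrt.
by rewrite -/a; field; rewrite !gt_eqF.
Qed.
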